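(* Let $(S,\sigma)$ be a real primary Kodaira surface. Then the differentiable type of the pair $(S,\sigma)$ is completely determined by its orbifold fundamental group exact sequence. That is: if $(S,\sigma)$ and $(S',\sigma')$ are real primary Kodaira surfaces whose orbifold fundamental group exact sequences $$1 \to \pi_1(S) \to \hat G \to \mathbb{Z}/2 \to 1 \quad\text{and}\quad 1 \to \pi_1(S') \to \hat G' \to \mathbb{Z}/2 \to 1$$ are isomorphic as extensions, then there is a diffeomorphism $f: S \to S'$ with $f\circ\sigma = \sigma'\circ f$.
   Context: A primary Kodaira surface is a compact complex surface $S$ of the form $\mathbb{C}^2/G$, where $G\cong\pi_1(S)$ is a properly discontinuous group of affine transformations of $\mathbb{C}^2$ acting without fixed points, leaving the 2-form $dz_1\wedge dz_2$ invariant, and such that $H_1(S,\mathbb{Z})\cong \mathbb{Z}\oplus\mathbb{Z}\oplus\mathbb{Z}\oplus\mathbb{Z}/m$ for some integer $m\ge 1$. A real primary Kodaira surface is a pair $(S,\sigma)$ where $S$ is a primary Kodaira surface and $\sigma:S\to S$ is an antiholomorphic involution ($\sigma^2=\mathrm{id}$). The orbifold fundamental group exact sequence of $(S,\sigma)$ is the extension $$1\to\pi_1(S)\to\hat G\to\mathbb{Z}/2\to 1,$$ where $\hat G=\pi_1^{orb}(S/\langle\sigma\rangle)$ is the group of all liftings to the universal covering $\tilde S$ of the elements of $\{\mathrm{id}_S,\sigma\}\cong\mathbb{Z}/2$, and $\pi_1(S)$ is identified with the subgroup of liftings of $\mathrm{id}_S$. (Equivalently: if $\sigma$ has no fixed points,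 $\hat G=\pi_1(S/\langle\sigma\rangle)$; if $\sigma$ has a fixed point $x_0$, $\hat G$ is the semidirect product of the normal subgroup $\pi_1(S,x_0)$ with the group of order two generated by an element acting on $\pi_1(S,x_0)$ by conjugation as $\sigma$ does.) Two such extensions are isomorphic if there is a group isomorphism $\hat G\to\hat G'$ mapping $\pi_1(S)$ isomorphically onto $\pi_1(S')$ and inducing the identity on $\mathbb{Z}/2$. Two pairs $(S,\sigma)$, $(S',\sigma')$ have the same differentiable type if there is a diffeomorphism $f:S\to S'$ with $f\circ\sigma=\sigma'\circ f$. *)

(* Defs.v *)
From HB Require Import structures.
From mathcomp Require Import all_boot all_order all_algebra generic_quotient.
From mathcomp Require Import complex.
From mathcomp Require Import all_classical all_reals all_analysis.
Set Implicit Arguments.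
Unset Strict Implicit.
Unset Printing Implicit Defensive.
Import Order.TTheory GRing.Theory Num.Theory.
Import numFieldNormedType.Exports.
Local Open Scope classical_set_scope.
Local Open Scope ring_scope.
Local Open Scope quotient_scope.

(* [R[i]], packed so that the topology of a [numFieldType] is inferred. *)
Definition Cplx (R : realType) : numFieldType := R[i]%C.

Notation C2 R := 'cV[Cplx R]_2.

Section Differentiability.
Variable R : realType.

Fixpoint Ck (V W : normedModType R) (n : nat) (U : set V) (f : V -> W) : Prop :=
  match n with
  | 0%N => forall x, U x -> {for x, continuous f}
  | n'.+1 => (forall x, U x -> differentiable f x) /\
             (forall v : V, Ck n' U (fun x => 'D_v f x))
  end.

(* The identification of C^2 with R^4, (x1 + i y1, x2 + i y2) being sent to
   (x1, x2, y1, y2). *)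
Definition realify (z : C2 R) : 'cV[R]_4 :=
  col_mx (map_mx (@complex.Re R) z) (map_mx (@complex.Im R) z).

Definition complexify (x : 'cV[R]_4) : C2 R :=
  \col_i Complex (usubmx (x : 'cV[R]_(2 + 2)) i ord0)
                 (dsubmx (x : 'cV[R]_(2 + 2)) i ord0).

(* Smoothness on an open set, in the sense of real differentiability. *)
Definition smooth_on (U : set (C2 R)) (F : C2 R -> C2 R) : Prop :=
  forall n, Ck n (realify @` U) (realify \o F \o complexify).

(* [differentiable] is here taken over the field of complex numbers. *)
Definition holomorphic_on (U : set (C2 R)) (F : C2 R -> C2 R) : Prop :=
  forall z, U z -> differentiable F z.

Definition conj2 (z : C2 R) : C2 R := map_mx (@conjc R) z.

Definition antiholomorphic_on (U : set (C2 R)) (F : C2 R -> C2 R) : Prop :=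
  holomorphic_on U (conj2 \o F).

(* The value of dz_1 /\ dz_2 on a pair of tangent vectors. *)
Definition dz1_dz2 (u v : C2 R) : Cplx R :=
  u ord0 ord0 * v ord_max ord0 - u ord_max ord0 * v ord0 ord0.

End Differentiability.

Section SingularHomology.
Variable R : realType.

Definition std_simplex (n : nat) : set 'rV[R]_n.+1 :=
  [set t | (forall i, 0 <= t ord0 i) /\ \sum_i t ord0 i = 1].
Arguments std_simplex : clear implicits.

Definition insert0 (n : nat) (i : 'I_n.+2) (t : 'rV[R]_n.+1) : 'rV[R]_n.+2 :=
  \row_j (if unlift i j is Some k then t ord0 k else 0).

Lemma insert0_simplex n (i : 'I_n.+2) (t : std_simplex n) :
  insert0 i (set_val t) \in std_simplex n.+1.
Proof.
have /set_mem[t0 t1] := valP t; rewrite inE; split => [j|].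
  by rewrite mxE; case: unlift => [k|]; [exact: t0|exact: lexx].
rewrite (bigD1_ord i) //= mxE unlift_none add0r -[RHS]t1.
by apply: eq_bigr => k _; rewrite mxE liftK.
Qed.

Definition face n (i : 'I_n.+2) (t : std_simplex n) : std_simplex n.+1 :=
  exist _ (insert0 i (set_val t)) (insert0_simplex i t).

Variable X : topologicalType.

(* A chain is a function assigning to every map from the standard simplex to X
   its multiplicity; only finitely many maps, all of them continuous, may have
   nonzero multiplicity. *)
Definition chain (n : nat) : set ((std_simplex n -> X) -> int) :=
  [set c | finite_set [set s | c s != 0] /\
           forall s, c s != 0 -> continuous s].

(* The functional form of c |-> \sum_s c(s) \sum_i (-1)^i (s \o face i). *)
Definition boundary (n : nat) (c : (std_simplex n.+1 -> X) -> int) :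
    (std_simplex n -> X) -> int :=
  fun s => \sum_(t \in [set: std_simplex n.+1 -> X])
    (\sum_(i < n.+2) if t \o face i == s then (-1) ^+ i * c t else 0).

Definition cycles1 : set ((std_simplex 1 -> X) -> int) :=
  [set c | chain c /\ boundary c = 0].

Definition boundaries1 : set ((std_simplex 1 -> X) -> int) :=
  [set c | exists2 b, chain (n := 2) b & boundary b = c].

(* H_1(X, Z) is isomorphic to A: the group of 1-cycles maps onto A, with kernel
   the group of 1-boundaries. *)
Definition H1_isomorphic (A : zmodType) : Prop :=
  exists phi : ((std_simplex 1 -> X) -> int) -> A,
    [/\ {in cycles1 &, {morph phi : c d / c + d}},
        phi @` cycles1 = [set: A] &
        forall c, cycles1 c -> (phi c = 0 <-> boundaries1 c)].

End SingularHomology.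

Section Quotients.
Variable R : realType.

Record affine_group := AffineGroup {
  aff_set : set (C2 R -> C2 R);
  aff_affine : forall g, aff_set g -> exists (A : 'M[Cplx R]_2) (b : C2 R),
    A \in unitmx /\ forall z, g z = A *m z + b;
  aff_id : aff_set id;
  aff_comp : forall g h, aff_set g -> aff_set h -> aff_set (g \o h);
  aff_inv : forall g, aff_set g ->
    exists h, [/\ aff_set h, cancel g h & cancel h g]
}.

Variable G : affine_group.

Definition orbit_rel (z w : C2 R) : bool := `[< exists2 g, aff_set G g & g z = w >].

Lemma orbit_relP : equiv_class_of orbit_rel.
Proof.
have tr : transitive orbit_rel.
  move=> y x z /asboolP[g Gg <-] /asboolP[h Gh <-]; apply/asboolP.
  by exists (h \o g) => //; exact: aff_comp.
have sy x y : orbit_rel x y -> orbit_rel y x.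
  move=> /asboolP[g Gg <-]; apply/asboolP.
  by have [h [Gh gK _]] := aff_inv Gg; exists h.
split=> // [x|x y]; first by apply/asboolP; exists id => //; exact: aff_id.
by apply/idP/idP; exact: sy.
Qed.

Canonical orbit_equiv := EquivRelPack orbit_relP.

(* C^2 / G with its quotient topology. *)
Definition orbit_space : topologicalType :=
  quotient_topology {eq_quot orbit_equiv}.

Definition orbit_pi (z : C2 R) : orbit_space := \pi_({eq_quot orbit_equiv}) z.

Definition properly_discontinuous : Prop :=
  forall K : set (C2 R), compact K ->
    finite_set [set g | aff_set G g /\ (g @` K) `&` K !=set0].

Definition fixed_point_free : Prop :=
  forall g z, aff_set G g -> g z = z -> g = id.

Definition preserves_dz1_dz2 : Prop :=
  forall g, aff_set G g -> forall z u v : C2 R,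
    dz1_dz2 ('d g z u) ('d g z v) = dz1_dz2 u v.

(* Z/m is represented by ['I_k.+1] with m = k + 1, which unlike ['Z_m] is
   correct for m = 1. *)
Definition primary_Kodaira : Prop :=
  [/\ properly_discontinuous, fixed_point_free, preserves_dz1_dz2,
      compact [set: orbit_space] &
      exists k : nat,
        H1_isomorphic R orbit_space (int * int * int * 'I_k.+1)%type].

End Quotients.

Section Maps.
Variables (R : realType).
Implicit Types G H : affine_group R.

(* The manifold structure of C^2 / G is the one for which [orbit_pi G] is a
   local diffeomorphism, and a local biholomorphism: regularity of a map between
   quotients is regularity of its local lifts to C^2. *)
Definition smooth_map G H (f : orbit_space G -> orbit_space H) : Prop :=
  forall z : C2 R, exists U : set (C2 R), exists F : C2 R -> C2 R,
    [/\ open U, U z, smooth_on U F &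
        forall w, U w -> f (orbit_pi G w) = orbit_pi H (F w)].

Definition antiholomorphic_map G H (f : orbit_space G -> orbit_space H) :
    Prop :=
  forall z : C2 R, exists U : set (C2 R), exists F : C2 R -> C2 R,
    [/\ open U, U z, antiholomorphic_on U F &
        forall w, U w -> f (orbit_pi G w) = orbit_pi H (F w)].

Definition diffeomorphism G H (f : orbit_space G -> orbit_space H) : Prop :=
  exists g : orbit_space H -> orbit_space G,
    [/\ cancel f g, cancel g f, smooth_map f & smooth_map g].

Definition real_structure G (sigma : orbit_space G -> orbit_space G) : Prop :=
  antiholomorphic_map sigma /\ forall x, sigma (sigma x) = x.

(* Liftings of tau to the universal covering [orbit_pi G]. *)
Definition liftings G (tau : orbit_space G -> orbit_space G) :
    set (C2 R -> C2 R) :=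
  [set h | continuous h /\ forall z, orbit_pi G (h z) = tau (orbit_pi G z)].

(* pi_1 of C^2 / G, as the group of liftings of the identity. *)
Definition pi1 G : set (C2 R -> C2 R) := @liftings G id.

(* The orbifold fundamental group; its group law is composition. *)
Definition pi1_orb G (sigma : orbit_space G -> orbit_space G) :
    set (C2 R -> C2 R) :=
  pi1 G `|` liftings sigma.

(* The projection of the orbifold fundamental group onto Z/2. *)
Definition orb_proj G (h : C2 R -> C2 R) : 'Z_2 :=
  if `[< pi1 G h >] then 0 else 1.

(* A bijection compatible with composition between two groups of maps is an
   isomorphism of groups. *)
Definition orb_extension_iso G (sigma : orbit_space G -> orbit_space G)
    H (tau : orbit_space H -> orbit_space H) : Prop :=
  exists phi : (C2 R -> C2 R) -> (C2 R -> C2 R),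
    [/\ set_bij (pi1_orb sigma) (pi1_orb tau) phi,
        forall h k, pi1_orb sigma h -> pi1_orb sigma k ->
          phi (h \o k) = phi h \o phi k,
        phi @` pi1 G = pi1 H &
        forall h, pi1_orb sigma h -> orb_proj H (phi h) = orb_proj G h].

End Maps.

(* Main.v *)
(* Being fixed point free and volume preserving, the affine maps in G are
   unipotent with a common eigenvector: in suitable coordinates
   g (x, y) = (x + a g, y + c g x + b g).  If G is abelian then c can be
   normalised to 0, and otherwise to conj a.  An isomorphism of groups is then
   given by real-linear maps on the values of a and b, since an additive map on a
   lattice extends to a real-linear one; hence it is induced by an equivariant
   polynomial diffeomorphism of C^2.  An antiholomorphic map which is equivariant
   differs from the corresponding polynomial map by a bounded function, and by
   Liouville's theorem by a constant.  So the liftings of sigma and sigma' are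
   polynomial of the same form, and a translation, found by halving the defect,
   makes the diffeomorphism intertwine them; it then descends to the quotients. *)
Require Import Defs.
From mathcomp Require Import all_boot all_order all_algebra generic_quotient complex ring lra.
From mathcomp Require Import all_classical all_reals all_analysis.
Set Implicit Arguments.
Unset Strict Implicit.
Unset Printing Implicit Defensive.
Import Order.TTheory GRing.Theory Num.Theory.
Import numFieldNormedType.Exports.
Local Open Scope classical_set_scope.
Local Open Scope ring_scope.

(** * Cauchy's theorem on rectangles and Liouville's theorem *)

(** The values of [a] and [b] are not known in advance to form lattices. Two soft facts replace
    this. A continuous invariant function on C^2 is bounded, since it lives on a compact quotient;
    applied to real parts of coordinates, this shows that the values span over the reals. And an
    additive relation over a spanning subgroup which is bounded over bounded sets is part of a
    real-linear map. The bounds come from proper discontinuity, and in the non-abelian case from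
    counting commutators, which are central.

    In the non-abelian case the comparison map needs a quadratic correction in x and conj x. It
    exists only if a certain bilinear expression is symmetric, and the alternating part of that
    expression is exactly what commutators control.

    The comparison map is merely smooth, so function theory is needed for the lifts of [sigma] and
    [sigma'] alone. It is applied on one coordinate line at a time: second differences turn a
    function close to a quadratic one into a bounded entire function, so Liouville's theorem in one
    variable is enough. *)

Section ComplexTopology.
Variable R : realType.
Local Notation C := (Cplx R).
Implicit Types z w : C.

(** The norm of the numeric field [Cplx R] takes its values in [Cplx R]; a modulus in [R] makes
    estimates accessible to ordered-field arithmetic. *)
Definition cabs (z : C) : R := Normc.normc (z : R[i]%C).

Lemma cabsE z : `|z| = (cabs z)%:C%C.
Proof. by []. Qed.

Lemma cabs_ge0 z : 0 <= cabs z.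
Proof. by rewrite -ler0c; exact: (normr_ge0 z). Qed.

Lemma cabsM z w : cabs (z * w) = cabs z * cabs w.
Proof. exact: Normc.normcM. Qed.

Lemma cabsD z w : cabs (z + w) <= cabs z + cabs w.
Proof. exact: le_normcD. Qed.

Lemma cabsN z : cabs (- z) = cabs z.
Proof. exact: normcN. Qed.

Lemma cabsD4 (a b c d : C) : cabs (a + b + c + d) <= cabs a + cabs b + cabs c + cabs d.
Proof.
apply: le_trans (cabsD _ _) _; rewrite lerD2r.
by apply: le_trans (cabsD _ _) _; rewrite lerD2r; exact: cabsD.
Qed.

Lemma cabs0 : cabs 0 = 0.
Proof. exact: Normc.normc0. Qed.

Lemma cabs_eq0 z : cabs z = 0 -> z = 0.
Proof. exact: Normc.eq0_normc. Qed.

Lemma cabs_conj z : cabs (conjc z) = cabs z.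
Proof. by case: z => a b; rewrite /cabs /= sqrrN. Qed.

Lemma cabs_real (x : R) : cabs (x%:C%C) = `|x|.
Proof. by rewrite /cabs /= expr0n addr0 sqrtr_sqr. Qed.

Lemma cabs_i (x : R) : cabs (Complex 0 x) = `|x|.
Proof. by rewrite /cabs /= expr0n add0r sqrtr_sqr. Qed.

Lemma Re_le_cabs z : `|complex.Re z| <= cabs z.
Proof. by rewrite -lecR; exact: (normc_ge_Re z). Qed.

Lemma Im_le_cabs z : `|complex.Im z| <= cabs z.
Proof.
case: z => a b; rewrite /cabs /= -[leLHS]sqrtr_sqr ler_wsqrtr // lerDr.
exact: sqr_ge0.
Qed.

Lemma cabs_le_ReIm z : cabs z <= `|complex.Re z| + `|complex.Im z|.
Proof.
case: z => a b /=; rewrite -(cabs_real a) -(cabs_i b).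
by apply: le_trans (cabsD _ _); rewrite /cabs /= addr0 add0r.
Qed.

(** A positive radius in [Cplx R] is real, so the balls of the topology are the balls of [cabs]. *)
Lemma nbhs_cabs z (A : set C) :
  nbhs z A <-> exists2 e : R, 0 < e & forall w, cabs (w - z) < e -> A w.
Proof.
split=> [/nbhs_ballP[e /= e0 eA]|[e e0 eA]].
  have er : e \is Num.real by exact: gtr0_real.
  have ee : e = (complex.Re e)%:C%C by rewrite RRe_real.
  exists (complex.Re e).
    by rewrite -ltcR -ee.
  move=> w we; apply: eA; rewrite /ball /= ee.
  by rewrite -opprB normrN cabsE ltcR.
apply/nbhs_ballP; exists (e%:C%C) => /=; first by rewrite ltcR.
by move=> w; rewrite /ball /= -opprB normrN cabsE ltcR; exact: eA.
Qed.

Lemma near_cabs z (P : C -> Prop) :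
  (\forall w \near z, P w) <-> exists2 e : R, 0 < e & forall w, cabs (w - z) < e -> P w.
Proof. exact: (nbhs_cabs z P). Qed.

Lemma cvg_near_cabs (V : normedModType R) (f : C -> V) z :
  (forall e : R, 0 < e -> exists2 d : R, 0 < d &
     forall w, cabs (w - z) < d -> `|f w - f z| < e) ->
  {for z, continuous f}.
Proof.
move=> H; rewrite /prop_for /continuous_at.
apply: (proj2 (@cvgrPdist_lt _ _ _ _ (nbhs_filter z) _ _)) => e e0; apply/near_cabs.
by have [d d0 dH] := H e e0; exists d => // w /dH; rewrite distrC.
Qed.

End ComplexTopology.

(** * Primitives on real intervals, in place of line integrals *)

Section Primitives.
Variable R : realType.
Local Notation C := (Cplx R).

Lemma primitive_exists (L : R) (u : R -> R) : continuous u ->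
  exists U : R -> R, forall x, - L < x < L -> is_derive x 1 U (u x).
Proof.
move=> cu; exists (fun x => \int[lebesgue_measure]_(t in `[- L, x]) u t)%R => x.
move=> /andP[Lx xL].
have ui : (@lebesgue_measure R).-integrable `[- L, L] (EFin \o u).
  apply: continuous_compact_integrable; first exact: segment_compact.
  by apply: continuous_subspaceT => y; exact: cu.
have [du uE] := continuous_FTC1_closed xL ui Lx (cu x).
by apply: (DeriveDef du); rewrite -derive1E.
Qed.

(** The mean value theorem. All integral estimates below reduce to it, upper bounds by a change of
    sign. *)
Lemma increment_ge (U u : R -> R) (a b m : R) : a <= b ->
  (forall x, a <= x <= b -> is_derive x 1 U (u x)) ->
  (forall x, a <= x <= b -> m <= u x) -> m * (b - a) <= U b - U a.
Proof.
move=> ab dU mu; have [<-|neq] := eqVneq a b; first by rewrite !subrr mulr0.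
have ltab : a < b by rewrite lt_neqAle neq.
have [||c] := @MVT _ U u a b ltab.
- by move=> x /[!in_itv] /= /andP[/ltW ? /ltW ?]; apply: dU; apply/andP.
- apply: derivable_within_continuous => x /[!in_itv] /= xab.
  by have [] := dU x xab.
rewrite in_itv /= => /andP[/ltW ac /ltW cb] ->.
by rewrite ler_wpM2r ?subr_ge0 // mu // ac.
Qed.

(** [Cplx R] is normed over itself, so a derivative in a real variable is taken on real and
    imaginary parts. *)
Definition cprim (L : R) (u U : R -> C) :=
  forall x, - L < x < L ->
    is_derive x 1 (fun t => complex.Re (U t) : R) (complex.Re (u x)) /\
    is_derive x 1 (fun t => complex.Im (U t) : R) (complex.Im (u x)).

Lemma continuous_Re : continuous (fun z : C => complex.Re z : R).
Proof.
move=> z; apply: (@cvg_near_cabs R R^o) => e e0; exists e => // w wz.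
apply: le_lt_trans wz.
have -> : complex.Re w - complex.Re z = complex.Re (w - z).
  by case: (w) (z) => [? ?] [? ?].
exact: Re_le_cabs.
Qed.

Lemma continuous_Im : continuous (fun z : C => complex.Im z : R).
Proof.
move=> z; apply: (@cvg_near_cabs R R^o) => e e0; exists e => // w wz.
apply: le_lt_trans wz.
have -> : complex.Im w - complex.Im z = complex.Im (w - z).
  by case: (w) (z) => [? ?] [? ?].
exact: Im_le_cabs.
Qed.

Lemma cprim_exists L (u : R -> C) : continuous u -> exists U, cprim L u U.
Proof.
move=> cu.
have [U1 H1] : exists U : R -> R, forall x, - L < x < L ->
    is_derive x 1 U (complex.Re (u x)).
  by apply: primitive_exists => x; apply: continuous_comp;
    [exact: cu|exact: continuous_Re].
have [U2 H2] : exists U : R -> R, forall x, - L < x < L ->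
    is_derive x 1 U (complex.Im (u x)).
  by apply: primitive_exists => x; apply: continuous_comp;
    [exact: cu|exact: continuous_Im].
by exists (fun x => Complex (U1 x) (U2 x)) => x xL; split; [exact: H1|exact: H2].
Qed.

(** [c * x + e * (x ^+ 2 / 2)] is a primitive of the affine comparison function; its difference to
    [U] has derivative at most [M] in absolute value. *)
Lemma real_increment (U u : R -> R) (a b c e M : R) : a <= b ->
  (forall x, a <= x <= b -> is_derive x 1 U (u x)) ->
  (forall x, a <= x <= b -> `|u x - (c + e * x)| <= M) ->
  `|U b - U a - (c * (b - a) + e * ((b ^+ 2 - a ^+ 2) / 2))| <= M * (b - a).
Proof.
move=> ab dU uM.
have P (x : R) : is_derive x (1:R) (fun x : R => c * x + e * (x ^+ 2 / 2)) (c + e * x).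
  apply: is_derive_eq; rewrite /GRing.scale /=; lra.
have lo : - M * (b - a) <= (U b - (c * b + e * (b ^+ 2 / 2)))
     - (U a - (c * a + e * (a ^+ 2 / 2))).
  apply: (@increment_ge (fun x => U x - (c * x + e * (x ^+ 2 / 2)))
     (fun x => u x - (c + e * x))) => // x xab.
    by have := dU x xab => ?; apply: is_deriveB.
  by have := uM x xab; rewrite ler_norml => /andP[].
have hi : - M * (b - a) <= ((c * b + e * (b ^+ 2 / 2)) - U b)
     - ((c * a + e * (a ^+ 2 / 2)) - U a).
  apply: (@increment_ge (fun x => (c * x + e * (x ^+ 2 / 2)) - U x)
     (fun x => (c + e * x) - u x) a b _ ab) => x xab.
    by have := dU x xab => ?; apply: is_deriveB.
  by have := uM x xab; rewrite ler_norml => /andP[_]; lra.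
by rewrite ler_norml; apply/andP; split; lra.
Qed.

Lemma cprim_increment L (u U : R -> C) (a b M : R) (c e : C) : cprim L u U ->
  - L < a -> a <= b -> b < L ->
  (forall x, a <= x <= b -> cabs (u x - (c + e * x%:C%C)) <= M) ->
  cabs (U b - U a - (c * (b - a)%:C%C + e * ((b ^+ 2 - a ^+ 2) / 2)%:C%C))
    <= 2 * M * (b - a).
Proof.
move=> pU La ab bL uM.
have inL x : a <= x <= b -> - L < x < L.
  by move=> /andP[ax xb]; rewrite (lt_le_trans La ax) (le_lt_trans xb bL).
apply: le_trans (cabs_le_ReIm _) _.
case: c e uM => [c1 c2] [e1 e2] uM.
have h1 := @real_increment (fun t => complex.Re (U t)) (fun t => complex.Re (u t))
   a b c1 e1 M ab.
have h2 := @real_increment (fun t => complex.Im (U t)) (fun t => complex.Im (u t))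
   a b c2 e2 M ab.
have -> : 2 * M * (b - a) = M * (b - a) + M * (b - a) by lra.
have E1 (x y : C) (r s : R) : complex.Re (x - y - (Complex c1 c2 * r%:C%C +
     Complex e1 e2 * s%:C%C)) = complex.Re x - complex.Re y - (c1 * r + e1 * s).
  by case: x y => [x1 x2] [y1 y2] /=; rewrite !mulr0 !subr0.
have E2 (x y : C) (r s : R) : complex.Im (x - y - (Complex c1 c2 * r%:C%C +
     Complex e1 e2 * s%:C%C)) = complex.Im x - complex.Im y - (c2 * r + e2 * s).
  by case: x y => [x1 x2] [y1 y2] /=; rewrite !mulr0 !add0r.
rewrite E1 E2; apply: lerD.
  apply: h1 => x xab; first by have [] := pU x (inL x xab).
  apply: le_trans (uM x xab); apply: le_trans (Re_le_cabs _).
  by case: (u x) => [x1 x2] /=; rewrite !mulr0 !subr0.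
apply: h2 => x xab; first by have [] := pU x (inL x xab).
apply: le_trans (uM x xab); apply: le_trans (Im_le_cabs _).
by case: (u x) => [x1 x2] /=; rewrite !mulr0 !add0r.
Qed.

End Primitives.

Lemma nested_intervals (R : realType) (x l : nat -> R) :
  (forall n, 0 <= l n) -> (forall n, x n <= x n.+1) ->
  (forall n, x n.+1 + l n.+1 <= x n + l n) ->
  exists z, forall n, x n <= z <= x n + l n.
Proof.
move=> l0 xS xlS.
have incr n m : (n <= m)%N -> x n <= x m.
  elim: m => [|m IH]; first by rewrite leqn0 => /eqP ->.
  by rewrite leq_eqVlt => /orP[/eqP -> //|/IH] /le_trans; apply.
have decr n m : (n <= m)%N -> x m + l m <= x n + l n.
  elim: m => [|m IH]; first by rewrite leqn0 => /eqP ->.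
  by rewrite leq_eqVlt => /orP[/eqP -> //|/IH]; exact: le_trans.
have ub n : ubound (range x) (x n + l n).
  move=> _ [m _ <-]; have [nm|mn] := leqP n m.
    by apply: le_trans (decr _ _ nm); rewrite lerDl.
  by apply: le_trans (incr _ _ (ltnW mn)) _; rewrite lerDl.
exists (sup (range x)) => n; apply/andP; split; last first.
  by apply: ge_sup; [exists (x 0%N), 0%N|exact: ub].
apply: sup_upper_bound; last by exists n.
by split; [exists (x 0%N), 0%N|exists (x 0%N + l 0%N)].
Qed.

(** * Cauchy's theorem for a rectangle, by bisection *)

Section Goursat.
Variable R : realType.
Local Notation C := (Cplx R).
Variables (L : R) (f : C -> C) (P Q : R -> R -> C).
Hypothesis primP : forall y, cprim L (fun x => f (Complex x y)) (P y).
Hypothesis primQ : forall x, cprim L (fun y => f (Complex x y)) (Q x).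

Definition ci : C := Complex 0 1.

(* The integral of [f] along the boundary of a rectangle, in terms of primitives
   [P y] and [Q x] of [f] along horizontal and vertical lines; in this form its
   additivity under subdivision is an algebraic identity. *)
Definition mu x1 x2 y1 y2 : C :=
  (P y1 x2 - P y1 x1) + ci * (Q x2 y2 - Q x2 y1)
  - (P y2 x2 - P y2 x1) - ci * (Q x1 y2 - Q x1 y1).

Lemma mu_quarter x1 x2 y1 y2 xm ym :
  mu x1 x2 y1 y2 = mu x1 xm y1 ym + mu xm x2 y1 ym
                 + mu x1 xm ym y2 + mu xm x2 ym y2.
Proof. by rewrite /mu; ring. Qed.

(** A strip of full width below, one above, a piece on either side, and the inner rectangle, which
    later contains the singular point. *)
Lemma mu_annulus x1 x2 y1 y2 p1 p2 q1 q2 :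
  mu x1 x2 y1 y2 = mu x1 x2 y1 q1 + mu x1 x2 q2 y2
                 + mu x1 p1 q1 q2 + mu p2 x2 q1 q2 + mu p1 p2 q1 q2.
Proof. by rewrite /mu; ring. Qed.

Lemma cabs_ci z : cabs (ci * z) = cabs z.
Proof. by rewrite cabsM /ci (cabs_i 1) normr1 mul1r. Qed.

(** The boundary integral of an affine function of the complex variable vanishes, so only the
    remainder contributes; [cprim_increment] allows [2 * M] per unit length of the boundary. *)
Lemma mu_estimate x1 x2 y1 y2 (c d : C) M :
  - L < x1 -> x1 <= x2 -> x2 < L -> - L < y1 -> y1 <= y2 -> y2 < L ->
  (forall x y, x1 <= x <= x2 -> y1 <= y <= y2 ->
     cabs (f (Complex x y) - (c + d * (Complex x y : C))) <= M) ->
  cabs (mu x1 x2 y1 y2) <= 4 * M * ((x2 - x1) + (y2 - y1)).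
Proof.
move=> Lx1 x12 x2L Ly1 y12 y2L H.
have x1x : x1 <= x1 <= x2 by rewrite lexx.
have x2x : x1 <= x2 <= x2 by rewrite lexx x12.
have y1y : y1 <= y1 <= y2 by rewrite lexx.
have y2y : y1 <= y2 <= y2 by rewrite lexx y12.
have hE x y : c + d * (Complex x y : C) = (c + d * ci * y%:C%C) + d * x%:C%C.
  case: (c) (d) => [c1 c2] [d1 d2]; apply/eqP; rewrite eq_complex /=.
  by apply/andP; split; apply/eqP; ring.
have vE x y : c + d * (Complex x y : C) = (c + d * x%:C%C) + d * ci * y%:C%C.
  by rewrite hE; ring.
have e1 : cabs (P y1 x2 - P y1 x1 - ((c + d * ci * y1%:C%C) * (x2 - x1)%:C%C
    + d * ((x2 ^+ 2 - x1 ^+ 2) / 2)%:C%C)) <= 2 * M * (x2 - x1).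
  by apply: cprim_increment (primP y1) _ _ _ _ => // x hx; rewrite -hE H.
have e3 : cabs (P y2 x2 - P y2 x1 - ((c + d * ci * y2%:C%C) * (x2 - x1)%:C%C
    + d * ((x2 ^+ 2 - x1 ^+ 2) / 2)%:C%C)) <= 2 * M * (x2 - x1).
  by apply: cprim_increment (primP y2) _ _ _ _ => // x hx; rewrite -hE H.
have e2 : cabs (Q x2 y2 - Q x2 y1 - ((c + d * x2%:C%C) * (y2 - y1)%:C%C
    + d * ci * ((y2 ^+ 2 - y1 ^+ 2) / 2)%:C%C)) <= 2 * M * (y2 - y1).
  by apply: cprim_increment (primQ x2) _ _ _ _ => // y hy; rewrite -vE H.
have e4 : cabs (Q x1 y2 - Q x1 y1 - ((c + d * x1%:C%C) * (y2 - y1)%:C%C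
    + d * ci * ((y2 ^+ 2 - y1 ^+ 2) / 2)%:C%C)) <= 2 * M * (y2 - y1).
  by apply: cprim_increment (primQ x1) _ _ _ _ => // y hy; rewrite -vE H.
move: e1 e2 e3 e4.
set l1 := (X in cabs (P y1 x2 - P y1 x1 - X)).
set l2 := (X in cabs (Q x2 y2 - Q x2 y1 - X)).
set l3 := (X in cabs (P y2 x2 - P y2 x1 - X)).
set l4 := (X in cabs (Q x1 y2 - Q x1 y1 - X)).
have l0 : l1 + ci * l2 - l3 - ci * l4 = 0.
  rewrite /l1 /l2 /l3 /l4; case: (c) (d) => [c1 c2] [d1 d2].
  apply/eqP; rewrite eq_complex /=.
  by apply/andP; split; apply/eqP; field.
move=> e1 e2 e3 e4.
have -> : mu x1 x2 y1 y2 = (P y1 x2 - P y1 x1 - l1) + ci * (Q x2 y2 - Q x2 y1 - l2)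
  - (P y2 x2 - P y2 x1 - l3) - ci * (Q x1 y2 - Q x1 y1 - l4).
  rewrite -[LHS]subr0 -l0 /mu; ring.
by apply: le_trans (cabsD4 _ _ _ _) _; rewrite !cabsN !cabs_ci; lra.
Qed.

Definition cdiff (f : C -> C) (z : C) :=
  exists d : C, forall e : R, 0 < e -> exists2 r : R, 0 < r &
    forall w, cabs (w - z) < r -> cabs (f w - f z - d * (w - z)) <= e * cabs (w - z).

Lemma goursat x1 x2 y1 y2 :
  - L < x1 -> x1 <= x2 -> x2 < L -> - L < y1 -> y1 <= y2 -> y2 < L ->
  (forall x y, x1 <= x <= x2 -> y1 <= y <= y2 -> cdiff f (Complex x y)) ->
  mu x1 x2 y1 y2 = 0.
Proof.
move=> Lx1 x12 x2L Ly1 y12 y2L df.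
pose s n : R := (x2 - x1) * 2^-1 ^+ n.
pose t n : R := (y2 - y1) * 2^-1 ^+ n.
have s0 n : 0 <= s n by rewrite mulr_ge0 ?subr_ge0 // exprn_ge0 // invr_ge0.
have t0 n : 0 <= t n by rewrite mulr_ge0 ?subr_ge0 // exprn_ge0 // invr_ge0.
have sS n : s n = s n.+1 + s n.+1 by rewrite /s exprS; lra.
have tS n : t n = t n.+1 + t n.+1 by rewrite /t exprS; lra.
pose m n (p : R * R) := mu p.1 (p.1 + s n) p.2 (p.2 + t n).
(* Some quarter of the rectangle carries at least a quarter of the modulus of [mu]; otherwise
   [mu_quarter] would give a strict inequality. The level is carried along with the corner because
   the side lengths depend on it. *)
have step (np : nat * (R * R)) : exists q : R * R,
    [/\ np.2.1 <= q.1, q.1 + s np.1.+1 <= np.2.1 + s np.1,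
       np.2.2 <= q.2, q.2 + t np.1.+1 <= np.2.2 + t np.1 &
       cabs (m np.1 np.2) <= 4 * cabs (m np.1.+1 q)].
  case: np => n [x y] /=; apply: contrapT => no.
  have B a b : (a = x \/ a = x + s n.+1) -> (b = y \/ b = y + t n.+1) ->
      4 * cabs (m n.+1 (a, b)) < cabs (m n (x, y)).
    move=> ha hb; rewrite ltNge; apply/negP => le; apply: no; exists (a, b) => /=.
    have h1 := s0 n.+1; have h2 := t0 n.+1; have h3 := sS n; have h4 := tS n.
    by split=> //; case: ha => ha; case: hb => hb; lra.
  have b1 := B _ _ (or_introl erefl) (or_introl erefl).
  have b2 := B _ _ (or_introl erefl) (or_intror erefl).
  have b3 := B _ _ (or_intror erefl) (or_introl erefl).
  have b4 := B _ _ (or_intror erefl) (or_intror erefl).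
  have : cabs (m n (x, y)) <= cabs (m n.+1 (x, y)) + cabs (m n.+1 (x + s n.+1, y))
     + cabs (m n.+1 (x, y + t n.+1)) + cabs (m n.+1 (x + s n.+1, y + t n.+1)).
    rewrite /m /= (mu_quarter _ _ _ _ (x + s n.+1) (y + t n.+1)).
    rewrite (sS n) (tS n) !(addrA x, addrA y).
    exact: cabsD4.
  lra.
have [g gP] := choice step.
pose p := nat_rect (fun=> (R * R)%type) (x1, y1) (fun n q => g (n, q)).
have [xs xsP] : exists z, forall n, (p n).1 <= z <= (p n).1 + s n.
  by apply: nested_intervals => // n; have [] := gP (n, p n).
have [ys ysP] : exists z, forall n, (p n).2 <= z <= (p n).2 + t n.
  by apply: nested_intervals => // n; have [] := gP (n, p n).
have pin n : [/\ x1 <= (p n).1, (p n).1 + s n <= x2, y1 <= (p n).2 &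
   (p n).2 + t n <= y2].
  elim: n => [|n [h1 h2 h3 h4]]; first by rewrite /= /s /t !mulr1; split; lra.
  by have /= [k1 k2 k3 k4 _] := gP (n, p n); split=> /=; lra.
have mp n : cabs (mu x1 x2 y1 y2) <= 4 ^+ n * cabs (m n (p n)).
  elim: n => [|n IH].
    by rewrite mul1r /m /= /s /t !mulr1 !(addrC x1, addrC y1) !subrK.
  apply: le_trans IH _; rewrite exprSr -mulrA ler_wpM2l ?exprn_ge0 //.
  by have /= [] := gP (n, p n).
pose D := (x2 - x1) + (y2 - y1).
have D0 : 0 <= D by rewrite addr_ge0 ?subr_ge0.
have fz : cdiff f (Complex xs ys).
  have := xsP 0%N; have := ysP 0%N; rewrite /= /s /t !mulr1 => hy hx.
  by apply: df; lra.
apply: cabs_eq0; apply/eqP; rewrite eq_le cabs_ge0 andbT.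
apply/ler_addgt0Pl => e e0; rewrite addr0.
have [d dP] := fz.
(* At level [n] the estimate is [4 * e' * D ^+ 2] divided by [4 ^+ n], and the factor from the
   bisection cancels the power of 4. The [+ 1] covers [D = 0]. *)
pose e' := e / (8 * D ^+ 2 + 1).
have D1 : 0 < 8 * D ^+ 2 + 1 by rewrite ltr_wpDl // mulr_ge0 // sqr_ge0.
have e'0 : 0 < e' by rewrite divr_gt0.
have [r r0 rP] := dP e' e'0.
have [n nP] : exists n, D * 2^-1 ^+ n < r.
  have : (fun n => D * 2^-1 ^+ n) @ \oo --> (D * 0 : R).
    by apply: cvgMr; apply: cvg_expr; rewrite ger0_norm; lra.
  rewrite mulr0 => /cvgrPdist_lt /(_ r r0) [N _ /(_ N (leqnn N))] /=.
  rewrite sub0r normrN ger0_norm; first by exists N.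
  by rewrite mulr_ge0 // exprn_ge0.
have := mp n; rewrite /m.
have [h1 h2 h3 h4] := pin n.
have stD : s n + t n = D * 2^-1 ^+ n by rewrite [in RHS]/D mulrDl.
have est : cabs (mu (p n).1 ((p n).1 + s n) (p n).2 ((p n).2 + t n)) <=
    4 * (e' * (D * 2^-1 ^+ n)) * (s n + t n).
  have -> : s n + t n = ((p n).1 + s n - (p n).1) + ((p n).2 + t n - (p n).2).
    by lra.
  have := s0 n; have := t0 n => t0n s0n.
  apply: (@mu_estimate _ _ _ _ (f (Complex xs ys) - d * (Complex xs ys : C)) d);
    try lra.
  move=> x y hx hy.
  have close : cabs ((Complex x y : C) - Complex xs ys) <= D * 2^-1 ^+ n.
    rewrite -stD; apply: le_trans (cabs_le_ReIm _) _; rewrite /=.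
    have := xsP n; have := ysP n => hys hxs.
    by apply: lerD; rewrite ler_norml; apply/andP; split; lra.
  have -> : f (Complex x y) - (f (Complex xs ys) - d * (Complex xs ys : C)
      + d * (Complex x y : C)) = f (Complex x y) - f (Complex xs ys)
       - d * ((Complex x y : C) - Complex xs ys) by ring.
  apply: le_trans (rP _ (le_lt_trans close nP)) _.
  by rewrite ler_wpM2l // ltW.
have p40 : 0 <= (4 : R) ^+ n by rewrite exprn_ge0.
move=> /le_trans; apply; apply: le_trans (ler_wpM2l p40 est) _.
rewrite stD.
have -> : 4 ^+ n * (4 * (e' * (D * 2^-1 ^+ n)) * (D * 2^-1 ^+ n))
   = 4 * e' * D ^+ 2 * (4 * (2^-1 * 2^-1)) ^+ n :> R.
  by rewrite !exprMn; ring.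
have -> : 4 * (2^-1 * 2^-1) = 1 :> R by field.
rewrite expr1n mulr1 /e'.
have -> : 4 * (e / (8 * D ^+ 2 + 1)) * D ^+ 2 = e * (4 * D ^+ 2 / (8 * D ^+ 2 + 1)).
  by ring.
rewrite ger_pMr // ler_pdivrMr // mul1r.
by have := sqr_ge0 D; lra.
Qed.

End Goursat.

Section MoreTopology.
Variable R : realType.
Local Notation C := (Cplx R).

Lemma cvg_toC (T : topologicalType) (f : T -> C) (x : T) :
  (forall e : R, 0 < e -> \forall y \near x, cabs (f y - f x) < e) ->
  {for x, continuous f}.
Proof.
move=> H; rewrite /prop_for /continuous_at => A /= /nbhs_cabs [e e0 eA].
by apply: filterS (H e e0) => y; exact: eA.
Qed.

Lemma cabs_triangle (z w : C) : `|cabs z - cabs w| <= cabs (z - w).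
Proof.
have h1 : cabs z <= cabs (z - w) + cabs w by rewrite -{1}(subrK w z) cabsD.
have h2 : cabs w <= cabs (z - w) + cabs z.
  by rewrite -(cabsN (z - w)) opprB -{1}(subrK z w) cabsD.
by rewrite ler_norml; apply/andP; split; lra.
Qed.

Lemma continuous_cabs : continuous (@cabs R : C -> R).
Proof.
move=> z; apply: (@cvg_near_cabs R R^o) => e e0; exists e => // w wz.
exact: le_lt_trans (cabs_triangle _ _) wz.
Qed.

Lemma continuous_conj : continuous (@conjc R : C -> C).
Proof.
move=> z; apply: cvg_toC => e e0; apply/near_cabs; exists e => // w.
by rewrite -cabs_conj rmorphB.
Qed.

Lemma continuous_ofreal : continuous (fun x : R => x%:C%C : C).
Proof.
move=> x; apply: cvg_toC => e e0; near=> y.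
rewrite -rmorphB cabs_real distrC; near: y.
exact: (proj1 (@cvgrPdist_lt _ R^o _ (nbhs x) _ id x) cvg_id).
Unshelve. all: by end_near. Qed.

Lemma continuous_Complex_l (y : R) : continuous (fun x : R => Complex x y : C).
Proof.
move=> x; apply: cvg_toC => e e0; near=> t.
have -> : (Complex t y : C) - Complex x y = (t - x)%:C%C.
  by apply/eqP; rewrite eq_complex /= subrr !eqxx.
rewrite cabs_real distrC; near: t.
exact: (proj1 (@cvgrPdist_lt _ R^o _ (nbhs x) _ id x) cvg_id).
Unshelve. all: by end_near. Qed.

Lemma continuous_Complex_r (x : R) : continuous (fun y : R => Complex x y : C).
Proof.
move=> y; apply: cvg_toC => e e0; near=> t.
have -> : (Complex x t : C) - Complex x y = Complex 0 (t - y).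
  by apply/eqP; rewrite eq_complex /= subrr !eqxx.
rewrite cabs_i distrC; near: t.
exact: (proj1 (@cvgrPdist_lt _ R^o _ (nbhs y) _ id y) cvg_id).
Unshelve. all: by end_near. Qed.

Definition entire (f : C -> C) := forall z : C, differentiable (f : C^o -> C^o) z.

Lemma differentiable_cdiff (f : C -> C) z :
  differentiable (f : C^o -> C^o) z -> cdiff f z.
Proof.
move=> /derivable1_diffP df.
exists ('D_1 (f : C^o -> C^o) z) => e e0.
have := df; rewrite /derivable => /(@cvgrPdist_lt _ C^o) /(_ (e%:C%C)).
rewrite ltcR => /(_ e0) /nbhs_cabs [r r0 rP].
exists r => // w wz.
have [->|neq] := eqVneq w z.
  by rewrite !subrr mulr0 subrr cabs0 mulr0.
have h0 : w - z != 0 by rewrite subr_eq0.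
have := rP (w - z); rewrite subr0 => /(_ wz h0).
rewrite /= -/('D_1 f z) /GRing.scale /= mulr1 subrK => H.
have {}H : cabs ('D_1 (f : C^o -> C^o) z - (w - z)^-1 * (f w - f z)) < e.
  by rewrite -ltcR -cabsE.
have -> : f w - f z - 'D_1 (f : C^o -> C^o) z * (w - z) =
   - ('D_1 (f : C^o -> C^o) z - (w - z)^-1 * (f w - f z)) * (w - z).
  by field.
by rewrite cabsM cabsN ler_wpM2r ?cabs_ge0 // ltW.
Qed.

Lemma entire_continuous f : entire f -> continuous f.
Proof. by move=> ef z; exact: (differentiable_continuous (ef z)). Qed.

End MoreTopology.

(** * Bounded entire functions have derivative zero *)

Section Liouville.
Variable R : realType.
Local Notation C := (Cplx R).

Lemma near_cdiff (f g : C -> C) z (r : R) : 0 < r ->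
  (forall w, cabs (w - z) < r -> f w = g w) -> cdiff g z -> cdiff f z.
Proof.
move=> r0 fg [d dP]; exists d => e e0; have [s s0 sP] := dP e e0.
exists (Num.min r s); first by rewrite lt_min r0.
move=> w; rewrite lt_min => /andP[wr ws]; rewrite (fg w wr) (fg z) ?sP //.
by rewrite subrr cabs0.
Qed.

(* [1/z] cut off near the origin so as to be continuous. *)
Definition cutinv (n : R) (z : C) : C :=
  conjc z * (((cabs z ^+ 2 + n + `|cabs z ^+ 2 - n|) / 2)^-1)%:C%C.

Lemma mul_conj (z : C) : z * conjc z = (cabs z ^+ 2)%:C%C.
Proof. by rewrite -sqr_normc cabsE rmorphXn. Qed.

Lemma cutinvE n z : 0 < n -> n <= cabs z ^+ 2 -> cutinv n z = z^-1.
Proof.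
move=> n0 nz; rewrite /cutinv ger0_norm ?subr_ge0 //.
have -> : (cabs z ^+ 2 + n + (cabs z ^+ 2 - n)) / 2 = cabs z ^+ 2 by field.
have z0 : z != 0 by apply/eqP => z0; move: nz; rewrite z0 cabs0 expr0n /=; lra.
have cz0 : (cabs z ^+ 2)%:C%C != 0 :> C.
  by rewrite -mul_conj mulf_neq0 // conjc_eq0.
rewrite fmorphV /=; apply: (mulfI cz0); rewrite mulrCA divff // mulr1.
by rewrite -mul_conj mulrAC divff ?mul1r.
Qed.

Lemma continuous_cutinv n : 0 < n -> continuous (cutinv n : C -> C).
Proof.
move=> n0 z.
apply: (@continuousM _ C (@conjc R)
  (fun z => (((cabs z ^+ 2 + n + `|cabs z ^+ 2 - n|) / 2)^-1)%:C%C : C)).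
  exact: (@continuous_conj R z).
apply: (@continuous_comp _ _ _
  (fun z : C => ((cabs z ^+ 2 + n + `|cabs z ^+ 2 - n|) / 2)^-1 : R)
  (fun x : R => x%:C%C : C)); last exact: continuous_ofreal.
apply: (@continuous_comp _ _ _ (@cabs R) (fun x : R => ((x ^+ 2 + n + `|x ^+ 2 - n|) / 2)^-1)).
  exact: continuous_cabs.
set x := cabs z.
have csq : {for x, continuous (fun x : R => x ^+ 2)} by exact: exprn_continuous.
apply: (@continuousV R).
  rewrite mulf_neq0 // gt_eqF //.
  by have := ler_norm (- (x ^+ 2 - n)); rewrite normrN; have := sqr_ge0 x; lra.
apply: (@continuousM R); last exact: cst_continuous.
apply: (@continuousD R); first by apply: (@continuousD R) => //; exact: cst_continuous.
apply: (@continuous_comp _ _ _ (fun x : R => x ^+ 2 - n) (fun x : R => `|x|)).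
  by apply: (@continuousB R) => //; exact: cst_continuous.
exact: norm_continuous.
Qed.

(** Let [q] be the maximum of [t ^+ 2] and [m ^+ 2], with [t] the modulus. Both [m * t] and [t ^+ 2]
    are at most [q], and the left side is [m * t * t ^+ 2 / q ^+ 2]. The bound holds also inside the
    cut-off disc, where [k] below has to be estimated too. *)
Lemma cutinv_bound (n m : R) z : 0 < m -> m ^+ 2 = n -> m * (cabs z * cabs (cutinv n z) ^+ 2) <= 1.
Proof.
move=> m0 mn; have n0 : 0 < n by rewrite -mn exprn_gt0.
rewrite /cutinv cabsM cabs_conj cabs_real.
set t := cabs z; have t0 : 0 <= t := cabs_ge0 z.
have nrm : 0 <= `|t ^+ 2 - n| := normr_ge0 _.
have h1 := ler_norm (t ^+ 2 - n).
have h2 := ler_norm (- (t ^+ 2 - n)); rewrite normrN in h2.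
set q := (t ^+ 2 + n + `|t ^+ 2 - n|) / 2.
have q1 : n <= q by rewrite /q; lra.
have q2 : t ^+ 2 <= q by rewrite /q; lra.
have q0 : 0 < q by apply: lt_le_trans q1.
clearbody q.
rewrite gtr0_norm ?invr_gt0 //.
have -> : m * (t * (t * q^-1) ^+ 2) = (m * t) * t ^+ 2 / (q * q).
  by field; rewrite gt_eqF.
rewrite ler_pdivrMr ?mul1r; last exact: mulr_gt0.
have mt : m * t <= q.
  have := sqr_ge0 (m - t); rewrite sqrrB mn; nra.
by rewrite ler_pM ?mulr_ge0 ?exprn_ge0 // ltW.
Qed.

Lemma liouville_derivative (f : C -> C) (M : R) : entire f ->
  (forall z, cabs (f z) <= M) ->
  forall e : R, 0 < e -> exists2 r : R, 0 < r & forall w, cabs w < r ->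
    cabs (f w - f 0) <= e * cabs w.
Proof.
move=> ef fM; have [d dP] := differentiable_cdiff (ef 0).
suff d0 : d = 0.
  move=> e e0; have [r r0 rP] := dP e e0; exists r => // w wr.
  by have := rP w; rewrite subr0 d0 mul0r subr0; exact.
apply: contrapT => /eqP d0.
have M0 : 0 <= M := le_trans (cabs_ge0 _) (fM 0).
have D0 : 0 < cabs d.
  by rewrite lt_neqAle cabs_ge0 andbT eq_sym; apply: contraNneq d0 => /cabs_eq0 ->.
set D := cabs d in D0.
(* This constant makes the bound for the small square exactly 1: there [k] is at most
   [D / 32 / D / (de / 2)], and [mu_estimate] multiplies this by [16 * de]. *)
have e0 : 0 < D / 32 by rewrite divr_gt0.
have [r r0 rP] := dP _ e0.
pose de := Num.min (r / 4) (1 / 2).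
have de0 : 0 < de by rewrite lt_min divr_gt0 //=; lra.
have de4 : de <= r / 4 by rewrite ge_min lexx.
have de2 : de <= 1 / 2 by rewrite ge_min lexx orbT.
(* Large enough that [(f z - f 0) / (d z^2)], at most [2 * M / (D * Rr ^+ 2)], is at most half of
   [1 / (2 * Rr)], the contribution of [1 / z] per unit length. The [+ 1] keeps the large square
   outside the small one. *)
pose Rr := 8 * M / D + 1.
have MD0 : 0 <= M / D by rewrite divr_ge0 // ltW.
have R1 : 1 <= Rr by rewrite /Rr -mulrA; lra.
have Rr0 : 0 < Rr by lra.
(* Cut-off radius [de / 2]: around a point of modulus at least [de], the disc of radius [de / 2]
   lies where [cutinv] is the true inverse, so [k] is differentiable there. *)
pose n := (de / 2) ^+ 2.
have n0 : 0 < n by rewrite exprn_gt0 // divr_gt0.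
pose k z := (f z - f 0 - d * z) * (- d)^-1 * (cutinv n z * cutinv n z).
have kc : continuous k.
  move=> z; apply: (@continuousM _ C (fun z => (f z - f 0 - d * z) * (- d)^-1)
    (fun z => cutinv n z * cutinv n z)); last first.
    by apply: (@continuousM _ C (cutinv n) (cutinv n)); exact: (continuous_cutinv n0).
  apply: (@continuousM _ C (fun z => f z - f 0 - d * z) (fun=> (- d)^-1));
    last exact: cst_continuous.
  apply: (@continuousB _ C^o _ (fun z => f z - f 0) (fun z => d * z)).
    apply: (@continuousB _ C^o _ f (fun=> f 0)); last exact: cst_continuous.
    exact: (entire_continuous ef).
  apply: (@continuousM _ C (fun=> d) id); first exact: cst_continuous.
  exact: cvg_id.
pose L := Rr + 1.
(* The cut-off made [k] continuous on the whole plane, so primitives exist on every line, including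
   those through the origin. *)
have [P HP] := choice (fun y => @cprim_exists R L (fun x => k (Complex x y))
   (fun x => @continuous_comp _ _ _ _ k x (@continuous_Complex_l R y x) (kc _))).
have [Q HQ] := choice (fun x => @cprim_exists R L (fun y => k (Complex x y))
   (fun y => @continuous_comp _ _ _ _ k y (@continuous_Complex_r R x y) (kc _))).
have kd z : de <= cabs z -> cdiff k z.
  move=> dez.
  have z0 : z != 0 by apply/eqP => z0; move: dez; rewrite z0 cabs0; lra.
  apply: (@near_cdiff _ (fun w => (f w - f 0 - d * w) * (- d)^-1 * (w^-1 * w^-1)) _ (de / 2)).
  - by rewrite divr_gt0.
  - move=> w wz; rewrite /k cutinvE // /n.
    have : de / 2 <= cabs w.
      have := cabs_triangle z w; rewrite -(cabsN (z - w)) opprB => h.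
      by have := ler_norm (cabs z - cabs w); lra.
    by move=> h; rewrite ler_pXn2r ?nnegrE ?cabs_ge0 //; lra.
  - apply: differentiable_cdiff.
    apply: (@differentiableM C C^o); last first.
      by apply: (@differentiableM C C^o); apply: (@differentiableV C C^o).
    apply: (@differentiableM C C^o); last exact: differentiable_cst.
    apply: (@differentiableB C C^o C^o); last first.
      by apply: (@differentiableM C C^o); first exact: differentiable_cst.
    by apply: (@differentiableB C C^o C^o); first exact: ef.
have cabs_x (x y : R) : `|x| <= cabs (Complex x y : C) := Re_le_cabs (Complex x y : C).
have cabs_y (x y : R) : `|y| <= cabs (Complex x y : C) := Im_le_cabs (Complex x y : C).
have gz x1 x2 y1 y2 : - Rr <= x1 -> x1 <= x2 -> x2 <= Rr ->
    - Rr <= y1 -> y1 <= y2 -> y2 <= Rr ->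
    [|| x2 <= - de, de <= x1, y2 <= - de | de <= y1] -> mu P Q x1 x2 y1 y2 = 0.
  move=> h1 h2 h3 h4 h5 h6 h7.
  apply: (goursat HP HQ) => [||||||x y hx hy]; rewrite /L; [lra..|].
  apply: kd; case/or4P: h7 => h7.
  - by apply: le_trans (cabs_x x y); rewrite -normrN; apply: le_trans (ler_norm _); lra.
  - by apply: le_trans (cabs_x x y); apply: le_trans (ler_norm _); lra.
  - by apply: le_trans (cabs_y x y); rewrite -normrN; apply: le_trans (ler_norm _); lra.
  - by apply: le_trans (cabs_y x y); apply: le_trans (ler_norm _); lra.
have outer : mu P Q (- Rr) Rr (- Rr) Rr = mu P Q (- de) de (- de) de.
  rewrite (mu_annulus P Q _ _ _ _ (- de) de (- de) de).
  rewrite (gz (- Rr) Rr (- Rr) (- de)) ?(gz (- Rr) Rr de Rr)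
    ?(gz (- Rr) (- de) (- de) de) ?(gz de Rr (- de) de) ?add0r ?lexx ?orbT //; lra.
have inner : cabs (mu P Q (- de) de (- de) de) <= 1.
  have -> : 1 = 4 * ((8 * de)^-1 / 2) * ((de - - de) + (de - - de)) :> R.
    by field; rewrite gt_eqF.
  have -> : (8 * de)^-1 / 2 = D / 32 / D / (de / 2) :> R.
    by field; rewrite !gt_eqF.
  apply: (mu_estimate HP HQ (c := 0) (d := 0)); try by rewrite /L; lra.
  move=> x y hx hy; rewrite mul0r addr0 subr0 /k.
  set z : C := Complex x y; move: (cutinv n z) (@cutinv_bound n (de / 2) z) => ct ctP.
  rewrite !cabsM.
  have zr : cabs (z - 0) < r.
    rewrite subr0; apply: le_lt_trans (cabs_le_ReIm _) _ => /=.
    have : `|x| <= de by rewrite ler_norml.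
    have : `|y| <= de by rewrite ler_norml.
    by lra.
  have := rP z zr; rewrite subr0 => h.
  have cd : cabs (- d)^-1 = D^-1.
    by rewrite /cabs Normc.normcV -/(cabs (- d)) cabsN.
  rewrite cd -expr2.
  have cb := ctP (divr_gt0 de0 (ltr0Sn _ 1)) erefl.
  apply: (@le_trans _ _ ((D / 32 * cabs z) * D^-1 * cabs ct ^+ 2)).
    rewrite ler_wpM2r ?exprn_ge0 ?cabs_ge0 // ler_wpM2r // invr_ge0.
    exact: ltW.
  have -> : (D / 32 * cabs z) * D^-1 * cabs ct ^+ 2 =
     (D / 32 * D^-1) * (cabs z * cabs ct ^+ 2) by ring.
  rewrite ler_wpM2l //; first by rewrite mulr_ge0 ?invr_ge0 // ltW.
  by rewrite -[leRHS]mul1r ler_pdivlMr ?divr_gt0 // mulrC.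
(* off the origin k z = 1 / z + O(1 / |z|^2) *)
have kE z : Rr <= cabs z -> exists2 u : C, k z = z^-1 + u & cabs u <= (4 * Rr)^-1.
  move=> Rz.
  have z0 : z != 0 by apply/eqP => z0; move: Rz; rewrite z0 cabs0; lra.
  exists ((f z - f 0) * (- d)^-1 * (z^-1 * z^-1)).
    rewrite /k cutinvE //; last first.
      by rewrite /n ler_pXn2r ?nnegrE ?cabs_ge0 //; lra.
    by field; rewrite z0 d0.
  have cV (w : C) : cabs w^-1 = (cabs w)^-1 by exact: Normc.normcV.
  rewrite !cabsM !cV cabsN -/D.
  have fz : cabs (f z - f 0) <= 2 * M.
    apply: le_trans (cabsD _ _) _; rewrite cabsN.
    by have := fM z; have := fM 0; lra.
  have iz : (cabs z)^-1 <= Rr^-1 by rewrite lef_pV2 ?posrE //; lra.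
  have i0 : 0 <= (cabs z)^-1 by rewrite invr_ge0 cabs_ge0.
  apply: (@le_trans _ _ (2 * M * D^-1 * (Rr^-1 * Rr^-1))).
    apply: ler_pM; rewrite ?mulr_ge0 ?invr_ge0 ?(ltW D0) ?cabs_ge0 //.
      by rewrite ler_wpM2r // invr_ge0 ltW.
    by apply: ler_pM.
  have -> : 2 * M * D^-1 * (Rr^-1 * Rr^-1) = (8 * M / D) / Rr * (4 * Rr)^-1.
    by field; rewrite ?gt_eqF.
  rewrite -[leRHS]mul1r ler_wpM2r ?invr_ge0 ?mulr_ge0 ?(ltW Rr0) //.
  by rewrite ler_pdivrMr // mul1r /Rr lerDl.
have half : (4 * Rr)^-1 * (Rr - - Rr) = 1 / 2 by field; rewrite gt_eqF.
have main x : - Rr <= x <= Rr -> (2 * Rr)^-1 <= Rr / (x ^+ 2 + Rr ^+ 2).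
  move=> /andP[hx1 hx2].
  have h1 : 0 <= Rr - x by lra.
  have h2 : 0 <= Rr + x by lra.
  have h := mulr_ge0 h1 h2.
  have RR : 0 < Rr * Rr by rewrite mulr_gt0.
  have s0 : 0 < x ^+ 2 + Rr ^+ 2 by have := sqr_ge0 x; lra.
  by rewrite ler_pdivlMr // mulrC ler_pdivrMr ?mulr_gt0 //; lra.
have dbl : (2 * Rr)^-1 = (4 * Rr)^-1 + (4 * Rr)^-1 by field; rewrite gt_eqF.
have inL x : - Rr <= x <= Rr -> - L < x < L by move=> h; rewrite /L; lra.
have big x : Rr <= cabs (Complex x Rr : C) by apply: le_trans (cabs_y _ _); exact: ler_norm.
have big' x : Rr <= cabs (Complex x (- Rr) : C).
  by apply: le_trans (cabs_y _ _); rewrite normrN; exact: ler_norm.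
have big2 y : Rr <= cabs (Complex Rr y : C) by apply: le_trans (cabs_x _ _); exact: ler_norm.
have big2' y : Rr <= cabs (Complex (- Rr) y : C).
  by apply: le_trans (cabs_x _ _); rewrite normrN; exact: ler_norm.
have ReD (z w : C) : complex.Re (z + w) = complex.Re z + complex.Re w by case: z w => ? ? [].
have ImD (z w : C) : complex.Im (z + w) = complex.Im z + complex.Im w by case: z w => ? ? [].
have ReV (x y : R) : complex.Re ((Complex x y : C)^-1) = x / (x ^+ 2 + y ^+ 2) by [].
have ImV (x y : R) : complex.Im ((Complex x y : C)^-1) = - (y / (x ^+ 2 + y ^+ 2)) by [].
have bottom : 1 / 2 <= complex.Im (P (- Rr) Rr) - complex.Im (P (- Rr) (- Rr)).
  rewrite -half; apply: (@increment_ge _ (fun x => complex.Im (P (- Rr) x))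
     (fun x => complex.Im (k (Complex x (- Rr))))); first by lra.
    by move=> x /inL xL; have [] := HP (- Rr) x xL.
  move=> x hx; have [u -> ub] := kE _ (big' x).
  have := le_trans (Im_le_cabs u) ub; rewrite ler_norml => /andP[ub1 ub2].
  rewrite ImD ImV sqrrN mulNr opprK; have := main x hx; lra.
have top : 1 / 2 <= - complex.Im (P Rr Rr) - (- complex.Im (P Rr (- Rr))).
  rewrite -half; apply: (@increment_ge _ (fun x => - complex.Im (P Rr x))
     (fun x => - complex.Im (k (Complex x Rr)))); first by lra.
    by move=> x /inL xL; have [_ h] := HP Rr x xL; apply: is_deriveN.
  move=> x hx; have [u -> ub] := kE _ (big x).
  have := le_trans (Im_le_cabs u) ub; rewrite ler_norml => /andP[ub1 ub2].
  rewrite ImD ImV; have := main x hx; lra.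
have right : 1 / 2 <= complex.Re (Q Rr Rr) - complex.Re (Q Rr (- Rr)).
  rewrite -half; apply: (@increment_ge _ (fun x => complex.Re (Q Rr x))
     (fun x => complex.Re (k (Complex Rr x)))); first by lra.
    by move=> x /inL xL; have [] := HQ Rr x xL.
  move=> x hx; have [u -> ub] := kE _ (big2 x).
  have := le_trans (Re_le_cabs u) ub; rewrite ler_norml => /andP[ub1 ub2].
  rewrite ReD ReV (addrC (Rr ^+ 2)); have := main x hx; lra.
have left : 1 / 2 <= - complex.Re (Q (- Rr) Rr) - (- complex.Re (Q (- Rr) (- Rr))).
  rewrite -half; apply: (@increment_ge _ (fun x => - complex.Re (Q (- Rr) x))
     (fun x => - complex.Re (k (Complex (- Rr) x)))); first by lra.
    by move=> x /inL xL; have [h _] := HQ (- Rr) x xL; apply: is_deriveN.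
  move=> x hx; have [u -> ub] := kE _ (big2' x).
  have := le_trans (Re_le_cabs u) ub; rewrite ler_norml => /andP[ub1 ub2].
  rewrite ReD ReV sqrrN mulNr (addrC (Rr ^+ 2)); have := main x hx; lra.
have muIm : complex.Im (mu P Q (- Rr) Rr (- Rr) Rr) =
   (complex.Im (P (- Rr) Rr) - complex.Im (P (- Rr) (- Rr)))
   + (complex.Re (Q Rr Rr) - complex.Re (Q Rr (- Rr)))
   + (- complex.Im (P Rr Rr) - (- complex.Im (P Rr (- Rr))))
   + (- complex.Re (Q (- Rr) Rr) - (- complex.Re (Q (- Rr) (- Rr)))).
  rewrite /mu /ci.
  case: (P (- Rr) Rr) => ? ?; case: (P (- Rr) (- Rr)) => ? ?.
  case: (P Rr Rr) => ? ?; case: (P Rr (- Rr)) => ? ?.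
  case: (Q Rr Rr) => ? ?; case: (Q Rr (- Rr)) => ? ?.
  case: (Q (- Rr) Rr) => ? ?; case: (Q (- Rr) (- Rr)) => ? ? /=; ring.
have := le_trans (ler_norm _) (Im_le_cabs (mu P Q (- Rr) Rr (- Rr) Rr)).
rewrite muIm outer; lra.
Qed.

End Liouville.

(** * Liouville's theorem and functions close to quadratic ones *)

Section Rigidity.
Variable R : realType.
Local Notation C := (Cplx R).

Lemma is_derive_zero (g : R -> R) t :
  (forall e : R, 0 < e -> exists2 r : R, 0 < r & forall h, `|h| < r ->
     `|g (t + h) - g t| <= e * `|h|) -> is_derive t 1 g 0.
Proof.
move=> H.
have L : (fun h : R => h^-1 *: (g (h *: (1 : R) + t) - g t)) @ 0^' --> (0 : R).
  apply/(@cvgrPdist_le _ R^o) => e e0; have [r r0 rP] := H e e0.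
  near=> h; rewrite sub0r normrN /GRing.scale /= mulr1 normrM normfV.
  have h0 : h != 0 by near: h; exact: nbhs_dnbhs_neq.
  rewrite ler_pdivrMl ?normr_gt0 // mulrC (addrC h); apply: rP.
  near: h; exact: (@dnbhs0_lt R R^o).
by apply: DeriveDef; [apply/cvg_ex; exists 0|exact: cvg_lim L].
Unshelve. all: by end_near. Qed.

Lemma entire_comp_affine (f : C -> C) a b : entire f -> entire (fun z => f (a + b * z)).
Proof.
move=> ef z; apply: (@differentiable_comp C C^o C^o C^o (fun z => a + b * z) f); last exact: ef.
apply: (@differentiableD C C^o C^o); first exact: differentiable_cst.
by apply: (@differentiableM C C^o); first exact: differentiable_cst.
Qed.

(** After a change of base point, [liouville_derivative] makes the derivative vanish everywhere;
    real and imaginary parts are then constant along the real line through 0 and [z]. *)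
Lemma liouville (f : C -> C) (M : R) : entire f -> (forall z, cabs (f z) <= M) ->
  forall z, f z = f 0.
Proof.
move=> ef fM z.
have D (w : C) (e : R) : 0 < e -> exists2 r : R, 0 < r &
    forall h : R, `|h| < r -> cabs (f (w + z * h%:C%C) - f w) <= e * `|h|.
  move=> e0.
  have ez0 : 0 < cabs z + 1 by rewrite ltr_pwDr ?cabs_ge0.
  have ez : 0 < e / (cabs z + 1) by rewrite divr_gt0.
  have [r r0 rP] := liouville_derivative (entire_comp_affine w 1 ef)
    (fun u => fM (w + 1 * u)) ez.
  exists (r / (cabs z + 1)); first by rewrite divr_gt0.
  move=> h; rewrite ltr_pdivlMr // => hr.
  have zh : cabs (z * h%:C%C) <= `|h| * (cabs z + 1).
    by rewrite cabsM cabs_real mulrC ler_wpM2l // lerDl.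
  have := rP _ (le_lt_trans zh hr); rewrite !mul1r addr0 => /le_trans; apply.
  rewrite -mulrA ler_wpM2l ?(ltW e0) //.
  by rewrite mulrC ler_pdivrMr.
have hE (t h : R) : z * (t + h)%:C%C = z * t%:C%C + z * h%:C%C by rewrite rmorphD mulrDr.
have Rec : complex.Re (f (z * 1%:C%C)) = complex.Re (f (z * 0%:C%C)).
  apply: (@is_derive_0_is_cst R (fun t => complex.Re (f (z * t%:C%C)))) => t.
  apply: is_derive_zero => e e0; have [r r0 rP] := D (z * t%:C%C) e e0.
  exists r => // h /rP; apply: le_trans; rewrite hE.
  apply: le_trans (Re_le_cabs _); rewrite le_eqVlt; apply/orP; left; apply/eqP; congr (`|_|).
  by case: (f _) (f _) => ? ? [].
have Imc : complex.Im (f (z * 1%:C%C)) = complex.Im (f (z * 0%:C%C)).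
  apply: (@is_derive_0_is_cst R (fun t => complex.Im (f (z * t%:C%C)))) => t.
  apply: is_derive_zero => e e0; have [r r0 rP] := D (z * t%:C%C) e e0.
  exists r => // h /rP; apply: le_trans; rewrite hE.
  apply: le_trans (Im_le_cabs _); rewrite le_eqVlt; apply/orP; left; apply/eqP; congr (`|_|).
  by case: (f _) (f _) => ? ? [].
rewrite mulr1 in Rec Imc; rewrite mulr0 in Rec Imc.
by apply/eqP; rewrite eq_complex; apply/andP; split; apply/eqP.
Qed.

Lemma bounded_progression (a k : C) (M : R) :
  (forall n : nat, cabs (a + n%:R * k) <= M) -> k = 0.
Proof.
move=> H; apply: contrapT => /eqP k0.
have K0 : 0 < cabs k.
  by rewrite lt_neqAle cabs_ge0 andbT eq_sym; apply: contraNneq k0 => /cabs_eq0 ->.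
have [n nP] : exists n : nat, (M + cabs a) / cabs k < n%:R.
  by exists (Num.truncn ((M + cabs a) / cabs k)).+1; exact: truncnS_gt.
have := H n; rewrite ltr_pdivrMr // in nP.
have : n%:R * cabs k <= cabs (a + n%:R * k) + cabs a.
  have -> : n%:R * cabs k = cabs (n%:R * k).
    have -> : n%:R = (n%:R : R)%:C%C :> C by rewrite rmorph_nat.
    by rewrite cabsM cabs_real ger0_norm.
  rewrite -[in leLHS](addKr a (n%:R * k)) addrC.
  by apply: le_trans (cabsD _ _) _; rewrite cabsN.
lra.
Qed.

(* Second differences of [f] are bounded entire functions, hence constant; a
   bounded function with constant second differences is constant. *)
Lemma entire_near_quadratic (f P : C -> C) (M : R) : entire f ->
  (forall u v, exists k, forall z, P (z + u + v) - P (z + u) - P (z + v) + P z = k) ->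
  (forall z, cabs (f z - P z) <= M) -> forall z, f z - P z = f 0 - P 0.
Proof.
move=> ef P2 fP; pose q z := f z - P z.
have q2 u v : exists k, forall z, q (z + u + v) - q (z + u) - q (z + v) + q z = k.
  have [k kP] := P2 u v.
  pose g z := f (z + u + v) - f (z + u) - f (z + v) + f z.
  have eg : entire g.
    have sh w : entire (fun z => f (z + w)).
      have -> : (fun z => f (z + w)) = (fun z => f (w + 1 * z)).
        by apply/funext => z; rewrite mul1r addrC.
      exact: entire_comp_affine.
    have -> : g = (fun z => f (z + (u + v)) - f (z + u) - f (z + v) + f z).
      by apply/funext => z; rewrite /g addrA.
    move=> z; apply: (@differentiableD C C^o C^o); last exact: ef.
    apply: (@differentiableB C C^o C^o); last exact: sh.
    by apply: (@differentiableB C C^o C^o); exact: sh.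
  have gE z : g z = (q (z + u + v) - q (z + u) - q (z + v) + q z) + k.
    by rewrite -(kP z) /g /q; ring.
  have gM z : cabs (g z) <= M + M + M + M + cabs k.
    rewrite gE; apply: le_trans (cabsD _ _) _; rewrite lerD2r.
    apply: le_trans (cabsD4 _ _ _ _) _; rewrite !cabsN; do ?apply: lerD; exact: fP.
  exists (g 0 - k) => z; rewrite -(liouville eg gM z) gE; ring.
(* Along the progression [z + n * u] the first difference in direction [v] grows by [k] at each
   step, yet stays bounded. *)
have D2 u v z : q (z + u + v) - q (z + u) - q (z + v) + q z = 0.
  have [k kP] := q2 u v; rewrite kP.
  apply: (@bounded_progression (q (z + v) - q z) _ (M + M)) => n.
  have -> : q (z + v) - q z + n%:R * k = q (z + n%:R * u + v) - q (z + n%:R * u).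
    elim: n => [|n IH]; first by rewrite !mul0r !addr0.
    rewrite -natr1 !mulrDl !mul1r !addrA IH.
    by rewrite -(kP (z + n%:R * u)); ring.
  by apply: le_trans (cabsD _ _) _; rewrite cabsN; apply: lerD; exact: fP.
have D1 v z : q (z + v) - q z = 0.
  apply: (@bounded_progression (q z) _ M) => n.
  suff -> : q z + n%:R * (q (z + v) - q z) = q (z + n%:R * v) by exact: fP.
  elim: n => [|n IH]; first by rewrite !mul0r !addr0.
  rewrite -natr1 !mulrDl !mul1r addrA IH.
  apply/eqP; rewrite -subr_eq0; apply/eqP.
  by rewrite -[RHS]oppr0 -[in RHS](D2 (n%:R * v) v z) [in q (z + (_ + v))]addrA; ring.
move=> z; apply: subr0_eq; rewrite -/(q z) -/(q 0).
by have := D1 z 0; rewrite add0r.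
Qed.

End Rigidity.

(** * Liftings to the universal covering *)

Lemma cvg_toR (R : realType) (T : topologicalType) (f : T -> R) (x : T) :
  (forall e : R, 0 < e -> \forall y \near x, `|f y - f x| < e) ->
  {for x, continuous f}.
Proof.
move=> H; rewrite /prop_for /continuous_at => A /= /nbhs_ballP [e e0 eA].
apply: filterS (H e e0) => y /= h; apply: eA.
by rewrite /ball /= distrC.
Qed.

Section ComplexPlane2.
Variable R : realType.
Local Notation C := (Cplx R).
Local Notation C2 := (C2 R).
Implicit Types z w : C2.

Definition fst2 z : C := z ord0 ord0.
Definition snd2 z : C := z ord_max ord0.
Definition mk2 (x y : C) : C2 := \col_i (if i == ord0 then x else y).

Lemma fst2_mk x y : fst2 (mk2 x y) = x.
Proof. by rewrite /fst2 mxE. Qed.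

Lemma snd2_mk x y : snd2 (mk2 x y) = y.
Proof. by rewrite /snd2 mxE. Qed.

Lemma C2P z w : fst2 z = fst2 w -> snd2 z = snd2 w -> z = w.
Proof.
move=> h1 h2; apply/matrixP => i j; rewrite (ord1 j).
by case: i => [[|[|//]]] Hi; [move: h1|move: h2]; rewrite /fst2 /snd2;
  congr (_ = _); congr (_ _ _); apply: val_inj.
Qed.

Lemma fst2D z w : fst2 (z + w) = fst2 z + fst2 w. Proof. by rewrite /fst2 mxE. Qed.
Lemma snd2D z w : snd2 (z + w) = snd2 z + snd2 w. Proof. by rewrite /snd2 mxE. Qed.
Lemma fst2N z : fst2 (- z) = - fst2 z. Proof. by rewrite /fst2 mxE. Qed.
Lemma snd2N z : snd2 (- z) = - snd2 z. Proof. by rewrite /snd2 mxE. Qed.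
Lemma fst2Z (a : C) z : fst2 (a *: z) = a * fst2 z. Proof. by rewrite /fst2 mxE. Qed.
Lemma snd2Z (a : C) z : snd2 (a *: z) = a * snd2 z. Proof. by rewrite /snd2 mxE. Qed.
Definition coord2E := (fst2D, snd2D, fst2N, snd2N, fst2Z, snd2Z, fst2_mk, snd2_mk).

(** A norm on C^2 with real values, for the same reason as [cabs]; the sum form keeps estimates
    linear. *)
Definition nm z : R := cabs (fst2 z) + cabs (snd2 z).

Lemma nm_ge0 z : 0 <= nm z.
Proof. by rewrite addr_ge0 ?cabs_ge0. Qed.

Lemma nmD z w : nm (z + w) <= nm z + nm w.
Proof.
rewrite /nm !coord2E; have := cabsD (fst2 z) (fst2 w).
have := cabsD (snd2 z) (snd2 w); lra.
Qed.

Lemma nmN z : nm (- z) = nm z.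
Proof. by rewrite /nm !coord2E !cabsN. Qed.

Lemma nmZ (t : R) z : nm (t%:C%C *: z) = `|t| * nm z.
Proof. by rewrite /nm !coord2E !cabsM cabs_real mulrDr. Qed.

Lemma nm0 : nm 0 = 0.
Proof. by rewrite /nm /fst2 /snd2 !mxE cabs0 addr0. Qed.

Lemma nmB z w : nm (z - w) = nm (w - z).
Proof. by rewrite -nmN opprB. Qed.

Lemma nbhs_nm z (A : set C2) :
  nbhs z A <-> exists2 e : R, 0 < e & forall w, nm (w - z) < e -> A w.
Proof.
split=> [[P Pz PA]|[e e0 eA]].
  have /nbhs_cabs[e0 e00 P0] := Pz ord0 ord0.
  have /nbhs_cabs[e1 e10 P1] := Pz ord_max ord0.
  exists (Num.min e0 e1); first by rewrite lt_min e00.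
  move=> w; rewrite /nm !coord2E lt_min => /andP[w0 w1]; apply: PA => i j.
  have [c0 c1] := (cabs_ge0 (fst2 w - fst2 z), cabs_ge0 (snd2 w - snd2 z)).
  rewrite (ord1 j); case: i => [[|[|//]]] Hi.
    have -> : Ordinal Hi = ord0 by apply: val_inj.
    by apply: P0; rewrite -/(fst2 w) -/(fst2 z); lra.
  have -> : Ordinal Hi = ord_max by apply: val_inj.
  by apply: P1; rewrite -/(snd2 w) -/(snd2 z); lra.
exists (fun i j => [set t | cabs (t - z i j) < e / 2]).
  by move=> i j; apply/nbhs_cabs; exists (e / 2) => //; rewrite divr_gt0.
move=> w H; apply: eA; rewrite /nm !coord2E.
by have := H ord0 ord0; have := H ord_max ord0; rewrite /= /fst2 /snd2; lra.
Qed.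

Lemma near_nm z (P : C2 -> Prop) : (\forall w \near z, P w) <->
  exists2 e : R, 0 < e & forall w, nm (w - z) < e -> P w.
Proof. exact: (nbhs_nm z P). Qed.

Lemma continuous_fst2 : continuous (fst2 : C2 -> C).
Proof.
move=> z; apply: cvg_toC => e e0; apply/near_nm; exists e => // w.
by apply: le_lt_trans; rewrite -fst2N -fst2D lerDl cabs_ge0.
Qed.

Lemma continuous_snd2 : continuous (snd2 : C2 -> C).
Proof.
move=> z; apply: cvg_toC => e e0; apply/near_nm; exists e => // w.
by apply: le_lt_trans; rewrite -snd2N -snd2D lerDr cabs_ge0.
Qed.

Lemma cvg_toC2 (T : topologicalType) (f : T -> C2) (x : T) :
  {for x, continuous (fun t => fst2 (f t))} ->
  {for x, continuous (fun t => snd2 (f t))} -> {for x, continuous f}.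
Proof.
move=> h1 h2; rewrite /prop_for /continuous_at => A /= /nbhs_nm [e e0 eA].
have e2 : 0 < e / 2 by rewrite divr_gt0.
have k1 : \forall t \near x, cabs (fst2 (f t) - fst2 (f x)) < e / 2.
  apply: (h1 [set c | cabs (c - fst2 (f x)) < e / 2]).
  by apply/nbhs_cabs; exists (e / 2).
have k2 : \forall t \near x, cabs (snd2 (f t) - snd2 (f x)) < e / 2.
  apply: (h2 [set c | cabs (c - snd2 (f x)) < e / 2]).
  by apply/nbhs_cabs; exists (e / 2).
change (nbhs x [set t | A (f t)]).
apply: filterS (filterI k1 k2) => t [/= t1 t2].
by apply: eA; rewrite /nm !coord2E; lra.
Qed.

Lemma continuous_mk2 (T : topologicalType) (f g : T -> C) (x : T) :
  {for x, continuous f} -> {for x, continuous g} ->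
  {for x, continuous (fun t => mk2 (f t) (g t))}.
Proof.
move=> hf hg; apply: cvg_toC2.
  by rewrite (_ : (fun t => _) = f) //; apply/funext => t; rewrite fst2_mk.
by rewrite (_ : (fun t => _) = g) //; apply/funext => t; rewrite snd2_mk.
Qed.

Definition is_affine (g : C2 -> C2) := exists (A : 'M[C]_2) (b : C2),
  forall z, g z = A *m z + b.

Lemma fst2_mulmx (A : 'M[C]_2) z :
  fst2 (A *m z) = A ord0 ord0 * fst2 z + A ord0 ord_max * snd2 z.
Proof.
rewrite /fst2 mxE big_ord_recr big_ord1 /=; congr (_ * _ + _ * _).
  by congr (A _ _); apply: val_inj.
by congr (z _ _); apply: val_inj.
Qed.

Lemma snd2_mulmx (A : 'M[C]_2) z :
  snd2 (A *m z) = A ord_max ord0 * fst2 z + A ord_max ord_max * snd2 z.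
Proof.
rewrite /snd2 mxE big_ord_recr big_ord1 /=; congr (_ * _ + _ * _).
  by congr (A _ _); apply: val_inj.
by congr (z _ _); apply: val_inj.
Qed.

Lemma cst_continuousC (T : topologicalType) (a : C) (x : T) : {for x, continuous (fun _ : T => a)}.
Proof. exact: cst_continuous. Qed.

Lemma continuous_lincomb (T : topologicalType) (u v f g : T -> C) (x : T) :
  {for x, continuous u} -> {for x, continuous f} ->
  {for x, continuous v} -> {for x, continuous g} ->
  {for x, continuous (fun t => u t * f t + v t * g t)}.
Proof.
move=> cu cf cv cg.
apply: (@continuousD C C^o _ (fun t => u t * f t) (fun t => v t * g t)).
  exact: (@continuousM C _ u f).
exact: (@continuousM C _ v g).
Qed.

Lemma is_affine_continuous g : is_affine g -> continuous g.
Proof.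
move=> [A [b gE]]; have -> : g = (fun z => A *m z + b) by apply/funext.
move=> z; apply: cvg_toC2.
  have -> : (fun z : C2 => fst2 (A *m z + b)) =
    (fun z => A ord0 ord0 * fst2 z + A ord0 ord_max * snd2 z + fst2 b).
    by apply/funext => w; rewrite coord2E fst2_mulmx.
  apply: (@continuousD C C^o _ (fun z => A ord0 ord0 * fst2 z + A ord0 ord_max * snd2 z)
     (fun=> fst2 b)); last exact: cst_continuousC.
  exact: (continuous_lincomb (@cst_continuousC _ _ _) (@continuous_fst2 _)
    (@cst_continuousC _ _ _) (@continuous_snd2 _)).
have -> : (fun z : C2 => snd2 (A *m z + b)) =
  (fun z => A ord_max ord0 * fst2 z + A ord_max ord_max * snd2 z + snd2 b).
  by apply/funext => w; rewrite coord2E snd2_mulmx.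
apply: (@continuousD C C^o _ (fun z => A ord_max ord0 * fst2 z + A ord_max ord_max * snd2 z)
   (fun=> snd2 b)); last exact: cst_continuousC.
exact: (continuous_lincomb (@cst_continuousC _ _ _) (@continuous_fst2 _)
  (@cst_continuousC _ _ _) (@continuous_snd2 _)).
Qed.

(** A closed subset of the continuous image of a cube in R^4. *)
Lemma compact_nm (r : R) : compact [set z : C2 | nm z <= r].
Proof.
pose K : set 'rV[R]_4 := [set v | forall i, v ord0 i \in `[- r, r]].
have Kc : compact K.
  apply: (@rV_compact _ _ (fun=> `[- r, r]%classic)).
  by move=> _; exact: segment_compact.
pose e (v : 'rV[R]_4) : C2 := mk2 (Complex (v ord0 (inord 0)) (v ord0 (inord 1)))
  (Complex (v ord0 (inord 2)) (v ord0 (inord 3))).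
have cco i : continuous (fun v : 'rV[R]_4 => v ord0 i) by exact: coord_continuous.
have cC i j : continuous (fun v : 'rV[R]_4 => Complex (v ord0 i) (v ord0 j) : C).
  move=> v; apply: cvg_toC => d d0.
  have d2 : 0 < d / 2 by rewrite divr_gt0.
  have h k : nbhs v [set w : 'rV[R]_4 | `|v ord0 k - w ord0 k| < d / 2].
    exact: (proj1 (@cvgrPdist_lt _ R^o _ (nbhs v) _ (fun w : 'rV[R]_4 => w ord0 k) _) (cco k v)).
  apply: filterS (filterI (h i) (h j)) => w [/=]; rewrite distrC => h1; rewrite distrC => h2.
  change (cabs ((Complex (w ord0 i) (w ord0 j) : C) - Complex (v ord0 i) (v ord0 j)) < d).
  apply: le_lt_trans (cabs_le_ReIm _) _ => /=.
  by rewrite (splitr d) ltrD.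
have ec : continuous e by move=> v; apply: continuous_mk2; exact: cC.
have eK : compact (e @` K).
  apply: continuous_compact Kc; exact: continuous_subspaceT.
apply: subclosed_compact eK _.
  have -> : [set z : C2 | nm z <= r] = nm @^-1` [set x | x <= r] by [].
  apply: preimage_closed; last exact: closed_le.
  move=> z _; apply: cvg_toR => d d0; apply/near_nm.
  exists d => // w wz; apply: le_lt_trans wz.
  have h1 : nm z <= nm (w - z) + nm w.
    by rewrite nmB -{1}(subrK w z) nmD.
  have h2 : nm w <= nm (w - z) + nm z by rewrite -{1}(subrK z w) nmD.
  by rewrite ler_norml; apply/andP; split; lra.
move=> z /= zr.
have b (x : C) : cabs x <= nm z -> (complex.Re x \in `[- r, r]) /\ (complex.Im x \in `[- r, r]).
  move=> xz; rewrite !in_itv /= -!ler_norml; split.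
    exact: le_trans (Re_le_cabs _) (le_trans xz zr).
  exact: le_trans (Im_le_cabs _) (le_trans xz zr).
have [b1 b2] : (complex.Re (fst2 z) \in `[- r, r]) /\ (complex.Im (fst2 z) \in `[- r, r]).
  by apply: b; rewrite lerDl cabs_ge0.
have [b3 b4] : (complex.Re (snd2 z) \in `[- r, r]) /\ (complex.Im (snd2 z) \in `[- r, r]).
  by apply: b; rewrite lerDr cabs_ge0.
exists (\row_(i < 4) nth 0 [:: complex.Re (fst2 z); complex.Im (fst2 z);
   complex.Re (snd2 z); complex.Im (snd2 z)] i).
  by move=> i; rewrite mxE; case: i => [[|[|[|[|//]]]]] Hi.
rewrite /e !mxE !inordK //=; apply: C2P; rewrite ?fst2_mk ?snd2_mk.
  by case: (fst2 z).
by case: (snd2 z).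
Qed.

End ComplexPlane2.

Local Open Scope quotient_scope.

(** [P g] is inherited by smaller numbers, so a minimum serves all [g]. Upper bounds also fit this
    scheme, as inverses of small numbers. *)
Lemma finite_uniform (R : realType) (T : Type) (S : set T) (P : T -> R -> Prop) :
  finite_set S -> (forall g r s, 0 < s -> s <= r -> P g r -> P g s) ->
  (forall g, S g -> exists2 r : R, 0 < r & P g r) ->
  exists2 r : R, 0 < r & forall g, S g -> P g r.
Proof.
move=> Sfin mono ex.
have [s Ss] := proj1 (@finite_seqP {classic T} S) Sfin.
have sS (g : {classic T}) : g \in s -> S g by move=> gs; rewrite Ss.
suff [r r0 rP] : exists2 r : R, 0 < r & forall g : {classic T}, g \in s -> P g r.
  by exists r => // g; rewrite Ss => /rP.
elim: s sS {Ss} => [|g s IH] sS; first by exists 1.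
have [r r0 rP] : exists2 r : R, 0 < r & forall h : {classic T}, h \in s -> P h r.
  by apply: IH => h hs; apply: sS; rewrite inE hs orbT.
have [t t0 tP] := ex g (sS _ (mem_head _ _)).
exists (Num.min r t); first by rewrite lt_min r0.
move=> h; rewrite inE => /orP[/eqP ->|/rP hr].
  by apply: mono tP; rewrite ?lt_min ?r0 // ge_min lexx orbT.
by apply: mono hr; rewrite ?lt_min ?r0 // ge_min lexx.
Qed.

(** * The orbit map as a covering: uniqueness of lifts *)

Section Covering.
Variable R : realType.
Local Notation C := (Cplx R).
Local Notation C2 := (C2 R).
Variable G : affine_group R.
Hypothesis Gpd : properly_discontinuous G.
Hypothesis Gfree : fixed_point_free G.

Lemma orbit_piP z w : orbit_pi G z = orbit_pi G w <-> exists2 g, aff_set G g & g z = w.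
Proof.
split=> [/eqmodP /asboolP //|H].
by apply/eqmodP/asboolP.
Qed.

Lemma orbit_pi_act g z : aff_set G g -> orbit_pi G (g z) = orbit_pi G z.
Proof. by move=> Gg; apply/esym/orbit_piP; exists g. Qed.

Lemma orbit_pi_surj (x : orbit_space G) : exists z, orbit_pi G z = x.
Proof. by exists (repr (x : {eq_quot orbit_equiv G})); rewrite /orbit_pi reprK. Qed.

Lemma aff_affine' g : aff_set G g -> is_affine g.
Proof. by move=> /(aff_affine)[A [b [_ gE]]]; exists A, b. Qed.

Lemma aff_continuous g : aff_set G g -> continuous g.
Proof. by move=> /aff_affine'; exact: is_affine_continuous. Qed.

(** Evenly covered balls. Proper discontinuity on a compact ball leaves finitely many [g]; each one
    other than the identity moves [y], and by continuity it keeps nearby points farther from [y]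
    than half that distance. *)
Lemma separated_orbit (y : C2) : exists2 r : R, 0 < r & forall g w,
  aff_set G g -> nm (w - y) < r -> nm (g w - y) < r -> g = id.
Proof.
pose K := [set z : C2 | nm z <= nm y + 1].
have Kc : compact K by exact: (@compact_nm R).
have fin := Gpd Kc.
pose S := [set g | aff_set G g /\ (g @` K) `&` K !=set0].
have inK w : nm (w - y) <= 1 -> K w.
  move=> wy; rewrite /K /= -(subrK y w); apply: le_trans (nmD _ _) _; lra.
have [|g Sg|r r0 rP] := @finite_uniform R _ S (fun g r => forall w, nm (w - y) < r ->
   nm (g w - y) < r -> g = id) fin.
- by move=> g r s s0 sr H w w1 w2; apply: (H w); apply: lt_le_trans sr.
- have [gy|gy] := pselect (g y = y).
    by exists 1 => // w _ _; apply: (Gfree Sg.1 gy).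
  have d0 : 0 < nm (g y - y).
    rewrite lt_neqAle nm_ge0 andbT eq_sym; apply/eqP => n0; apply: gy.
    have [c1 c2] := (cabs_ge0 (fst2 (g y - y)), cabs_ge0 (snd2 (g y - y))).
    move: n0; rewrite /nm => n0.
    have e1 : fst2 (g y - y) = 0 by apply: cabs_eq0; lra.
    have e2 : snd2 (g y - y) = 0 by apply: cabs_eq0; lra.
    by apply: C2P; apply: subr0_eq; rewrite -?fst2N -?fst2D -?snd2N -?snd2D.
  have e0 : 0 < nm (g y - y) / 2 by rewrite divr_gt0.
  have /nbhs_nm [s s0 sP] : nbhs y [set w | nm (g w - g y) < nm (g y - y) / 2].
    apply: (@aff_continuous g Sg.1 y [set u | nm (u - g y) < nm (g y - y) / 2]).
    by apply/nbhs_nm; exists (nm (g y - y) / 2).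
  exists (Num.min s (nm (g y - y) / 2)); first by rewrite lt_min s0.
  move=> w; rewrite !lt_min => /andP[ws _] /andP[_ gw].
  have := sP w ws; rewrite /= => h.
  have : nm (g y - y) <= nm (g w - g y) + nm (g w - y).
    by rewrite (nmB (g w)) -[in leLHS](subrK (g w) (g y)) -addrA nmD.
  by move=> h2; exfalso; move: d0 gw h h2; clear; lra.
- exists (Num.min r 1); first by rewrite lt_min r0 ltr01.
  move=> g w Gg; rewrite !lt_min => /andP[wr w1] /andP[gr g1].
  apply: (rP g _ w) => //; split=> //; exists (g w); split; last by apply: inK; lra.
  by exists w => //; apply: inK; lra.
Qed.

Lemma lift_near (f1 f2 : C2 -> C2) g x : aff_set G g ->
  {for x, continuous f1} -> {for x, continuous f2} ->
  (\forall w \near x, orbit_pi G (f1 w) = orbit_pi G (f2 w)) ->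
  f1 x = g (f2 x) -> \forall w \near x, f1 w = g (f2 w).
Proof.
move=> Gg c1 c2 eqpi e; have [r r0 rP] := separated_orbit (f1 x).
have n1 : nbhs x [set w | nm (f1 w - f1 x) < r].
  by apply: (c1 [set u | nm (u - f1 x) < r]); apply/nbhs_nm; exists r.
have n2 : nbhs x [set w | nm (g (f2 w) - f1 x) < r].
  apply: (c2 [set u | nm (g u - f1 x) < r]).
  apply: (@aff_continuous g Gg (f2 x) [set u | nm (u - f1 x) < r]).
  by apply/nbhs_nm; exists r => // w; rewrite e.
apply: filterS (filterI eqpi (filterI n1 n2)) => w [/= /esym/orbit_piP[k Gk kE] [h1 h2]].
have [g' [Gg' gg' g'g]] := aff_inv Gg.
have : k \o g' = id.
  apply: (rP _ (g (f2 w))) => //; first exact: aff_comp.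
  by rewrite /= gg' kE.
by move=> /(congr1 (fun f => f (g (f2 w)))) /=; rewrite gg' kE.
Qed.

(** The set where [f1 = g \o f2] is open and closed in [A]: near any point the lifts differ by one
    element [k] of [G], and if [k] and [g] agree at one point then they are equal by freeness. *)
Lemma lift_unique (A : set C2) (f1 f2 : C2 -> C2) : open A -> connected A -> A !=set0 ->
  (forall x, A x -> {for x, continuous f1}) -> (forall x, A x -> {for x, continuous f2}) ->
  (forall x, A x -> orbit_pi G (f1 x) = orbit_pi G (f2 x)) ->
  exists2 g, aff_set G g & forall x, A x -> f1 x = g (f2 x).
Proof.
move=> oA cA [x0 Ax0] c1 c2 epi.
have [g Gg gE] : exists2 g, aff_set G g & g (f2 x0) = f1 x0.
  by apply/orbit_piP/esym/epi.
exists g => //.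
have near_eq k x : aff_set G k -> A x -> f1 x = k (f2 x) ->
    \forall w \near x, A w /\ f1 w = k (f2 w).
  move=> Gk Ax e; have nA : nbhs x A by exact: open_nbhs_nbhs.
  apply: filterI => //; apply: lift_near => //; [exact: c1|exact: c2|].
  by apply: filterS nA => w /epi.
pose B := [set x | A x /\ f1 x = g (f2 x)].
suff BA : B = A by move=> x; rewrite -{1}BA => -[].
apply: cA; first by exists x0.
  exists B; last by apply/seteqP; split=> [x [? ?]|x [_ []]].
  by rewrite openE => x [Ax e]; exact: (near_eq g x Gg Ax e).
exists (~` (A `\` B)).
  apply: open_closedC; rewrite openE => x [Ax nBx].
  have [k Gk kE] : exists2 k, aff_set G k & k (f2 x) = f1 x.
    by apply/orbit_piP/esym/epi.
  apply: filterS (near_eq k x Gk Ax (esym kE)) => w [Aw e]; split => // -[_ e'].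
  have [g' [Gg' gg' g'g]] := aff_inv Gg.
  have /Gfree kg : aff_set G (g' \o k) by exact: aff_comp.
  have : g' \o k = id by apply: (kg (f2 w)); rewrite /= -e e' gg'.
  move=> /(congr1 (fun f => f (f2 x))) /= h.
  by apply: nBx; split=> //; rewrite -[in RHS]h g'g.
by apply/seteqP; split=> [x Bx|x [Ax h]];
  [split; [exact: Bx.1|case]|apply: contrapT => nB; apply: h].
Qed.

End Covering.

Section Convex.
Variable R : realType.
Local Notation C := (Cplx R).
Local Notation C2 := (C2 R).

Definition convex2 (A : set C2) := forall (x y : C2) (t : R), A x -> A y ->
  0 <= t <= 1 -> A ((1 - t)%:C%C *: x + t%:C%C *: y).

Lemma convex2_connected (A : set C2) : convex2 A -> connected A.
Proof.
move=> cA; have [[x Ax]|] := pselect (A !=set0); last first.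
  by move=> /set0P/negP; rewrite negbK => /eqP ->; exact: connected0.
pose s (y : C2) := (fun t : R => (1 - t)%:C%C *: x + t%:C%C *: y : C2).
have c1 : continuous (fun t : R => (1 - t)%:C%C : C).
  move=> t; apply: (@continuous_comp _ _ _ (fun t : R => 1 - t) (fun t : R => t%:C%C : C));
    last exact: continuous_ofreal.
  by apply: (@continuousB R R^o); [exact: cst_continuous|exact: cvg_id].
have c2 (u v : C) : continuous (fun t : R => (1 - t)%:C%C * u + t%:C%C * v : C).
  move=> t; exact: (continuous_lincomb (c1 t) (@cst_continuousC _ _ _ _)
    (@continuous_ofreal R t) (@cst_continuousC _ _ _ _)).
have sc y : continuous (s y).
  move=> t; apply: cvg_toC2.
    have -> : (fun t => fst2 (s y t)) =
       (fun t : R => (1 - t)%:C%C * fst2 x + t%:C%C * fst2 y).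
      by apply/funext => u; rewrite /s !coord2E.
    exact: c2.
  have -> : (fun t => snd2 (s y t)) =
     (fun t : R => (1 - t)%:C%C * snd2 x + t%:C%C * snd2 y).
    by apply/funext => u; rewrite /s !coord2E.
  exact: c2.
have -> : A = \bigcup_(y in A) (s y @` `[0, 1]).
  apply/seteqP; split=> [y Ay|_ [y Ay [t t01 <-]]]; last first.
    by apply: cA => //; move: t01; rewrite /= in_itv.
  exists y => //; exists 1; first by rewrite /= in_itv /= lexx ler01.
  by rewrite /s subrr scale0r add0r scale1r.
apply: bigcup_connected.
  exists x => y Ay; exists 0; first by rewrite /= in_itv /= lexx ler01.
  by rewrite /s subr0 scale1r scale0r addr0.
move=> y Ay; apply: connected_continuous_connected; first exact: segment_connected.
exact: continuous_subspaceT.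
Qed.

Lemma convex2_ball (z : C2) (r : R) : convex2 [set w | nm (w - z) < r].
Proof.
move=> x y t /= xr yr /andP[t0 t1].
have -> : (1 - t)%:C%C *: x + t%:C%C *: y - z =
   (1 - t)%:C%C *: (x - z) + t%:C%C *: (y - z).
  by apply: C2P; rewrite !coord2E rmorphB rmorph1; ring.
apply: le_lt_trans (nmD _ _) _; rewrite !nmZ !ger0_norm ?subr_ge0 //.
have -> : r = (1 - t) * r + t * r by ring.
have [->|tn0] := eqVneq t 0; first by rewrite !mul0r !addr0 subr0 !mul1r.
have h1 : (1 - t) * nm (x - z) <= (1 - t) * r by rewrite ler_wpM2l ?subr_ge0 // ltW.
have h2 : t * nm (y - z) < t * r by rewrite ltr_pM2l // lt_def tn0.
lra.
Qed.

Lemma open_ball2 (z : C2) (r : R) : open [set w | nm (w - z) < r].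
Proof.
rewrite openE => w /= wr; apply/nbhs_nm; exists (r - nm (w - z)).
  by rewrite subr_gt0.
move=> u /= uw; rewrite -(subrK w u) -addrA; apply: le_lt_trans (nmD _ _) _.
lra.
Qed.

End Convex.

(** * Existence of lifts of maps defined on C^2 *)

Section LiftExists.
Variable R : realType.
Local Notation C := (Cplx R).
Local Notation C2 := (C2 R).
Variable G : affine_group R.
Hypothesis Gpd : properly_discontinuous G.
Hypothesis Gfree : fixed_point_free G.
Variable p : C2 -> orbit_space G.

Definition local_lift (A : set C2) (f : C2 -> C2) :=
  forall w, A w -> {for w, continuous f} /\ orbit_pi G (f w) = p w.

Hypothesis local : forall z, exists2 e : R, 0 < e & exists f,
  local_lift [set w | nm (w - z) < e] f.

Lemma local_liftS (A B : set C2) f : B `<=` A -> local_lift A f -> local_lift B f.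
Proof. by move=> BA fA w /BA; exact: fA. Qed.

Lemma local_lift_act (A : set C2) f g : aff_set G g -> local_lift A f -> local_lift A (g \o f).
Proof.
move=> Gg fA w Aw; have [fc fp] := fA w Aw; split.
  by apply: continuous_comp; [exact: fc|exact: (@aff_continuous R G g Gg (f w))].
by rewrite /= -fp; exact: orbit_pi_act.
Qed.

Lemma local_lift_unique (A : set C2) f1 f2 : open A -> convex2 A -> A !=set0 ->
  local_lift A f1 -> local_lift A f2 ->
  exists2 g, aff_set G g & forall x, A x -> f1 x = g (f2 x).
Proof.
move=> oA cA A0 h1 h2.
apply: (lift_unique Gpd Gfree oA (convex2_connected cA) A0 (fun x Ax => (h1 x Ax).1)
  (fun x Ax => (h2 x Ax).1)) => x Ax.
by rewrite (h1 x Ax).2 (h2 x Ax).2.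
Qed.

Lemma local_lift_eq (A : set C2) f1 f2 x : open A -> convex2 A -> A x ->
  local_lift A f1 -> local_lift A f2 -> f1 x = f2 x -> forall w, A w -> f1 w = f2 w.
Proof.
move=> oA cA Ax h1 h2 e.
have [g Gg gE] := local_lift_unique oA cA (ex_intro _ x Ax) h1 h2.
suff gid : g = id by move=> w /gE ->; rewrite gid.
by apply: (Gfree Gg (z := f2 x)); rewrite -gE.
Qed.

Lemma near_lift (A : set C2) f1 f2 : open A ->
  local_lift A f1 -> (forall w, A w -> f2 w = f1 w) -> local_lift A f2.
Proof.
move=> oA h1 e w Aw; have [c1 p1] := h1 w Aw; split; last by rewrite e.
rewrite /prop_for /continuous_at => P /=; rewrite (e w Aw) => nP.
change (nbhs w [set u | P (f2 u)]).
apply: filterS (filterI (open_nbhs_nbhs (conj oA Aw)) (c1 P nP)) => u [Au Pu] /=.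
by rewrite e.
Qed.

(** A Lebesgue number: compactness is used as a near-covering, with the radius as a parameter
    tending to 0 from the right. *)
Lemma uniform_local_lift (N : R) : exists2 e : R, 0 < e & forall x, nm x <= N ->
  exists f, local_lift [set w | nm (w - x) < e] f.
Proof.
pose P (e : R) (x : C2) := exists f, local_lift [set w | nm (w - x) < e] f.
have := (@compact_near_coveringP _ [set x : C2 | nm x <= N]).1 (@compact_nm R N).
move=> /(_ R (0 : R)^'+ P _) [].
  move=> x _; have [e e0 [f fP]] := local x.
  exists ([set w | nm (w - x) < e / 2], [set d : R | d < e / 2]).
    split; first by apply/nbhs_nm; exists (e / 2); rewrite ?divr_gt0.
    by apply: nbhs_right_lt; rewrite divr_gt0.
  move=> [y d] /= [yx de]; exists f; apply: local_liftS fP => w /= wy.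
  rewrite -(subrK y w) -addrA; apply: le_lt_trans (nmD _ _) _; lra.
move=> e /= e0 eP; exists (e / 2); first by rewrite divr_gt0.
move=> x xN; apply: (eP (e / 2)) => //=; last by rewrite divr_gt0.
rewrite sub0r normrN gtr0_norm ?divr_gt0 //; lra.
Qed.

Lemma convex2I (A B : set C2) : convex2 A -> convex2 B -> convex2 (A `&` B).
Proof.
by move=> cA cB x y t [Ax Bx] [Ay By] t01; split; [exact: cA|exact: cB].
Qed.

Lemma midpoint_close (x y w : C2) (e r : R) : nm (w - x) < e -> nm (w - y) < e ->
  nm x <= r -> nm y <= r ->
  [/\ nm ((2^-1)%:C%C *: (x + y)) <= r, nm ((2^-1)%:C%C *: (x + y) - x) < e &
      nm ((2^-1)%:C%C *: (x + y) - y) < e].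
Proof.
move=> wx wy xr yr.
have half a : (2^-1 : R) * a = a / 2 by rewrite mulrC.
have h0 : `|2^-1 : R| = 2^-1 by rewrite ger0_norm.
have xy : nm (y - x) < 2 * e.
  have -> : y - x = (w - x) - (w - y) by apply: C2P; rewrite !coord2E; ring.
  by apply: le_lt_trans (nmD _ _) _; rewrite nmN; lra.
have e1 : (2^-1)%:C%C *: (x + y) - x = (2^-1)%:C%C *: (y - x).
  have h : (2^-1)%:C%C = 2^-1 :> C by rewrite fmorphV /= rmorph_nat.
  by apply: C2P; rewrite !coord2E h; field.
have e2 : (2^-1)%:C%C *: (x + y) - y = (2^-1)%:C%C *: (x - y).
  have h : (2^-1)%:C%C = 2^-1 :> C by rewrite fmorphV /= rmorph_nat.
  by apply: C2P; rewrite !coord2E h; field.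
split; rewrite ?e1 ?e2 nmZ h0 half.
- by have := nmD x y; lra.
- by lra.
- by rewrite nmB; lra.
Qed.

Lemma shrink_into_ball (x : C2) (r e : R) : 0 < r -> 0 < e -> nm x <= r ->
  exists y, nm y < r /\ nm (y - x) < e.
Proof.
move=> r0 e0 xr; pose t := Num.min 1 (e / (2 * r)).
have t0 : 0 < t by rewrite lt_min ltr01 divr_gt0 // mulr_gt0.
have t1 : t <= 1 by rewrite ge_min lexx.
have te : t <= e / (2 * r) by rewrite ge_min lexx orbT.
exists ((1 - t)%:C%C *: x); split.
  rewrite nmZ ger0_norm ?subr_ge0 //.
  apply: le_lt_trans (_ : (1 - t) * r < r); last by rewrite gtr_pMl //; lra.
  by rewrite ler_wpM2l ?subr_ge0.
have -> : (1 - t)%:C%C *: x - x = (- t)%:C%C *: x.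
  by apply: C2P; rewrite !coord2E rmorphB rmorphN rmorph1; ring.
rewrite nmZ normrN gtr0_norm //.
apply: le_lt_trans (_ : t * r < e); first by rewrite ler_wpM2l // ltW.
apply: le_lt_trans (_ : e / (2 * r) * r < e); first by rewrite ler_wpM2r // ltW.
have -> : e / (2 * r) * r = e / 2 by field; rewrite gt_eqF.
lra.
Qed.

(** One radius [e] serves all centres in the ball of radius [N]. Each round extends the lift from
    radius [r] to [r + e / 2] by gluing lifts on balls centred in the closed ball of radius [r].
    Convexity of balls does the work of simple connectedness. *)
Lemma ball_lift (y0 : C2) (N : R) : orbit_pi G y0 = p 0 -> 0 < N ->
  exists h, local_lift [set w | nm w < N] h /\ h 0 = y0.
Proof.
move=> py0 N0; have [e e0 eP] := uniform_local_lift N.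
have ball0 r : [set w : C2 | nm w < r] = [set w | nm (w - 0) < r].
  by apply/seteqP; split=> w /=; rewrite subr0.
have base : exists h, local_lift [set w | nm w < e] h /\ h 0 = y0.
  have [|f fP] := eP 0; first by rewrite nm0 ltW.
  have f0 : orbit_pi G (f 0) = orbit_pi G y0.
    by rewrite py0; apply: (fP 0 _).2; rewrite /= subr0 nm0.
  have [g Gg gE] := (orbit_piP G (f 0) y0).1 f0.
  exists (g \o f); split; last exact: gE.
  by rewrite ball0; exact: local_lift_act.
have step r : 0 < r -> r <= N ->
    (exists h, local_lift [set w | nm w < r] h /\ h 0 = y0) ->
    (exists h, local_lift [set w | nm w < r + e / 2] h /\ h 0 = y0).
  move=> r0 rN [h [hP h0]].
  (* The condition on [x] sits inside the existential so that [choice] applies to all points; [id]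
     is a default outside the ball. *)
  have adj x : exists f, nm x <= r -> local_lift [set w | nm (w - x) < e] f /\
      forall w, nm w < r -> nm (w - x) < e -> f w = h w.
    have [xr|xr] := pselect (nm x <= r); last by exists id.
    have [f fP] := eP x (le_trans xr rN).
    have [y [yr yx]] := shrink_into_ball r0 e0 xr.
    have oA : open ([set w : C2 | nm w < r] `&` [set w | nm (w - x) < e]).
      by apply: openI; rewrite ?ball0; exact: open_ball2.
    have cA : convex2 ([set w : C2 | nm w < r] `&` [set w | nm (w - x) < e]).
      by apply: convex2I; rewrite ?ball0; exact: convex2_ball.
    have [g Gg gE] := local_lift_unique oA cA (ex_intro _ y (conj yr yx))
      (local_liftS (@subIsetl _ _ _) hP) (local_liftS (@subIsetr _ _ _) fP).
    exists (g \o f) => _; split; first exact: local_lift_act.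
    by move=> w wr wx; rewrite /= -gE.
  have [F FP] := choice adj.
  (* If the balls about x and y meet then both contain their midpoint, near which
     the lifts F x and F y agree with h. *)
  have agree x y w : nm x <= r -> nm y <= r -> nm (w - x) < e -> nm (w - y) < e ->
      F x w = F y w.
    move=> xr yr wx wy; have [mr mx my] := midpoint_close wx wy xr yr.
    set m := (2^-1)%:C%C *: (x + y) in mr mx my.
    pose d := Num.min (e - nm (m - x)) (e - nm (m - y)).
    have d0 : 0 < d by rewrite lt_min !subr_gt0 mx.
    have [u [ur um]] := shrink_into_ball r0 d0 mr.
    have [dx dy] : d <= e - nm (m - x) /\ d <= e - nm (m - y).
      by rewrite /d !ge_min !lexx orbT.
    have ux : nm (u - x) < e.
      by rewrite -(subrK m u) -addrA; apply: le_lt_trans (nmD _ _) _; lra.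
    have uy : nm (u - y) < e.
      by rewrite -(subrK m u) -addrA; apply: le_lt_trans (nmD _ _) _; lra.
    have [fx hx] := FP x xr; have [fy hy] := FP y yr.
    apply: (@local_lift_eq ([set w : C2 | nm (w - x) < e] `&` [set w | nm (w - y) < e])
      _ _ u) => //.
    - by apply: openI; exact: open_ball2.
    - by apply: convex2I; exact: convex2_ball.
    - exact: local_liftS (@subIsetl _ _ _) fx.
    - exact: local_liftS (@subIsetr _ _ _) fy.
    - by rewrite hx // hy.
  (* The radial projection onto the ball of radius [r] is at distance [nm w - r], less than
     [e / 2]. *)
  have near_pt w : exists x, nm w < r + e / 2 -> nm x <= r /\ nm (w - x) < e.
    have [wr|wr] := leP (nm w) r; first by exists w; rewrite subrr nm0.
    exists ((r / nm w)%:C%C *: w) => we.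
    have w0 : 0 < nm w by apply: lt_trans wr.
    have t0 : 0 <= r / nm w by rewrite divr_ge0 ?ltW.
    split; first by rewrite nmZ ger0_norm // divfK // gt_eqF.
    have -> : w - (r / nm w)%:C%C *: w = (1 - r / nm w)%:C%C *: w.
      by apply: C2P; rewrite !coord2E rmorphB rmorph1; ring.
    rewrite nmZ ger0_norm; last by rewrite subr_ge0 ler_pdivrMr // mul1r ltW.
    by rewrite mulrBl mul1r divfK ?gt_eqF //; lra.
  have [c cP] := choice near_pt.
  exists (fun w => F (c w) w); split.
    move=> w we; have [cr cw] := cP w we.
    pose B := [set v : C2 | nm v < r + e / 2] `&` [set v | nm (v - c w) < e].
    have oB : open B by apply: openI; rewrite ?ball0; exact: open_ball2.
    have [Fc _] := FP _ cr.
    apply: (@near_lift B (F (c w))) => //.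
      exact: local_liftS (@subIsetr _ _ _) Fc.
    move=> v [ve vc]; have [cv vv] := cP v ve.
    exact: agree.
  have z0 : nm (0 : C2) < r + e / 2 by rewrite nm0; lra.
  have [cr cw] := cP 0 z0; have [_ FE] := FP _ cr.
  by rewrite FE // nm0.
have iter n : exists h, local_lift [set w | nm w < Num.min N (e + n%:R * (e / 2))] h /\ h 0 = y0.
  elim: n => [|n IH].
    have [h [hP h0]] := base; exists h; split; last exact: h0.
    by apply: local_liftS hP => w /=; rewrite mul0r addr0 lt_min => /andP[].
  rewrite -natr1 mulrDl mul1r addrA.
  have n0 : 0 <= n%:R * (e / 2) by rewrite mulr_ge0 // ltW // divr_gt0.
  have m0 : 0 < Num.min N (e + n%:R * (e / 2)) by rewrite lt_min N0; lra.
  have [|h [hP h0]] := step _ m0 _ IH; first by rewrite ge_min lexx.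
  exists h; split; last exact: h0.
  apply: local_liftS hP => w /=; rewrite lt_min => /andP[w1 w2].
  by case: (leP N) => _; lra.
have e2 : 0 < e / 2 by rewrite divr_gt0.
have [h [hP h0]] := iter (Num.truncn (N / (e / 2))).+1.
exists h; split; last exact: h0.
apply: local_liftS hP => w /= wN; rewrite lt_min wN /=.
have := truncnS_gt (N / (e / 2)); rewrite ltr_pdivrMr //; lra.
Qed.

(** The lifts on balls of radius [n + 1] have the same value [y0] at 0, so they agree where both are
    defined, and the truncated norm of a point may select the lift. *)
Lemma lift_exists : exists h : C2 -> C2, continuous h /\ forall z, orbit_pi G (h z) = p z.
Proof.
have [y0 py0] := orbit_pi_surj (p 0).
have [h hP] := choice (fun n : nat => @ball_lift y0 n.+1%:R py0 (ltr0Sn _ _)).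
have hE n m w : (n <= m)%N -> nm w < n.+1%:R -> h n w = h m w.
  move=> lenm wn; have [hn hn0] := hP n; have [hm hm0] := hP m.
  have hm' : local_lift [set w | nm w < n.+1%:R] (h m).
    apply: local_liftS hm => u /= /lt_le_trans; apply.
    by rewrite ler_nat ltnS.
  move: wn hn hm'.
  have -> : [set w : C2 | nm w < n.+1%:R] = [set w | nm (w - 0) < n.+1%:R].
    by apply/seteqP; split=> u /=; rewrite subr0.
  rewrite -{1}(subr0 w) => wn hn hm'.
  apply: (local_lift_eq (x := 0) (@open_ball2 _ _ _) (@convex2_ball _ _ _) _ hn hm') => //.
    by rewrite /= subr0 nm0.
  by rewrite hn0.
pose H z := h (Num.truncn (nm z)) z.
have HE n z : nm z < n.+1%:R -> H z = h n z.
  move=> zn; apply: hE; last exact: truncnS_gt.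
  by rewrite -ltnS -(ltr_nat R); apply: le_lt_trans zn; have /andP[] := truncn_itv (nm_ge0 z).
have HL n : local_lift [set w | nm w < n.+1%:R] H.
  apply: (@near_lift _ (h n)) => [||w]; [|by have [] := hP n|exact: HE].
  have -> : [set w : C2 | nm w < n.+1%:R] = [set w | nm (w - 0) < n.+1%:R].
    by apply/seteqP; split=> u /=; rewrite subr0.
  exact: open_ball2.
exists H; split=> z; have [] := HL (Num.truncn (nm z)) z (truncnS_gt _) => //.
Qed.

End LiftExists.

(** * Real structures and extensions *)

Section RealStructure.
Variable R : realType.
Local Notation C := (Cplx R).
Local Notation C2 := (C2 R).

Lemma continuous_conj2 : continuous (@conj2 R).
Proof.
move=> z; apply: cvg_toC2.
  have -> : (fun t : C2 => fst2 (conj2 t)) = (@conjc R : C -> C) \o @fst2 R.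
    by apply/funext => t; rewrite /fst2 mxE.
  by apply: continuous_comp; [exact: continuous_fst2|exact: continuous_conj].
have -> : (fun t : C2 => snd2 (conj2 t)) = (@conjc R : C -> C) \o @snd2 R.
  by apply/funext => t; rewrite /snd2 mxE.
by apply: continuous_comp; [exact: continuous_snd2|exact: continuous_conj].
Qed.

Lemma conj2K (z : C2) : conj2 (conj2 z) = z.
Proof. by apply/matrixP => i j; rewrite !mxE conjcK. Qed.

Lemma fst2_conj2 (z : C2) : fst2 (conj2 z) = conjc (fst2 z).
Proof. by rewrite /fst2 mxE. Qed.

Lemma snd2_conj2 (z : C2) : snd2 (conj2 z) = conjc (snd2 z).
Proof. by rewrite /snd2 mxE. Qed.

Lemma differentiable_conj2_continuous (F : C2 -> C2) z :
  differentiable (@conj2 R \o F) z -> {for z, continuous F}.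
Proof.
move=> /differentiable_continuous c.
have -> : F = @conj2 R \o (@conj2 R \o F) by apply/funext => w; rewrite /= conj2K.
by apply: continuous_comp; [exact: c|exact: continuous_conj2].
Qed.

Lemma near_differentiable (f k : C -> C) (t : C) :
  (\forall u \near t, f u = k u) -> differentiable (k : C^o -> C^o) t ->
  differentiable (f : C^o -> C^o) t.
Proof.
move=> fk /derivable1_diffP dk; apply/derivable1_diffP.
apply: (@near_eq_derivable C C^o C^o k f t 1 _ dk).
by apply: filterS fk => u ->.
Qed.

(** Antiholomorphy in the only form used later: on entire curves, where function theory in one
    variable suffices. *)
Definition antiholomorphic_curves (h : C2 -> C2) :=
  forall M : C -> C2, (forall t : C, differentiable (M : C^o -> C2) t) ->
    entire (fun t => conjc (fst2 (h (M t)))) /\ entire (fun t => conjc (snd2 (h (M t)))).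

Lemma differentiable_fst2 (V : normedModType C) (f : V -> C2) x :
  differentiable f x -> differentiable (fun t => fst2 (f t) : C^o) x.
Proof.
move=> df; apply: (@differentiable_comp C V C2 C^o f (@fst2 R)) => //.
exact: differentiable_coord.
Qed.

Lemma differentiable_snd2 (V : normedModType C) (f : V -> C2) x :
  differentiable f x -> differentiable (fun t => snd2 (f t) : C^o) x.
Proof.
move=> df; apply: (@differentiable_comp C V C2 C^o f (@snd2 R)) => //.
exact: differentiable_coord.
Qed.

Variable G : affine_group R.
Hypothesis Gpd : properly_discontinuous G.
Hypothesis Gfree : fixed_point_free G.

Lemma lift_unique_global (f1 f2 : C2 -> C2) : continuous f1 -> continuous f2 ->
  (forall z, orbit_pi G (f1 z) = orbit_pi G (f2 z)) ->
  exists2 g, aff_set G g & f1 = g \o f2.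
Proof.
move=> c1 c2 e.
have [g Gg gE] := @lift_unique R G Gpd Gfree setT f1 f2 openT
  (convex2_connected (fun _ _ _ _ _ _ => I)) (ex_intro _ 0 I)
  (fun x _ => c1 x) (fun x _ => c2 x) (fun x _ => e x).
by exists g => //; apply/funext => z; exact: gE.
Qed.

(** Two lifts of the identity differ by an element of [G], so [G] is the whole deck group. *)
Lemma pi1E (g : C2 -> C2) : pi1 G g <-> aff_set G g.
Proof.
split=> [[cg eg]|Gg]; last first.
  by split; [exact: (@aff_continuous _ G)|move=> z; exact: orbit_pi_act].
have [|z|k Gk ->] := @lift_unique_global g id cg; last by [].
  by move=> z; exact: cvg_id.
exact: eg.
Qed.

Variable sigma : orbit_space G -> orbit_space G.
Hypothesis sigma_real : real_structure sigma.

Lemma lifting_exists : exists h, liftings sigma h.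
Proof.
have [|h [hc hE]] := @lift_exists R G Gpd Gfree (fun z => sigma (orbit_pi G z)).
  move=> z; have [U [F [oU Uz aF FE]]] := sigma_real.1 z.
  have /nbhs_nm[e e0 eU] := open_nbhs_nbhs (conj oU Uz).
  exists e => //; exists F => w /= we; split; last by rewrite FE //; exact: eU.
  by apply: differentiable_conj2_continuous; apply: aF; exact: eU.
by exists h.
Qed.

(** Locally [h] is [g \o F] with [F] an antiholomorphic local lift and [g] affine. After conjugation
    the coordinates of [h] are affine combinations, with conjugate coefficients, of holomorphic
    functions. *)
Lemma lifting_antiholomorphic h : liftings sigma h -> antiholomorphic_curves h.
Proof.
move=> [hc hE] M dM.
suff H (t : C) : differentiable (fun t => conjc (fst2 (h (M t))) : C^o) (t : C^o) /\
    differentiable (fun t => conjc (snd2 (h (M t))) : C^o) (t : C^o).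
  by split=> t; have [] := H t.
have [U [F [oU Uz aF FE]]] := sigma_real.1 (M t).
have Fc := differentiable_conj2_continuous (aF _ Uz).
have nU : nbhs (M t) U by exact: open_nbhs_nbhs.
have [g Gg gE] : exists2 g, aff_set G g & g (F (M t)) = h (M t).
  by apply/orbit_piP; rewrite -FE // hE.
have nr : \forall w \near M t, h w = g (F w).
  apply: (@lift_near R G Gpd Gfree h F g (M t) Gg (hc (M t)) Fc _ (esym gE)).
  by apply: filterS nU => w Uw; rewrite hE FE.
have nt : \forall u \near t, h (M u) = g (F (M u)).
  have Mc : {for t, continuous (M : C^o -> C2)} := differentiable_continuous (dM t).
  exact: (Mc _ nr).
have [A [b gAb]] := aff_affine' Gg.
have dFM : differentiable (fun u : C^o => conj2 (F (M u))) t.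
  by apply: (@differentiable_comp C C^o C2 C2 M (@conj2 R \o F)); [exact: dM|exact: aF].
have d1 := differentiable_fst2 dFM; have d2 := differentiable_snd2 dFM.
have comb (a a' c : C) : differentiable (fun u : C^o => conjc a * conjc (fst2 (F (M u)))
     + conjc a' * conjc (snd2 (F (M u))) + conjc c : C^o) t.
  apply: (@differentiableD C C^o C^o); last exact: differentiable_cst.
  apply: (@differentiableD C C^o C^o).
    apply: (@differentiableM C C^o); first exact: differentiable_cst.
    by move: d1; congr (differentiable _ _); apply/funext => u; rewrite fst2_conj2.
  apply: (@differentiableM C C^o); first exact: differentiable_cst.
  by move: d2; congr (differentiable _ _); apply/funext => u; rewrite snd2_conj2.
split.
  apply: near_differentiable (comb (A ord0 ord0) (A ord0 ord_max) (fst2 b)).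
  by apply: filterS nt => u ->; rewrite gAb fst2D fst2_mulmx !rmorphD !rmorphM.
apply: near_differentiable (comb (A ord_max ord0) (A ord_max ord_max) (snd2 b)).
by apply: filterS nt => u ->; rewrite gAb snd2D snd2_mulmx !rmorphD !rmorphM.
Qed.

Lemma lifting_square h : liftings sigma h -> aff_set G (h \o h).
Proof.
move=> [hc hE]; apply/pi1E; split.
  by move=> z; apply: continuous_comp; exact: hc.
by move=> z; rewrite /= !hE sigma_real.2.
Qed.

Lemma lifting_comp_r h g : liftings sigma h -> aff_set G g -> liftings sigma (h \o g).
Proof.
move=> [hc hE] Gg; split; last by move=> z; rewrite /= hE orbit_pi_act.
by move=> z; apply: continuous_comp; [exact: (@aff_continuous _ G)|exact: hc].
Qed.

(** Both [h \o g] and [h] lift [sigma]. *)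
Lemma lifting_conj h g : liftings sigma h -> aff_set G g ->
  exists2 k, aff_set G k & h \o g = k \o h.
Proof.
move=> hL Gg; have [c1 e1] := lifting_comp_r hL Gg; have [c2 e2] := hL.
by apply: lift_unique_global => // z; rewrite e1 e2.
Qed.

End RealStructure.

(** * Descent of equivariant maps to the quotients *)

Section Descent.
Variable R : realType.
Local Notation C2 := (C2 R).
Variables G G' : affine_group R.

(** A representative is chosen; the equivariance required in [descendE] removes the dependence on
    it. *)
Definition descend (F : C2 -> C2) (x : orbit_space G) : orbit_space G' :=
  orbit_pi G' (F (repr (x : {eq_quot orbit_equiv G}))).

Lemma descendE (F : C2 -> C2) z :
  (forall g, aff_set G g -> exists2 g', aff_set G' g' & F \o g = g' \o F) ->
  descend F (orbit_pi G z) = orbit_pi G' (F z).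
Proof.
move=> H; rewrite /descend.
have [g Gg gE] : exists2 g, aff_set G g &
    g z = repr ((orbit_pi G z : orbit_space G) : {eq_quot orbit_equiv G}).
  by apply/orbit_piP; rewrite /orbit_pi reprK.
rewrite -gE; have [g' Gg' e] := H g Gg.
have -> : F (g z) = g' (F z) by exact: (congr1 (fun k => k z) e).
exact: orbit_pi_act.
Qed.

End Descent.

Section Extensions.
Variable R : realType.
Local Notation C2 := (C2 R).
Variables (G G' : affine_group R).
Variables (sigma : orbit_space G -> orbit_space G) (sigma' : orbit_space G' -> orbit_space G').

Lemma equivariant_diffeomorphism (F F' h h' : C2 -> C2) (phi : (C2 -> C2) -> (C2 -> C2)) :
  cancel F F' -> cancel F' F -> smooth_on setT F -> smooth_on setT F' ->
  (forall g, aff_set G g -> aff_set G' (phi g)) ->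
  (forall g', aff_set G' g' -> exists2 g, aff_set G g & phi g = g') ->
  (forall g, aff_set G g -> F \o g = phi g \o F) ->
  liftings sigma h -> liftings sigma' h' -> F \o h = h' \o F ->
  exists f : orbit_space G -> orbit_space G',
    diffeomorphism f /\ (forall x, f (sigma x) = sigma' (f x)).
Proof.
move=> FK F'K sF sF' phiG phiS FE [_ hE] [_ h'E] Fh.
have H g : aff_set G g -> exists2 g', aff_set G' g' & F \o g = g' \o F.
  by move=> Gg; exists (phi g); [exact: phiG|exact: FE].
have H' g' : aff_set G' g' -> exists2 g, aff_set G g & F' \o g' = g \o F'.
  move=> /phiS[g Gg <-]; exists g => //; apply/funext => z /=.
  by have := congr1 (fun k => k (F' z)) (FE g Gg); rewrite /= F'K => <-; rewrite FK.
exists (descend G' F); split.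
  exists (descend G F'); split.
  - by move=> x; have [z <-] := orbit_pi_surj x; rewrite !descendE // FK.
  - by move=> x; have [z <-] := orbit_pi_surj x; rewrite !descendE // F'K.
  - by move=> z; exists setT, F; split=> //; [exact: openT|move=> w _; exact: descendE].
  - by move=> z; exists setT, F'; split=> //; [exact: openT|move=> w _; exact: descendE].
move=> x; have [z <-] := orbit_pi_surj x; rewrite -hE !descendE // -h'E.
by congr (orbit_pi _ _); exact: (congr1 (fun k => k z) Fh).
Qed.

Hypothesis Gpd : properly_discontinuous G.
Hypothesis Gfree : fixed_point_free G.
Hypothesis G'pd : properly_discontinuous G'.
Hypothesis G'free : fixed_point_free G'.
Hypothesis sigma_real : real_structure sigma.
Hypothesis sigma'_real : real_structure sigma'.

Lemma extension_iso_lifting : orb_extension_iso sigma sigma' ->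
  exists (phi : (C2 -> C2) -> (C2 -> C2)) (h h' : C2 -> C2),
  [/\ liftings sigma h, liftings sigma' h',
      (forall g, aff_set G g -> aff_set G' (phi g)),
      (forall g', aff_set G' g' -> exists2 g, aff_set G g & phi g = g') &
      [/\ (forall g k, aff_set G g -> aff_set G k -> phi (g \o k) = phi g \o phi k),
      (forall g k, aff_set G g -> aff_set G k -> phi g = phi k -> g = k),
      phi (h \o h) = h' \o h' &
      (forall g k, aff_set G g -> aff_set G k -> h \o g = k \o h ->
         h' \o phi g = phi k \o h')]].
Proof.
move=> [phi [[phiF phiI phiS] phiM phiG phiP]].
have piE := pi1E Gpd Gfree; have piE' := pi1E G'pd G'free.
have orbG g : aff_set G g -> pi1_orb sigma g by move=> Gg; left; exact/piE.
have [h hL] := lifting_exists Gpd Gfree sigma_real.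
have orbh : pi1_orb sigma h by right.
have phiGG g : aff_set G g -> aff_set G' (phi g).
  by move=> Gg; apply/piE'; rewrite -phiG; exists g => //; exact/piE.
have h'L : liftings sigma' (phi h).
  (* If [phi h] lies in [pi1 G'], compatibility with the projections puts [h] in [pi1 G], so [sigma]
     is the identity. Surjectivity of [phi] then makes [sigma'] the identity as well, and [phi h]
     lifts it all the same. *)
  have [h1|//] := phiF _ orbh.
  have : pi1 G h.
    have [//|nh] := pselect (pi1 G h); have := phiP h orbh.
    by rewrite /orb_proj asboolT // asboolF.
  move=> ph; have sid x : sigma x = x.
    by have [z <-] := orbit_pi_surj x; rewrite -hL.2; exact: ph.2.
  have [k kL] := lifting_exists G'pd G'free sigma'_real.
  have [j jO jk] : exists2 j, pi1_orb sigma j & phi j = k.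
    by apply: phiS; right.
  have pj : pi1 G j.
    by case: jO => // -[jc jE]; split=> // z; rewrite jE sid.
  have pk : pi1 G' k by rewrite -phiG -jk; exists j.
  have sid' x : sigma' x = x.
    by have [z <-] := orbit_pi_surj x; rewrite -kL.2; exact: pk.2.
  by split; [exact: h1.1|move=> z; rewrite sid'; exact: h1.2].
exists phi, h, (phi h); split => //.
  move=> g' /piE'; rewrite -phiG => -[g /piE Gg <-]; by exists g.
split.
- by move=> g k Gg Gk; apply: phiM; exact: orbG.
- by move=> g k Gg Gk e; apply: phiI => //; rewrite inE; exact: orbG.
- exact: phiM.
- by move=> g k Gg Gk e; rewrite -!phiM ?e //; exact: orbG.
Qed.

End Extensions.

(** * Polynomial coordinates *)

Section PolynomialMaps.
Variable R : realType.
Local Notation C := (Cplx R).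
Local Notation C2 := (C2 R).

(** A class of differentiable functions closed under directional derivatives, which reduces [Ck] to
    an induction on the order. *)
Inductive rpoly : ('cV[R]_4 -> R) -> Prop :=
| rpoly_cst c : rpoly (fun=> c)
| rpoly_coord i : rpoly (fun x => x i ord0)
| rpoly_add f g : rpoly f -> rpoly g -> rpoly (fun x => f x + g x)
| rpoly_mul f g : rpoly f -> rpoly g -> rpoly (fun x => f x * g x).

Lemma rpoly_differentiable f x : rpoly f -> differentiable f x.
Proof.
elim=> [c|i|g h _ dg _ dh|g h _ dg _ dh].
- exact: differentiable_cst.
- exact: differentiable_coord.
- exact: (@differentiableD R _ _ g h).
- exact: (@differentiableM R _ g h).
Qed.

Lemma rpoly_derive f v : rpoly f -> rpoly (fun x => 'D_v f x).
Proof.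
elim=> [c|i|g h pg dg ph dh|g h pg dg ph dh].
- have -> : (fun x => 'D_v (fun=> c) x) = (fun=> 0).
    by apply/funext => x; rewrite derive_cst.
  exact: rpoly_cst.
- have -> : (fun x => 'D_v (fun x : 'cV[R]_4 => x i ord0) x) = (fun=> v i ord0).
    apply/funext => x.
    have d : derivable (fun x : 'cV[R]_4 => x) x v by exact: derivable_id.
    have := derive_mx d; rewrite derive_id => /matrixP /(_ i ord0).
    by rewrite mxE => <-.
  exact: rpoly_cst.
- have -> : (fun x => 'D_v (fun x => g x + h x) x) = (fun x => 'D_v g x + 'D_v h x).
    apply/funext => x; apply: (@deriveD R _ _ g h); apply: diff_derivable;
      exact: rpoly_differentiable.
  exact: rpoly_add.
- have -> : (fun x => 'D_v (fun x => g x * h x) x) =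
      (fun x => g x * 'D_v h x + h x * 'D_v g x).
    apply/funext => x; apply: (@deriveM R _ g h); apply: diff_derivable;
      exact: rpoly_differentiable.
  by apply: rpoly_add; apply: rpoly_mul.
Qed.

Lemma differentiable_rpoly_cV (f : 'cV[R]_4 -> 'cV[R]_4) x :
  (forall i, rpoly (fun x => f x i ord0)) -> differentiable f x.
Proof.
move=> pf; have -> : f = \sum_(i < 4) (fun x => f x i ord0 *: (delta_mx i ord0 : 'cV[R]_4)).
  apply/funext => y; rewrite fct_sumE {1}[f y]matrix_sum_delta.
  by apply: eq_bigr => i _; rewrite big_ord1.
apply: differentiable_sum => i; apply: differentiableZl.
exact: rpoly_differentiable.
Qed.

Lemma rpoly_Ck (U : set 'cV[R]_4) (f : 'cV[R]_4 -> 'cV[R]_4) n :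
  (forall i, rpoly (fun x => f x i ord0)) -> Ck n U f.
Proof.
move=> pf; elim: n f pf => [|n IH] f pf.
  by move=> x _; apply: differentiable_continuous; exact: differentiable_rpoly_cV.
split=> [x _|v]; first exact: differentiable_rpoly_cV.
apply: IH => i.
have -> : (fun x => ('D_v f x) i ord0) = (fun x => 'D_v (fun x => f x i ord0) x).
  apply/funext => x; rewrite derive_mx ?mxE //; apply: diff_derivable.
  exact: differentiable_rpoly_cV.
exact: rpoly_derive.
Qed.

Definition cpoly (f : C2 -> C) :=
  rpoly (fun x => complex.Re (f (complexify x))) /\
  rpoly (fun x => complex.Im (f (complexify x))).

Lemma cpoly_cst c : cpoly (fun=> c).
Proof. by split; exact: rpoly_cst. Qed.

Lemma cpoly_add f g : cpoly f -> cpoly g -> cpoly (fun z => f z + g z).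
Proof.
move=> [f1 f2] [g1 g2]; split.
  have -> : (fun x => complex.Re (f (complexify x) + g (complexify x))) =
    (fun x => complex.Re (f (complexify x)) + complex.Re (g (complexify x))).
    by apply/funext => x; case: (f _) (g _) => ? ? [].
  exact: rpoly_add.
have -> : (fun x => complex.Im (f (complexify x) + g (complexify x))) =
  (fun x => complex.Im (f (complexify x)) + complex.Im (g (complexify x))).
  by apply/funext => x; case: (f _) (g _) => ? ? [].
exact: rpoly_add.
Qed.

Lemma cpoly_mul f g : cpoly f -> cpoly g -> cpoly (fun z => f z * g z).
Proof.
move=> [f1 f2] [g1 g2]; split.
  have -> : (fun x => complex.Re (f (complexify x) * g (complexify x))) =
    (fun x => complex.Re (f (complexify x)) * complex.Re (g (complexify x))
      + -1 * (complex.Im (f (complexify x)) * complex.Im (g (complexify x)))).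
    by apply/funext => x; rewrite mulN1r; case: (f _) (g _) => ? ? [].
  apply: rpoly_add; first exact: rpoly_mul.
  by apply: rpoly_mul; [exact: rpoly_cst|exact: rpoly_mul].
have -> : (fun x => complex.Im (f (complexify x) * g (complexify x))) =
  (fun x => complex.Re (f (complexify x)) * complex.Im (g (complexify x))
      + complex.Im (f (complexify x)) * complex.Re (g (complexify x))).
  by apply/funext => x; case: (f _) (g _) => ? ? [].
by apply: rpoly_add; apply: rpoly_mul.
Qed.

Lemma cpoly_conj f : cpoly f -> cpoly (fun z => conjc (f z)).
Proof.
move=> [f1 f2]; split.
  have -> // : (fun x => complex.Re (conjc (f (complexify x)))) =
    (fun x => complex.Re (f (complexify x))).
  by apply/funext => x; case: (f _).
have -> : (fun x => complex.Im (conjc (f (complexify x)))) =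
  (fun x => -1 * complex.Im (f (complexify x))).
  by apply/funext => x; rewrite mulN1r; case: (f _).
by apply: rpoly_mul; first exact: rpoly_cst.
Qed.

Lemma cpoly_opp f : cpoly f -> cpoly (fun z => - f z).
Proof.
move=> pf; have -> : (fun z => - f z) = (fun z => -1 * f z).
  by apply/funext => z; rewrite mulN1r.
by apply: cpoly_mul; first exact: cpoly_cst.
Qed.

Lemma cpoly_fst2 : cpoly (@fst2 R).
Proof.
split.
  have -> : (fun x => complex.Re (fst2 (complexify x))) =
      (fun x : 'cV[R]_4 => x (lshift 2 (ord0 : 'I_2)) ord0).
    by apply/funext => x; rewrite /fst2 /complexify !mxE.
  exact: rpoly_coord.
have -> : (fun x => complex.Im (fst2 (complexify x))) =
    (fun x : 'cV[R]_4 => x (rshift 2 (ord0 : 'I_2)) ord0).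
  by apply/funext => x; rewrite /fst2 /complexify !mxE.
exact: rpoly_coord.
Qed.

Lemma cpoly_snd2 : cpoly (@snd2 R).
Proof.
split.
  have -> : (fun x => complex.Re (snd2 (complexify x))) =
      (fun x : 'cV[R]_4 => x (lshift 2 (ord_max : 'I_2)) ord0).
    by apply/funext => x; rewrite /snd2 /complexify !mxE.
  exact: rpoly_coord.
have -> : (fun x => complex.Im (snd2 (complexify x))) =
    (fun x : 'cV[R]_4 => x (rshift 2 (ord_max : 'I_2)) ord0).
  by apply/funext => x; rewrite /snd2 /complexify !mxE.
exact: rpoly_coord.
Qed.

Lemma cpoly_smooth (F : C2 -> C2) : cpoly (fun z => fst2 (F z)) ->
  cpoly (fun z => snd2 (F z)) -> smooth_on setT F.
Proof.
move=> [p1 p2] [q1 q2] n; apply: rpoly_Ck => i.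
have rE (x : 'cV[R]_4) : (@realify R \o F \o @complexify R) x i ord0 =
   match fintype.split (i : 'I_(2 + 2)) with
   | inl j => complex.Re (F (complexify x) j ord0)
   | inr j => complex.Im (F (complexify x) j ord0) end.
  by rewrite /= /realify mxE; case: fintype.split => j; rewrite mxE.
have -> : (fun x => (@realify R \o F \o @complexify R) x i ord0) = (fun x =>
   match fintype.split (i : 'I_(2 + 2)) with
   | inl j => complex.Re (F (complexify x) j ord0)
   | inr j => complex.Im (F (complexify x) j ord0) end) by apply/funext.
case: fintype.split => j; case: j => [[|[|//]]] Hj.
- by have -> : Ordinal Hj = ord0 by exact: val_inj.
- by have -> : Ordinal Hj = ord_max by exact: val_inj.
- by have -> : Ordinal Hj = ord0 by exact: val_inj.
- by have -> : Ordinal Hj = ord_max by exact: val_inj.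
Qed.

End PolynomialMaps.

Section Charts.
Variable R : realType.
Local Notation C := (Cplx R).
Local Notation C2 := (C2 R).

Lemma continuous_realify : continuous (@realify R).
Proof.
move=> z; rewrite /prop_for /continuous_at => A /= [P Pz PA].
have cR i j : {for z, continuous (fun w : C2 => realify w i j)}.
  rewrite /realify; have [k kE] : exists k : 'I_2, (forall w : C2,
      (col_mx (map_mx (@complex.Re R) w) (map_mx (@complex.Im R) w) : 'cV[R]_(2 + 2)) i j
        = complex.Re (w k ord0)) \/ (forall w : C2,
      (col_mx (map_mx (@complex.Re R) w) (map_mx (@complex.Im R) w) : 'cV[R]_(2 + 2)) i j
        = complex.Im (w k ord0)).
    case: (fintype.splitP (i : 'I_(2 + 2))) => k ik; exists k.
      by left=> w; rewrite (ord1 j) (_ : i = lshift 2 k) ?col_mxEu ?mxE //; exact: val_inj.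
    by right=> w; rewrite (ord1 j) (_ : i = rshift 2 k) ?col_mxEd ?mxE //; exact: val_inj.
  have cw : {for z, continuous (fun w : C2 => w k ord0 : C)} by exact: coord_continuous.
  case: kE => kE; [have -> : (fun w : C2 => (col_mx (map_mx (@complex.Re R) w)
      (map_mx (@complex.Im R) w) : 'cV[R]_(2 + 2)) i j) =
      (fun x : C => complex.Re x : R) \o (fun w : C2 => w k ord0) by apply/funext|
    have -> : (fun w : C2 => (col_mx (map_mx (@complex.Re R) w)
      (map_mx (@complex.Im R) w) : 'cV[R]_(2 + 2)) i j) =
      (fun x : C => complex.Im x : R) \o (fun w : C2 => w k ord0) by apply/funext].
  - by apply: continuous_comp; [exact: cw|exact: continuous_Re].
  - by apply: continuous_comp; [exact: cw|exact: continuous_Im].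
change (nbhs z [set w | A (realify w)]).
have H (ij : 'I_4 * 'I_1) : nbhs z [set w | P ij.1 ij.2 (realify w ij.1 ij.2)].
  exact: (cR _ _ _ (Pz ij.1 ij.2)).
apply: filterS (filter_forall (nbhs_filter z) H) => w wP; apply: PA => i j.
exact: (wP (i, j)).
Qed.

Lemma realifyK (z : C2) : complexify (realify z) = z.
Proof.
apply/matrixP => i j; rewrite (ord1 j) /complexify mxE /realify.
rewrite col_mxKu col_mxKd !mxE.
by case: (z i ord0).
Qed.

Lemma cpoly_continuous (f : C2 -> C) : cpoly f -> continuous f.
Proof.
move=> [f1 f2] z.
have c (g : 'cV[R]_4 -> R) : rpoly g -> {for z, continuous (g \o @realify R)}.
  move=> pg; apply: continuous_comp; first exact: continuous_realify.
  exact: (differentiable_continuous (rpoly_differentiable _ pg)).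
apply: cvg_toC => e e0; have e2 : 0 < e / 2 by rewrite divr_gt0.
have n1 : nbhs z [set w | `|complex.Re (f z) - complex.Re (f w)| < e / 2].
  have := c _ f1; rewrite /prop_for /continuous_at /= realifyK.
  move=> /(@cvgrPdist_lt _ R^o _ (nbhs z)) /(_ _ e2).
  by apply: filterS => w /=; rewrite realifyK.
have n2 : nbhs z [set w | `|complex.Im (f z) - complex.Im (f w)| < e / 2].
  have := c _ f2; rewrite /prop_for /continuous_at /= realifyK.
  move=> /(@cvgrPdist_lt _ R^o _ (nbhs z)) /(_ _ e2).
  by apply: filterS => w /=; rewrite realifyK.
apply: filterS (filterI n1 n2) => w [/= w1 w2].
apply: le_lt_trans (cabs_le_ReIm _) _.
have -> : complex.Re (f w - f z) = - (complex.Re (f z) - complex.Re (f w)).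
  by rewrite opprB; case: (f w) (f z) => ? ? [].
have -> : complex.Im (f w - f z) = - (complex.Im (f z) - complex.Im (f w)).
  by rewrite opprB; case: (f w) (f z) => ? ? [].
by rewrite !normrN; lra.
Qed.

(* Polynomial coordinates on C^2; that they are holomorphic is only recorded
   along entire and anti-entire curves, which is how it is used. *)
Record chart (X Y : C2 -> C) (M : C -> C -> C2) : Prop := Chart {
  chX : forall x y, X (M x y) = x;
  chY : forall x y, Y (M x y) = y;
  chM : forall z, M (X z) (Y z) = z;
  chXp : cpoly X;
  chYp : cpoly Y;
  chMp : forall f g : C2 -> C, cpoly f -> cpoly g ->
    cpoly (fun z => fst2 (M (f z) (g z))) /\ cpoly (fun z => snd2 (M (f z) (g z)));
  chMb : forall r : R, exists N : R, forall x y, cabs x <= r -> cabs y <= r -> nm (M x y) <= N;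
  chMh : forall f g : C -> C, entire f -> entire g ->
    forall t : C, differentiable ((fun t => M (f t) (g t)) : C^o -> C2) t;
  chanti : forall w : C -> C2, entire (fun t => conjc (fst2 (w t))) ->
    entire (fun t => conjc (snd2 (w t))) ->
    entire (fun t => conjc (X (w t))) /\ entire (fun t => conjc (Y (w t)))
}.

Lemma entire_cst (c : C) : entire (fun=> c).
Proof. by move=> t; exact: differentiable_cst. Qed.

Lemma entire_id : entire (id : C -> C).
Proof. by []. Qed.

Lemma entireD (f g : C -> C) : entire f -> entire g -> entire (fun t => f t + g t).
Proof. by move=> ef eg t; exact: (@differentiableD C C^o C^o f g). Qed.

Lemma entireM (f g : C -> C) : entire f -> entire g -> entire (fun t => f t * g t).
Proof. by move=> ef eg t; exact: (@differentiableM C C^o f g). Qed.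

Lemma differentiable_mk2 (f g : C -> C) : entire f -> entire g ->
  forall t : C, differentiable ((fun t => mk2 (f t) (g t)) : C^o -> C2) t.
Proof.
move=> ef eg t.
have -> : (fun t => mk2 (f t) (g t)) = (fun t => f t *: mk2 1 0 + g t *: mk2 0 1).
  by apply/funext => u; apply: C2P; rewrite !coord2E; ring.
apply: (@differentiableD C C^o C2 (fun t => f t *: mk2 1 0) (fun t => g t *: mk2 0 1)).
  by apply: (@differentiableZl C C^o C2 f); exact: ef.
by apply: (@differentiableZl C C^o C2 g); exact: eg.
Qed.

Definition lin2 (p q : C) (z : C2) := p * fst2 z + q * snd2 z.
Definition inv2 (p q r s : C) (x y : C) : C2 :=
  mk2 ((s * x - q * y) / (p * s - q * r)) ((p * y - r * x) / (p * s - q * r)).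

Lemma cpoly_lin2 p q : cpoly (lin2 p q).
Proof.
apply: cpoly_add; apply: cpoly_mul; try exact: cpoly_cst.
  exact: cpoly_fst2.
exact: cpoly_snd2.
Qed.

Lemma cabs_lin (p q x y : C) (r : R) : 0 <= r -> cabs x <= r -> cabs y <= r ->
  cabs (p * x + q * y) <= (cabs p + cabs q) * r.
Proof.
move=> r0 xr yr; apply: le_trans (cabsD _ _) _; rewrite !cabsM mulrDl lerD //.
  by rewrite ler_wpM2l ?cabs_ge0.
by rewrite ler_wpM2l ?cabs_ge0.
Qed.

Lemma linear_chart (p q r s : C) : p * s - q * r != 0 ->
  chart (lin2 p q) (lin2 r s) (inv2 p q r s).
Proof.
move=> D0; set D := p * s - q * r in D0.
have MX x y : inv2 p q r s x y =
    mk2 (s / D * x + (- q) / D * y) ((- r) / D * x + p / D * y).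
  by rewrite /inv2 -/D; congr mk2; ring.
split.
- by move=> x y; rewrite /inv2 /lin2 !coord2E -/D /D; field.
- by move=> x y; rewrite /inv2 /lin2 !coord2E -/D /D; field.
- by move=> z; apply: C2P; rewrite /inv2 /lin2 !coord2E -/D /D; field.
- exact: cpoly_lin2.
- exact: cpoly_lin2.
- move=> f g pf pg; split.
    have -> : (fun z => fst2 (inv2 p q r s (f z) (g z))) =
      (fun z => s / D * f z + (- q) / D * g z).
      by apply/funext => z; rewrite MX fst2_mk.
    by apply: cpoly_add; apply: cpoly_mul => //; exact: cpoly_cst.
  have -> : (fun z => snd2 (inv2 p q r s (f z) (g z))) =
    (fun z => (- r) / D * f z + p / D * g z).
    by apply/funext => z; rewrite MX snd2_mk.
  by apply: cpoly_add; apply: cpoly_mul => //; exact: cpoly_cst.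
- move=> t; exists ((cabs (s / D) + cabs (- q / D)) * t + (cabs (- r / D) + cabs (p / D)) * t).
  move=> x y xt yt; have t0 : 0 <= t := le_trans (cabs_ge0 x) xt.
  by rewrite MX /nm fst2_mk snd2_mk lerD // cabs_lin.
- move=> f g ef eg t; have -> : (fun t => inv2 p q r s (f t) (g t)) =
      (fun t => mk2 (s / D * f t + (- q) / D * g t) ((- r) / D * f t + p / D * g t)).
    by apply/funext => u; rewrite MX.
  by apply: differentiable_mk2; apply: entireD;
    apply: entireM => //; exact: entire_cst.
- move=> w w1 w2.
  have H a b : entire (fun t => conjc (lin2 a b (w t))).
    have -> : (fun t => conjc (lin2 a b (w t))) =
      (fun t => conjc a * conjc (fst2 (w t)) + conjc b * conjc (snd2 (w t))).
      by apply/funext => t; rewrite /lin2 rmorphD !rmorphM.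
    by apply: entireD; apply: entireM => //; exact: entire_cst.
  by split; exact: H.
Qed.

Lemma shear_chart X Y M (k l : C) : k != 0 -> chart X Y M ->
  chart X (fun z => k * (Y z - l * (X z * X z))) (fun x y => M x (k^-1 * y + l * (x * x))).
Proof.
move=> k0 ch; split.
- by move=> x y; rewrite (chX ch).
- by move=> x y; rewrite (chX ch) (chY ch) addrK mulrA divff // mul1r.
- by move=> z; rewrite (mulKf k0) subrK (chM ch).
- exact: chXp ch.
- apply: cpoly_mul; first exact: cpoly_cst.
  apply: cpoly_add; first exact: chYp ch.
  apply: cpoly_opp; apply: cpoly_mul; first exact: cpoly_cst.
  by apply: cpoly_mul; exact: chXp ch.
- move=> f g pf pg; apply: (chMp ch pf (g := fun z => k^-1 * g z + l * (f z * f z))).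
  apply: cpoly_add; first by apply: cpoly_mul => //; exact: cpoly_cst.
  by apply: cpoly_mul; [exact: cpoly_cst|exact: cpoly_mul].
- move=> r; pose r' := Num.max r (cabs k^-1 * r + cabs l * (r * r)).
  have [N NP] := chMb ch r'; exists N => x y xr yr.
  have r0 : 0 <= r := le_trans (cabs_ge0 x) xr.
  apply: NP; rewrite le_max; first by rewrite xr.
  apply/orP; right; apply: le_trans (cabsD _ _) _; rewrite !cabsM lerD //.
    by rewrite ler_wpM2l ?cabs_ge0.
  by rewrite ler_wpM2l ?cabs_ge0 // ler_pM ?cabs_ge0.
- move=> f g ef eg t.
  apply: (chMh ch ef (g := fun t => k^-1 * g t + l * (f t * f t))).
  apply: entireD; first by apply: entireM => //; exact: entire_cst.
  by apply: entireM; [exact: entire_cst|exact: entireM].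
- move=> w w1 w2; have [eX eY] := chanti ch w1 w2; split => //.
  have -> : (fun t => conjc (k * (Y (w t) - l * (X (w t) * X (w t))))) =
    (fun t => conjc k * (conjc (Y (w t)) + (- conjc l) *
       (conjc (X (w t)) * conjc (X (w t))))).
    by apply/funext => t; rewrite rmorphM rmorphB !rmorphM mulNr.
  apply: entireM; first exact: entire_cst.
  apply: entireD => //; apply: entireM; first exact: entire_cst.
  exact: entireM.
Qed.

End Charts.

(** * Additive maps on lattices *)

Section LatticeExtension.
Variable R : realType.

(** [Gam] is a subgroup of pairs of a vector and a value, a graph not assumed to be single-valued.
    [Gam_span] says that no nonzero linear functional kills all the vectors, [Gam_bound] that
    bounded vectors have bounded values. Discreteness is not assumed. *)
Variables (n : nat) (Gam : set ('rV[R]_n * R)).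
Hypothesis Gam0 : Gam 0.
Hypothesis GamB : forall p q, Gam p -> Gam q -> Gam (p - q).
Hypothesis Gam_span : forall l : 'cV[R]_n, (forall p, Gam p -> p.1 *m l = 0) -> l = 0.
Hypothesis Gam_bound : forall r : R, exists N : R, forall p, Gam p ->
  (forall i, `|p.1 ord0 i| <= r) -> `|p.2| <= N.

Lemma GamN p : Gam p -> Gam (- p).
Proof. by move=> Gp; rewrite -sub0r; exact: GamB. Qed.

Lemma GamD p q : Gam p -> Gam q -> Gam (p + q).
Proof. by move=> Gp Gq; rewrite -[q]opprK; apply: GamB => //; exact: GamN. Qed.

Lemma GamMn p k : Gam p -> Gam (p *+ k).
Proof. by move=> Gp; elim: k => [|k IH]; rewrite ?mulr0n // mulrS; exact: GamD. Qed.

Lemma GamMz p (z : int) : Gam p -> Gam (p *~ z).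
Proof.
move=> Gp; case: z => k; first exact: GamMn.
by rewrite NegzE mulrNz; apply: GamN; exact: GamMn.
Qed.

Lemma Gam_sum (f : 'I_n -> 'rV[R]_n * R) : (forall i, Gam (f i)) -> Gam (\sum_i f i).
Proof. by move=> Gf; elim/big_ind : _ => // p q; exact: GamD. Qed.

(** A nonzero [v] orthogonal to the rows found so far pairs nontrivially with some vector of [Gam],
    by [Gam_span]; that vector is independent of the rows. *)
Lemma Gam_free k : (k <= n)%N -> exists (A : 'M[R]_(k, n)) (y : 'cV[R]_k),
  row_free A /\ forall i, Gam (row i A, y i ord0).
Proof.
elim: k => [|k IH] kn.
  exists 0, 0; split; last by case.
  by rewrite -row_leq_rank.
have [A [y [fA GA]]] := IH (ltnW kn).
have [v v0 vA] : exists2 v : 'rV[R]_n, v != 0 & v *m A^T = 0.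
  have : kermx A^T != 0.
    by rewrite -mxrank_eq0 mxrank_ker mxrank_tr subn_eq0 -ltnNge
      (leq_ltn_trans (rank_leq_row A)).
  case/rowV0Pn => v /sub_kermxP vA v0; by exists v.
have [p Gp pv] : exists2 p, Gam p & p.1 *m v^T != 0.
  apply: contrapT => no; move/eqP: v0; apply.
  rewrite -[v]trmxK [v^T]Gam_span ?trmx0 // => p Gp; apply/eqP.
  by apply: contrapT => /negP pv; apply: no; exists p.
have pA : ~~ (p.1 <= A)%MS.
  apply/negP => /submxP[D pD]; move/eqP: pv; apply.
  by rewrite pD -mulmxA -[A]trmxK -trmx_mul vA trmx0 mulmx0.
have rk : (k < \rank (col_mx A p.1))%N.
  move: fA; rewrite /row_free => /eqP {1}<-.
  rewrite -addsmxE; apply: rank_ltmx; rewrite /ltmx addsmxSl /=.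
  by rewrite addsmx_sub submx_refl /= (negbTE pA).
have ek : (k + 1 = k.+1)%N by rewrite addn1.
pose A' : 'M[R]_(k.+1, n) := castmx (ek, erefl) (col_mx A p.1).
pose y' : 'cV[R]_k.+1 := castmx (ek, erefl) (col_mx y (p.2)%:M).
exists A', y'; split.
  rewrite -row_leq_rank; apply: leq_trans rk _.
  by rewrite /A'; move: (ek); case: _ / (ek) => e; rewrite (eq_axiomK e) castmx_id.
move=> i; have [j ->] : exists j, i = cast_ord ek j.
  by exists (cast_ord (esym ek) i); exact: val_inj.
have -> : y' (cast_ord ek j) ord0 = col_mx y (p.2)%:M j ord0.
  by rewrite /y' castmxE /= cast_ordK; congr (col_mx _ _ _ _); exact: val_inj.
have -> : row (cast_ord ek j) A' = row j (col_mx A p.1).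
  by apply/rowP => l; rewrite !mxE castmxE cast_ordK /= cast_ord_id !mxE.
case: (fintype.splitP j) => l jl.
  have -> : j = lshift 1 l by exact: val_inj.
  by rewrite col_mxEu rowKu; exact: GA.
have -> : j = rshift k l by exact: val_inj.
rewrite col_mxEd rowKd (ord1 l) mxE eqxx mulr1n.
have -> : row ord0 p.1 = p.1 by apply/rowP => m; rewrite mxE.
by rewrite -surjective_pairing.
Qed.

Lemma real_bounded_multiples (x N : R) : (forall k : nat, `|x *+ k| <= N) -> x = 0.
Proof.
move=> H; apply: contrapT => /eqP x0.
have xp : 0 < `|x| by rewrite normr_gt0.
have := H (Num.truncn (N / `|x|)).+1; rewrite normrMn -mulr_natr mulrC -ler_pdivlMr //.
by apply/negP; rewrite -ltNge; exact: truncnS_gt.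
Qed.

(* The difference to the linear function with the same values on a basis is
   bounded, as every lattice vector is congruent to a bounded one modulo the
   lattice spanned by the basis; being additive, it vanishes. *)
Lemma lattice_extension : exists L : 'cV[R]_n, forall p, Gam p -> p.2 = (p.1 *m L) ord0 ord0.
Proof.
have [A [y [fA GA]]] := Gam_free (leqnn n).
have uA : A \in unitmx by rewrite -row_free_unit.
pose L := invmx A *m y; exists L.
pose psi (p : 'rV[R]_n * R) := p.2 - (p.1 *m L) ord0 ord0.
have psiD p q : psi (p + q) = psi p + psi q.
  by rewrite /psi /= mulmxDl mxE opprD addrACA.
have psi0 : psi 0 = 0 by rewrite /psi /= mul0mx mxE subrr.
have psiN p : psi (- p) = - psi p.
  by apply/eqP; rewrite -subr_eq0 opprK -psiD addNr psi0.
have psiMn p k : psi (p *+ k) = psi p *+ k.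
  by elim: k => [|k IH]; rewrite ?mulr0n // !mulrS psiD IH.
have psiA i : psi (row i A, y i ord0) = 0.
  rewrite /psi /L /= mulmxA -row_mul mulmxV // -row_mul mul1mx mxE.
  by rewrite subrr.
have psiMz p (z : int) : psi p = 0 -> psi (p *~ z) = 0.
  move=> p0; case: z => k; first by rewrite psiMn p0 mul0rn.
  by rewrite NegzE mulrNz psiN psiMn p0 mul0rn oppr0.
(* A vector whose coordinates in the basis [A] lie between 0 and 1 has entries at most [r]. *)
pose r := \sum_i \sum_j `|A i j|.
have [N NP] := Gam_bound r.
pose N' := N + r * \sum_j `|L j ord0|.
have psi_bound p : Gam p -> `|psi p| <= N'.
  move=> Gp; pose s := p.1 *m invmx A.
  (* The integral part of [p] in the basis, on which [psi] vanishes. *)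
  pose t := \sum_i (row i A, y i ord0) *~ (Num.floor (s ord0 i)).
  have Gt : Gam t by apply: Gam_sum => i; exact: GamMz.
  have psit : psi t = 0.
    rewrite /t; elim/big_ind : _ => [|q q' h h'|i _]; first exact: psi0.
      by rewrite psiD h h' addr0.
    by apply: psiMz; exact: psiA.
  have -> : psi p = psi (p - t) by rewrite psiD psiN psit subr0.
  have t1 : t.1 = (\row_i (Num.floor (s ord0 i))%:~R) *m A.
    rewrite /t (big_morph (@fst 'rV[R]_n R) (id1 := 0) (op1 := +%R)) //.
    rewrite mulmx_sum_row; apply: eq_bigr => i _.
    have fstMn (q : 'rV[R]_n * R) k : (q *+ k).1 = q.1 *+ k.
      by elim: k => [|k IH]; rewrite ?mulr0n // !mulrS /= IH.
    have -> (q : 'rV[R]_n * R) (z : int) : (q *~ z).1 = q.1 *~ z.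
      by case: z => k; [exact: fstMn|rewrite NegzE !mulrNz /= fstMn].
    have -> : (\row_j (Num.floor (s ord0 j))%:~R : 'rV[R]_n) 0 i =
      (Num.floor (s ord0 i))%:~R by rewrite mxE.
    by rewrite scaler_int.
  have pt1 i : `|(p - t).1 ord0 i| <= r.
    have -> : (p - t).1 = (\row_i (s ord0 i - (Num.floor (s ord0 i))%:~R)) *m A.
      rewrite /= t1 -[in LHS](mulmxKV uA p.1) -/s -mulmxBl; congr (_ *m _).
      by apply/rowP => j; rewrite !mxE.
    rewrite mxE; apply: le_trans (ler_norm_sum _ _ _) _; rewrite /r.
    apply: ler_sum => j _; rewrite mxE normrM.
    apply: (@le_trans _ _ `|A j i|).
      rewrite ler_piMl // ger0_norm; last by rewrite subr_ge0 floor_le.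
      by have := floorD1_gt (s ord0 j); rewrite intrD => /ltW; rewrite lerBlDl addrC.
    by rewrite (bigD1 i) //= lerDl sumr_ge0.
  have r0 : 0 <= r by rewrite sumr_ge0 // => i _; exact: sumr_ge0.
  rewrite /psi; apply: le_trans (ler_normB _ _) _; rewrite lerD //.
    by apply: NP => //; exact: GamB.
  rewrite mxE; apply: le_trans (ler_norm_sum _ _ _) _.
  rewrite mulr_sumr; apply: ler_sum => j _; rewrite normrM.
  by rewrite ler_wpM2r.
move=> p Gp; apply/eqP; rewrite -subr_eq0 -/(psi p); apply/eqP.
apply: (@real_bounded_multiples _ N') => k.
by rewrite -psiMn; apply: psi_bound; exact: GamMn.
Qed.

End LatticeExtension.

Section ComplexLattice.
Variable R : realType.
Local Notation C := (Cplx R).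

Lemma ReB (z w : C) : complex.Re (z - w) = complex.Re z - complex.Re w.
Proof. by case: z w => ? ? []. Qed.
Lemma ImB (z w : C) : complex.Im (z - w) = complex.Im z - complex.Im w.
Proof. by case: z w => ? ? []. Qed.

(** The general real-linear endomorphism of C, with unique coefficients. *)
Definition rlin (p q z : C) : C := p * z + q * conjc z.

Lemma rlinD p q z w : rlin p q (z + w) = rlin p q z + rlin p q w.
Proof. by rewrite /rlin rmorphD; ring. Qed.

Lemma rlinN p q z : rlin p q (- z) = - rlin p q z.
Proof. by rewrite /rlin rmorphN; ring. Qed.

Lemma rlinB p q z w : rlin p q (z - w) = rlin p q z - rlin p q w.
Proof. by rewrite rlinD rlinN. Qed.

Lemma rlin0 p q : rlin p q 0 = 0.
Proof. by rewrite /rlin rmorph0 !mulr0 addr0. Qed.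

Lemma rlin_comp p q p' q' z : rlin p q (rlin p' q' z) =
  rlin (p * p' + q * conjc q') (p * q' + q * conjc p') z.
Proof.
rewrite /rlin; case: p q p' q' z => [a b] [c d] [a' b'] [c' d'] [x y].
by apply/eqP; rewrite eq_complex /=; apply/andP; split; apply/eqP; ring.
Qed.

(** Substitute [(u + conj u) / 2] for the real part and [(u - conj u) / (2 i)] for the imaginary
    part. *)
Lemma rlin_coord (c0 c1 u : C) : c0 * (complex.Re u)%:C%C + c1 * (complex.Im u)%:C%C =
  rlin ((c0 - Complex 0 1 * c1) / 2) ((c0 + Complex 0 1 * c1) / 2) u.
Proof.
have h : (2^-1 : C) = (2^-1 : R)%:C%C by rewrite fmorphV rmorph_nat.
rewrite /rlin h; case: u c0 c1 => [x y] [a b] [c d] /=.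
by apply/eqP; rewrite eq_complex /=; apply/andP; split; apply/eqP; field.
Qed.

Lemma finite_real_extension (V : zmodType) (n : nat) (e : V -> 'rV[R]_n) (Gam : set (V * C)) :
  (forall x y, e (x - y) = e x - e y) ->
  Gam 0 -> (forall p q, Gam p -> Gam q -> Gam (p - q)) ->
  (forall l : 'cV[R]_n, (forall p, Gam p -> e p.1 *m l = 0) -> l = 0) ->
  (forall r : R, exists N : R, forall p, Gam p ->
     (forall i, `|e p.1 ord0 i| <= r) -> cabs p.2 <= N) ->
  exists c : 'I_n -> C, forall p, Gam p -> p.2 = \sum_i c i * (e p.1 ord0 i)%:C%C.
Proof.
move=> eB G0 GB Gspan Gbound.
have e0 : e 0 = 0 by rewrite -(subrr 0) eB subrr.
have ext (f : C -> R) : (forall z w, f (z - w) = f z - f w) ->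
    (forall z, `|f z| <= cabs z) ->
    exists L : 'cV[R]_n, forall p, Gam p -> f p.2 = (e p.1 *m L) ord0 ord0.
  move=> fB fb; have f0 : f 0 = 0 by rewrite -(subrr (0 : C)) fB subrr.
  pose D : set ('rV[R]_n * R) := [set q | exists2 p, Gam p & q = (e p.1, f p.2)].
  have [] := @lattice_extension R n D.
  - by exists 0 => //; rewrite /= e0 f0.
  - move=> _ _ [p Gp ->] [q Gq ->]; exists (p - q); first exact: GB.
    by rewrite /= eB fB.
  - by move=> l lP; apply: Gspan => p Gp; apply: (lP (e p.1, f p.2)); exists p.
  - move=> r; have [N NP] := Gbound r; exists N => _ [p Gp ->] /= pr.
    exact: le_trans (fb _) (NP p Gp pr).
  - by move=> L LP; exists L => p Gp; apply: (LP (e p.1, f p.2)); exists p.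
have [L1 H1] := ext (@complex.Re R) ReB (@Re_le_cabs R).
have [L2 H2] := ext (@complex.Im R) ImB (@Im_le_cabs R).
exists (fun i => Complex (L1 i ord0) (L2 i ord0)) => p Gp.
have ReS (k : 'I_n -> C) : complex.Re (\sum_i k i) = \sum_i complex.Re (k i).
  by apply: (big_morph (fun z : C => complex.Re z : R)) => // -[? ?] [].
have ImS (k : 'I_n -> C) : complex.Im (\sum_i k i) = \sum_i complex.Im (k i).
  by apply: (big_morph (fun z : C => complex.Im z : R)) => // -[? ?] [].
apply/eqP; rewrite eq_complex ReS ImS; apply/andP; split; apply/eqP.
  by rewrite H1 // mxE; apply: eq_bigr => i _; rewrite /= mulr0 subr0 mulrC.
by rewrite H2 // mxE; apply: eq_bigr => i _; rewrite /= mulr0 add0r mulrC.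
Qed.

(** Real functionals on C have the form [z |-> Re (l z)], the one with real coordinates [l0], [l1]
    having [l = l0 - i l1]; hence the shape of the spanning hypothesis. *)
Lemma rlin_extension (Gam : set (C * C)) :
  Gam 0 -> (forall p q, Gam p -> Gam q -> Gam (p - q)) ->
  (forall l : C, (forall p, Gam p -> complex.Re (l * p.1) = 0) -> l = 0) ->
  (forall r : R, exists N : R, forall p, Gam p -> cabs p.1 <= r -> cabs p.2 <= N) ->
  exists p q, forall w, Gam w -> w.2 = rlin p q w.1.
Proof.
move=> G0 GB Gspan Gbound.
pose e (z : C) : 'rV[R]_2 := \row_(i < 2) nth 0 [:: complex.Re z; complex.Im z] i.
have [] := @finite_real_extension _ 2 e Gam _ G0 GB.
- by move=> x y; apply/rowP => -[[|[|//]] Hi]; rewrite !mxE /= ?ReB ?ImB.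
- move=> l lP; suff /eqP : Complex (l ord0 ord0) (- l ord_max ord0) = 0 :> C.
    rewrite eq_complex /= oppr_eq0 => /andP[/eqP l0 /eqP l1].
    apply/colP => -[[|[|//]] Hi]; rewrite mxE.
      by rewrite -[RHS]l0; congr (l _ _); exact: val_inj.
    by rewrite -[RHS]l1; congr (l _ _); exact: val_inj.
  apply: Gspan => p Gp; have /matrixP /(_ ord0 ord0) := lP p Gp.
  rewrite !mxE big_ord_recr big_ord1 /= !mxE /=.
  have -> : widen_ord (leqnSn 1) ord0 = ord0 :> 'I_2 by exact: val_inj.
  by case: p.1 => x y /=; rewrite mulNr opprK (mulrC x) (mulrC y).
- move=> r; have [N NP] := Gbound (r + r); exists N => p Gp pr.
  apply: NP => //; apply: le_trans (cabs_le_ReIm _) _.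
  by have := pr ord0; have := pr ord_max; rewrite !mxE /=; lra.
move=> c cP; eexists; eexists => w Gw; rewrite (cP w Gw).
rewrite big_ord_recr big_ord1 /= !mxE /=; exact: rlin_coord.
Qed.

Lemma rlin2_extension (Gam : set ((C * C) * C)) :
  Gam 0 -> (forall p q, Gam p -> Gam q -> Gam (p - q)) ->
  (forall l m : C, (forall p, Gam p -> complex.Re (l * p.1.1 + m * p.1.2) = 0) ->
     l = 0 /\ m = 0) ->
  (forall r : R, exists N : R, forall p, Gam p -> cabs p.1.1 <= r -> cabs p.1.2 <= r ->
     cabs p.2 <= N) ->
  exists p q p' q', forall w, Gam w -> w.2 = rlin p q w.1.1 + rlin p' q' w.1.2.
Proof.
move=> G0 GB Gspan Gbound.
pose e (z : C * C) : 'rV[R]_4 := \row_(i < 4)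
  nth 0 [:: complex.Re z.1; complex.Im z.1; complex.Re z.2; complex.Im z.2] i.
have o0 : widen_ord (leqnSn 3) (widen_ord (leqnSn 2) (widen_ord (leqnSn 1) (ord_max : 'I_1))) = inord 0 :> 'I_4.
  by apply: val_inj; rewrite /= inordK.
have o1 : widen_ord (leqnSn 3) (widen_ord (leqnSn 2) (ord_max : 'I_2)) = inord 1 :> 'I_4.
  by apply: val_inj; rewrite /= inordK.
have o2 : widen_ord (leqnSn 3) (ord_max : 'I_3) = inord 2 :> 'I_4.
  by apply: val_inj; rewrite /= inordK.
have o3 : ord_max = inord 3 :> 'I_4 by apply: val_inj; rewrite /= inordK.
have [] := @finite_real_extension (C * C)%type 4 e Gam _ G0 GB.
- move=> x y; apply/rowP => -[[|[|[|[|//]]]] Hi]; rewrite !mxE /= ?ReB ?ImB //.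
- move=> l lP.
  have [] := Gspan (Complex (l (inord 0) ord0) (- l (inord 1) ord0))
     (Complex (l (inord 2) ord0) (- l (inord 3) ord0)).
    move=> p Gp; have /matrixP /(_ ord0 ord0) := lP p Gp.
    rewrite !mxE !big_ord_recr big_ord0 /= o0 o1 o2 o3 !mxE !inordK //=.
    by case: p.1 => [[x y] [x' y']] /=; move=> <-; ring.
  move=> /eqP; rewrite eq_complex /= oppr_eq0 => /andP[/eqP l0 /eqP l1].
  move=> /eqP; rewrite eq_complex /= oppr_eq0 => /andP[/eqP l2 /eqP l3].
  apply/colP => -[[|[|[|[|//]]]] Hi]; rewrite mxE.
  + by rewrite -[RHS]l0; congr (l _ _); apply: val_inj; rewrite /= inordK.
  + by rewrite -[RHS]l1; congr (l _ _); apply: val_inj; rewrite /= inordK.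
  + by rewrite -[RHS]l2; congr (l _ _); apply: val_inj; rewrite /= inordK.
  + by rewrite -[RHS]l3; congr (l _ _); apply: val_inj; rewrite /= inordK.
- move=> r; have [N NP] := Gbound (r + r); exists N => p Gp pr.
  have := pr (inord 0); have := pr (inord 1); have := pr (inord 2); have := pr (inord 3).
  rewrite !mxE !inordK //= => h3 h2 h1 h0.
  by apply: NP => //; apply: le_trans (cabs_le_ReIm _) _; lra.
move=> c cP; pose k i := c (inord i).
exists ((k 0%N - Complex 0 1 * k 1%N) / 2), ((k 0%N + Complex 0 1 * k 1%N) / 2),
  ((k 2%N - Complex 0 1 * k 3%N) / 2), ((k 2%N + Complex 0 1 * k 3%N) / 2) => w Gw.
rewrite (cP w Gw) -!rlin_coord !big_ord_recr big_ord0 /= o0 o1 o2 o3 !mxE !inordK //=.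
by rewrite add0r !addrA.
Qed.

(** The real part of [rlin x y z] is [Re ((x + conj y) z)] and its imaginary part is
    [Re (- i (x - conj y) z)]; the hypotheses are what a spanning set yields when [rlin x y]
    vanishes on it. *)
Lemma conj_pair_eq0 (x y : C) :
  x + conjc y = 0 -> Complex 0 (-1) * (x - conjc y) = 0 -> x = 0 /\ y = 0.
Proof.
have i0 : (Complex 0 (-1) : C) != 0 by rewrite eq_complex /= oppr_eq0 oner_eq0 andbF.
move=> e1 /eqP; rewrite mulf_eq0 (negbTE i0) /= => /eqP e2.
have x0 : x = 0.
  have : x + x = (x + conjc y) + (x - conjc y) by ring.
  by rewrite e1 e2 addr0 => /eqP; rewrite -mulr2n mulrn_eq0 /= => /eqP.
split=> //; move: e1; rewrite x0 add0r => /(congr1 (@conjc R)).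
by rewrite conjcK rmorph0.
Qed.

Lemma rlin_eq0 (S : set C) (p q : C) :
  (forall l : C, (forall x, S x -> complex.Re (l * x) = 0) -> l = 0) ->
  (forall x, S x -> rlin p q x = 0) -> p = 0 /\ q = 0.
Proof.
move=> Sspan H.
have h1 : p + conjc q = 0.
  apply: Sspan => x Sx; have := congr1 (@complex.Re R) (H x Sx); rewrite /rlin /=.
  by case: (p) (q) x {Sx} => [a b] [c d] [x y] /= e; rewrite -[RHS]e; ring.
have h2 : Complex 0 (-1) * (p - conjc q) = 0 :> C.
  apply: Sspan => x Sx; have := congr1 (@complex.Im R) (H x Sx); rewrite /rlin /=.
  by case: (p) (q) x {Sx} => [a b] [c d] [x y] /= e; rewrite -[RHS]e; ring.
exact: conj_pair_eq0.
Qed.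

End ComplexLattice.

(** * Normal forms of the affine groups *)

Opaque mk2.

Section NormalForm.
Variable R : realType.
Local Notation C := (Cplx R).
Local Notation C2 := (C2 R).
Variable G : affine_group R.

Record nform (X Y : C2 -> C) (M : C -> C -> C2) (a b c : (C2 -> C2) -> C) : Prop := Nform {
  nf_chart : chart X Y M;
  nfX : forall g z, aff_set G g -> X (g z) = X z + a g;
  nfY : forall g z, aff_set G g -> Y (g z) = Y z + c g * X z + b g
}.

(** Entries of the linear part are read off from values of [g], so that no matrix has to be chosen
    for each [g]. *)
Definition l11 (g : C2 -> C2) := fst2 (g (mk2 1 0)) - fst2 (g 0).
Definition l12 (g : C2 -> C2) := fst2 (g (mk2 0 1)) - fst2 (g 0).
Definition l21 (g : C2 -> C2) := snd2 (g (mk2 1 0)) - snd2 (g 0).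
Definition l22 (g : C2 -> C2) := snd2 (g (mk2 0 1)) - snd2 (g 0).

Lemma fst2_0 : fst2 (0 : C2) = 0. Proof. by rewrite /fst2 mxE. Qed.
Lemma snd2_0 : snd2 (0 : C2) = 0. Proof. by rewrite /snd2 mxE. Qed.

Lemma affine_fst2 g z : is_affine g -> fst2 (g z) = l11 g * fst2 z + l12 g * snd2 z + fst2 (g 0).
Proof.
move=> [A [b gE]]; have E w : fst2 (g w) = A ord0 ord0 * fst2 w + A ord0 ord_max * snd2 w + fst2 b.
  by rewrite gE fst2D fst2_mulmx.
by rewrite /l11 /l12 !E fst2_0 snd2_0 !fst2_mk !snd2_mk; ring.
Qed.

Lemma affine_snd2 g z : is_affine g -> snd2 (g z) = l21 g * fst2 z + l22 g * snd2 z + snd2 (g 0).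
Proof.
move=> [A [b gE]]; have E w : snd2 (g w) = A ord_max ord0 * fst2 w + A ord_max ord_max * snd2 w + snd2 b.
  by rewrite gE snd2D snd2_mulmx.
by rewrite /l21 /l22 !E fst2_0 snd2_0 !fst2_mk !snd2_mk; ring.
Qed.

Hypothesis Gfree : fixed_point_free G.
Hypothesis Gvol : preserves_dz1_dz2 G.

Lemma linear_det1 g : aff_set G g -> l11 g * l22 g - l21 g * l12 g = 1.
Proof.
move=> Gg; have [A [b gE]] := aff_affine' Gg.
have cA : continuous (mulmx A : C2 -> C2).
  by apply: is_affine_continuous; exists A, 0 => z; rewrite addr0.
have dA z : 'd (mulmx A : C2 -> C2) z = (mulmx A : C2 -> C2) :> (C2 -> C2).
  exact: (diff_lin z cA).
have dfA z : differentiable (mulmx A : C2 -> C2) z by exact: linear_differentiable.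
have dfb z : differentiable (cst b : C2 -> C2) z by exact: differentiable_cst.
have dg z u : 'd g z u = A *m u.
  have -> : g = (mulmx A : C2 -> C2) + cst b by apply/funext => w; rewrite gE.
  have h := congr1 (fun k => k u) (diffD (dfA z) (dfb z)).
  have h1 : 'd (mulmx A : C2 -> C2) z u = A *m u := congr1 (fun k => k u) (dA z).
  have h2 : 'd (cst b : C2 -> C2) z u = 0 := congr1 (fun k : C2 -> C2 => k u) (diff_cst b z).
  exact: (etrans h (etrans (congr2 +%R h1 h2) (addr0 _))).
have := Gvol Gg 0 (mk2 1 0) (mk2 0 1); rewrite !dg /dz1_dz2.
have e1 (w : C2) : w ord0 ord0 = fst2 w by [].
have e2 (w : C2) : w ord_max ord0 = snd2 w by [].
rewrite !e1 !e2 !fst2_mulmx !snd2_mulmx !fst2_mk !snd2_mk => h.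
have E w : fst2 (g w) = A ord0 ord0 * fst2 w + A ord0 ord_max * snd2 w + fst2 b.
  by rewrite gE fst2D fst2_mulmx.
have F w : snd2 (g w) = A ord_max ord0 * fst2 w + A ord_max ord_max * snd2 w + snd2 b.
  by rewrite gE snd2D snd2_mulmx.
rewrite /l11 /l12 /l21 /l22 !E !F fst2_0 snd2_0 !fst2_mk !snd2_mk.
have -> : 1 = 1 * 1 - 0 * 0 :> C by rewrite mulr0 subr0 mulr1.
by rewrite -[RHS]h; ring.
Qed.

(** [D] is the determinant of the linear part minus the identity, which is 2 minus the trace by
    [linear_det1]. If it were nonzero, Cramer's rule would give a fixed point, so [g] would be the
    identity, for which [D] is 0. *)
Lemma linear_trace2 g : aff_set G g -> l11 g + l22 g = 2.
Proof.
move=> Gg; have Ag := aff_affine' Gg; have d1 := linear_det1 Gg.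
pose D := (l11 g - 1) * (l22 g - 1) - l12 g * l21 g.
have DE : D = 2 - (l11 g + l22 g).
  have -> : D = (l11 g * l22 g - l21 g * l12 g) - (l11 g + l22 g) + 1 by rewrite /D; ring.
  by rewrite d1; ring.
suff D0 : D = 0 by apply/eqP; rewrite eq_sym -subr_eq0 -DE D0.
apply: contrapT => /eqP D0.
pose z := mk2 ((l12 g * snd2 (g 0) - (l22 g - 1) * fst2 (g 0)) / D)
   ((l21 g * fst2 (g 0) - (l11 g - 1) * snd2 (g 0)) / D).
have gz : g z = z.
  apply: C2P.
    rewrite (affine_fst2 z Ag) /z !fst2_mk !snd2_mk.
    by move: D0; rewrite /D => D0; field.
  rewrite (affine_snd2 z Ag) /z !fst2_mk !snd2_mk.
  by move: D0; rewrite /D => D0; field.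
have gid := Gfree Gg gz; move: D0; rewrite /D gid /l11 /l12 /l21 /l22 !fst2_mk !snd2_mk.
by rewrite fst2_0 snd2_0 => /eqP; apply; ring.
Qed.

(** Let N be the linear part minus the identity. As [g], [k] and [g \o k] all have trace 2, the
    trace of the product of the two N is 0. *)
Lemma linear_products g k : aff_set G g -> aff_set G k ->
  2 * ((l11 g - 1) * (l11 k - 1)) + l12 g * l21 k + l21 g * l12 k = 0.
Proof.
move=> Gg Gk; have Ag := aff_affine' Gg; have Ak := aff_affine' Gk.
have tg := linear_trace2 Gg; have tk := linear_trace2 Gk.
have c1 : l11 (g \o k) = l11 g * l11 k + l12 g * l21 k.
  transitivity (fst2 (g (k (mk2 1 0))) - fst2 (g (k 0))); first by [].
  by rewrite (affine_fst2 (k (mk2 1 0)) Ag) (affine_fst2 (k 0) Ag) [l11 k]/l11 [l21 k]/l21; ring.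
have c2 : l22 (g \o k) = l21 g * l12 k + l22 g * l22 k.
  transitivity (snd2 (g (k (mk2 0 1))) - snd2 (g (k 0))); first by [].
  by rewrite (affine_snd2 (k (mk2 0 1)) Ag) (affine_snd2 (k 0) Ag) [l12 k]/l12 [l22 k]/l22; ring.
have := linear_trace2 (aff_comp Gg Gk); rewrite c1 c2.
have e1 : l22 g = 2 - l11 g by rewrite -tg; ring.
have e2 : l22 k = 2 - l11 k by rewrite -tk; ring.
rewrite e1 e2 => h.
by apply: (@addIr _ 2); rewrite add0r -[RHS]h; ring.
Qed.

(* A free affine group of determinant one consists of unipotent maps, as 1 is
   an eigenvalue of each linear part; unipotent 2x2 matrices which form a group
   have a common eigenvector, whose annihilator is the coordinate X. *)
Lemma nform_exists : exists X Y M a b c, nform X Y M a b c.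
Proof.
have det g : aff_set G g -> (l11 g - 1) ^+ 2 + l12 g * l21 g = 0.
  move=> Gg; have d1 := linear_det1 Gg.
  have e1 : l22 g = 2 - l11 g by rewrite -(linear_trace2 Gg); ring.
  rewrite e1 in d1; have -> : (l11 g - 1) ^+ 2 + l12 g * l21 g =
    1 - (l11 g * (2 - l11 g) - l21 g * l12 g) by ring.
  by rewrite d1 subrr.
have [[g0 Gg0 q0]|no] := pselect (exists2 g, aff_set G g & l12 g != 0); last first.
  have n2 g : aff_set G g -> l12 g = 0.
    by move=> Gg; apply/eqP; apply: contrapT => /negP n; apply: no; exists g.
  have n1 g : aff_set G g -> l11 g = 1.
    move=> Gg; have := det g Gg; rewrite n2 // mul0r addr0 => /eqP.
    by rewrite sqrf_eq0 subr_eq0 => /eqP.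
  have n4 g : aff_set G g -> l22 g = 1.
    by move=> Gg; have := linear_trace2 Gg; rewrite n1 // => h;
       apply: (@addrI _ 1); rewrite h.
  exists (lin2 1 0), (lin2 0 1), (inv2 1 0 0 1), (fun g => fst2 (g 0)),
     (fun g => snd2 (g 0)), l21; split.
  - by apply: linear_chart; rewrite mul0r subr0 mulr1 oner_neq0.
  - move=> g z Gg; have Ag := aff_affine' Gg; rewrite /lin2 (affine_fst2 _ Ag).
    by rewrite n1 // n2 //; ring.
  - move=> g z Gg; have Ag := aff_affine' Gg; rewrite /lin2 (affine_snd2 _ Ag).
    by rewrite n4 //; ring.
(* [(p, q)] is the first row of the nilpotent part of [g0]. By [E] all nilpotent parts are multiples
   of that one, whose square is 0, so their products with this row vanish and [lin2 p q] changes by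
   translations only. *)
set p := l11 g0 - 1; set q := l12 g0 in q0.
have r0 : l21 g0 = - p ^+ 2 / q.
  have := det g0 Gg0; rewrite -/p -/q => /eqP; rewrite addr_eq0 => /eqP ->.
  by field.
have E k : aff_set G k -> l11 k - 1 = p * l12 k / q /\ l21 k = - p ^+ 2 * l12 k / q ^+ 2.
  move=> Gk; have pr := linear_products Gg0 Gk; have dk := det k Gk.
  rewrite -/p -/q r0 in pr.
  have l21E : l21 k = (- (2 * (p * (l11 k - 1))) + p ^+ 2 / q * l12 k) / q.
    apply: (mulfI q0).
    by rewrite -[LHS]addr0 -[in LHS](oppr0) -[in LHS]pr; field.
  (* Once [l21 k] is eliminated, the relation [det] for [k] becomes a perfect square. *)
  have sq : (q * (l11 k - 1) - p * l12 k) ^+ 2 = 0.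
    by rewrite -[RHS](mulr0 (q ^+ 2)) -[in RHS]dk l21E; field.
  have m1 : l11 k - 1 = p * l12 k / q.
    move/eqP: sq; rewrite sqrf_eq0 subr_eq0 => /eqP h.
    by rewrite -h mulrC mulKf.
  by split => //; rewrite l21E m1; field.
exists (lin2 p q), (lin2 1 0), (inv2 p q 1 0),
  (fun g => p * fst2 (g 0) + q * snd2 (g 0)), (fun g => fst2 (g 0)), (fun g => l12 g / q).
split.
- by apply: linear_chart; rewrite mulr0 sub0r mulr1 oppr_eq0.
- move=> k z Gk; have Ak := aff_affine' Gk; have [m1 m3] := E k Gk.
  have e1 : l22 k = 1 - p * l12 k / q.
    by rewrite -m1; have := linear_trace2 Gk => h; rewrite -[LHS](addKr (l11 k)) h; ring.
  have e2 : l11 k = 1 + p * l12 k / q by rewrite -m1; ring.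
  by rewrite /lin2 (affine_fst2 _ Ak) (affine_snd2 _ Ak) e1 e2 m3; field.
- move=> k z Gk; have Ak := aff_affine' Gk; have [m1 m3] := E k Gk.
  have e2 : l11 k = 1 + p * l12 k / q by rewrite -m1; ring.
  by rewrite /lin2 (affine_fst2 _ Ak) (affine_snd2 _ Ak) e2; field.
Qed.

End NormalForm.

(** * Consequences of proper discontinuity and compactness *)

Section Consequences.
Variable R : realType.
Local Notation C := (Cplx R).
Local Notation C2 := (C2 R).
Variable G : affine_group R.
Hypothesis Gpd : properly_discontinuous G.
Hypothesis Gfree : fixed_point_free G.
Hypothesis Gcpt : compact [set: orbit_space G].

(** The modulus of [q] descends to a continuous function on a compact space. Compactness of the
    quotient always enters through this bound. *)
Lemma invariant_bounded (q : C2 -> C) : continuous q ->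
  (forall g z, aff_set G g -> q (g z) = q z) -> exists N : R, forall z, cabs (q z) <= N.
Proof.
move=> qc qG; pose f (x : orbit_space G) : R := cabs (q (repr (x : {eq_quot orbit_equiv G}))).
have fpi z : f (orbit_pi G z) = cabs (q z).
  have [g Gg gE] : exists2 g, aff_set G g &
      g z = repr ((orbit_pi G z : orbit_space G) : {eq_quot orbit_equiv G}).
    by apply/orbit_piP; rewrite /orbit_pi reprK.
  by rewrite /f -gE qG.
have fc : continuous f.
  apply/quotient_continuous; have -> : f \o \pi = (@cabs R) \o q.
    by apply/funext => z; exact: fpi.
  by move=> z; apply: continuous_comp; [exact: qc|exact: continuous_cabs].
have cpt : compact (f @` setT).
  by apply: continuous_compact Gcpt; exact: continuous_subspaceT.
have [N [_ NP]] := compact_bounded cpt.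
exists (N + 1) => z; have := NP (N + 1); rewrite ltrDl ltr01 => /(_ isT (f (orbit_pi G z))).
by rewrite /= fpi ger0_norm ?cabs_ge0 //; apply; exists (orbit_pi G z).
Qed.

Section Form.
Variables (X Y : C2 -> C) (M : C -> C -> C2) (a b c : (C2 -> C2) -> C).
Hypothesis nf : nform G X Y M a b c.
Let ch := nf_chart nf.

Lemma nf_aM g k : aff_set G g -> aff_set G k -> a (g \o k) = a g + a k.
Proof.
move=> Gg Gk; apply: (@addrI _ (X 0)); rewrite -(nfX nf) ?aff_comp //; last exact: aff_comp.
by rewrite /= !(nfX nf) // addrA addrAC.
Qed.

(** An identity of affine functions of [X z]; the values 0 and 1 of [X z] give the composition rules
    for [b] and [c]. *)
Lemma nf_YM g k z : aff_set G g -> aff_set G k ->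
  c (g \o k) * X z + b (g \o k) = (c g + c k) * X z + (b g + b k + c g * a k).
Proof.
move=> Gg Gk; apply: (@addrI _ (Y z)); rewrite addrA -(nfY nf); last exact: aff_comp.
by rewrite /= !(nfY nf) // (nfX nf) //; ring.
Qed.

Lemma nf_bM g k : aff_set G g -> aff_set G k -> b (g \o k) = b g + b k + c g * a k.
Proof.
by move=> Gg Gk; have := nf_YM (M 0 0) Gg Gk; rewrite (chX ch) !mulr0 !add0r.
Qed.

Lemma nf_cM g k : aff_set G g -> aff_set G k -> c (g \o k) = c g + c k.
Proof.
move=> Gg Gk; have := nf_YM (M 1 0) Gg Gk; rewrite (chX ch) !mulr1 nf_bM //.
exact: addIr.
Qed.

Lemma nf_a1 : a id = 0.
Proof.
apply: (@addrI _ (a id)); rewrite addr0 -nf_aM //; exact: aff_id.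
Qed.

Lemma nf_c1 : c id = 0.
Proof.
apply: (@addrI _ (c id)); rewrite addr0 -nf_cM //; exact: aff_id.
Qed.

Lemma nf_b1 : b id = 0.
Proof.
have := nf_bM (aff_id G) (aff_id G); rewrite nf_c1 mul0r addr0 => h.
by apply: (@addrI _ (b id)); rewrite addr0 -h.
Qed.

Lemma nf_inv g : aff_set G g -> exists k, [/\ aff_set G k, g \o k = id, k \o g = id,
  a k = - a g & c k = - c g].
Proof.
move=> Gg; have [k [Gk gk kg]] := aff_inv Gg; exists k.
have e1 : g \o k = id by apply/funext => z /=; rewrite kg.
split => //; first by apply/funext => z /=; rewrite gk.
  by apply: (@addrI _ (a g)); rewrite subrr -nf_aM // e1 nf_a1.
by apply: (@addrI _ (c g)); rewrite subrr -nf_cM // e1 nf_c1.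
Qed.

Lemma nf_inj g k : aff_set G g -> aff_set G k -> a g = a k -> b g = b k -> c g = c k -> g = k.
Proof.
move=> Gg Gk ea eb ec; apply/funext => z.
by rewrite -[LHS](chM ch) -[RHS](chM ch) !(nfX nf) // !(nfY nf) // ea eb ec.
Qed.

(** If [a g = 0] and [c g] is nonzero, the line [X = - b g / c g] is fixed pointwise, against
    freeness. *)
Lemma nf_free g : aff_set G g -> a g = 0 -> c g = 0.
Proof.
move=> Gg ag; apply: contrapT => /eqP cg; pose z := M (- b g / c g) 0.
have gz : g z = z.
  rewrite -[LHS](chM ch) -[RHS](chM ch) (nfX nf) // (nfY nf) // ag addr0 /z !(chX ch) (chY ch).
  by congr (M _ _); field.
by move/eqP: cg; apply; rewrite (Gfree Gg gz) nf_c1.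
Qed.

(** [g] sends the origin of the chart to the point with coordinates [a g] and [b g], so all these
    [g] carry a point of one compact ball into that ball. *)
Lemma nf_finite r : finite_set [set g | aff_set G g /\ cabs (a g) <= r /\ cabs (b g) <= r].
Proof.
have [N NP] := chMb ch (Num.max r 0).
apply: sub_finite_set (Gpd (@compact_nm R N)) => g [Gg [ar br]]; split => //.
have r0 : 0 <= Num.max r 0 by rewrite le_max lexx orbT.
exists (g (M 0 0)); split.
  by exists (M 0 0) => //=; apply: NP; rewrite cabs0.
rewrite /= -(chM ch (g (M 0 0))) (nfX nf) // (nfY nf) // (chX ch) (chY ch) mulr0 !addr0 !add0r.
by apply: NP; rewrite le_max ?ar ?br.
Qed.

(** Any function is bounded on a finite set; the bound is stored as [s^-1] because [finite_uniform]
    yields small numbers. *)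
Lemma nf_bound (f : (C2 -> C2) -> C) r : exists N : R, forall g, aff_set G g ->
  cabs (a g) <= r -> cabs (b g) <= r -> cabs (f g) <= N.
Proof.
have [||s s0 sP] := @finite_uniform R _ _ (fun g s => cabs (f g) <= s^-1) (nf_finite r).
- move=> g s t t0 ts /le_trans; apply; rewrite lef_pV2 ?posrE //.
  exact: lt_le_trans ts.
- move=> g _; exists (cabs (f g) + 1)^-1; last by rewrite invrK lerDl.
  by rewrite invr_gt0 ltr_pwDr ?cabs_ge0.
- by exists s^-1 => g Gg ar br; apply: sP.
Qed.

(** Twice the real part of [p * X] is invariant, hence bounded, but it equals [2 n |p|^2] where
    [X = n conj p]. *)
Lemma nf_spanA (p : C) : (forall g, aff_set G g -> complex.Re (p * a g) = 0) -> p = 0.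
Proof.
move=> H; pose q z := p * X z + conjc (p * X z).
have pX : cpoly (fun z => p * X z) by apply: cpoly_mul (cpoly_cst p) (chXp ch).
have qG g z : aff_set G g -> q (g z) = q z.
  move=> Gg; rewrite /q (nfX nf) // mulrDr rmorphD addrACA -[RHS]addr0; congr (_ + _).
  by move: (H g Gg); case: (p * a g) => x y /= ->;
    apply/eqP; rewrite eq_complex /= addr0 subrr !eqxx.
have [N NP] := invariant_bounded (cpoly_continuous (cpoly_add pX (cpoly_conj pX))) qG.
suff : p * conjc p + p * conjc p = 0.
  by move/eqP; rewrite -mulr2n mulrn_eq0 /= mulf_eq0 conjc_eq0 orbb => /eqP.
apply: (@bounded_progression R 0 _ N) => n; rewrite add0r.
have := NP (M (n%:R * conjc p) 0); rewrite /q (chX ch) !rmorphM rmorph_nat /= conjcK.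
by congr (cabs _ <= _); ring.
Qed.

Lemma nf_commutator g k : aff_set G g -> aff_set G k ->
  exists m, [/\ aff_set G m, a m = 0, b m = c g * a k - c k * a g &
     m \o (k \o g) = g \o k].
Proof.
move=> Gg Gk; have [g' [Gg' gg' g'g ag' cg']] := nf_inv Gg.
have [k' [Gk' kk' k'k ak' ck']] := nf_inv Gk.
pose m := (g \o k) \o (g' \o k').
have Ggk := aff_comp Gg Gk; have Gkg := aff_comp Gk Gg; have Ggk' := aff_comp Gg' Gk'.
have Gm : aff_set G m := aff_comp Ggk Ggk'.
have am : a m = 0.
  by rewrite /m (nf_aM Ggk Ggk') (nf_aM Gg Gk) (nf_aM Gg' Gk') ag' ak'; ring.
have mE : m \o (k \o g) = g \o k.
  apply/funext => z; rewrite /m /=.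
  have -> : k' (k (g z)) = g z by exact: (congr1 (fun f => f (g z)) k'k).
  by have -> : g' (g z) = z by exact: (congr1 (fun f => f z) g'g).
exists m; split => //.
have := congr1 b mE.
rewrite (nf_bM Gm Gkg) (nf_bM Gk Gg) (nf_bM Gg Gk) (nf_free Gm am) => e.
apply: (@addIr _ (b k + b g + c k * a g)).
by move: e; rewrite mul0r addr0 => ->; ring.
Qed.

Lemma nf_multiple k (n : int) : aff_set G k -> a k = 0 ->
  exists m, [/\ aff_set G m, a m = 0 & b m = n%:~R * b k].
Proof.
move=> Gk ak; have ck := nf_free Gk ak.
have pos j (n' : nat) : aff_set G j -> a j = 0 ->
    exists m, [/\ aff_set G m, a m = 0 & b m = n'%:R * b j].
  move=> Gj aj; have cj := nf_free Gj aj; elim: n' => [|n' [m [Gm am bm]]].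
    by exists id; split; [exact: aff_id|exact: nf_a1|rewrite nf_b1 mul0r].
  exists (j \o m); split; first exact: aff_comp.
    by rewrite nf_aM // aj am addr0.
  by rewrite nf_bM // cj mul0r addr0 bm -natr1; ring.
case: n => n; first exact: pos.
have [k' [Gk' kk' k'k ak' ck']] := nf_inv Gk.
have [|m [Gm am bm]] := pos k' n.+1 Gk'; first by rewrite ak' ak oppr0.
exists m; split => //; rewrite bm.
have : b (k \o k') = 0 by rewrite kk' nf_b1.
rewrite nf_bM // ck mul0r addr0 => /eqP; rewrite addrC addr_eq0 => /eqP ->.
by rewrite NegzE mulrNz mulNr mulrN.
Qed.

(** The hypothesis concerns minus the determinant [J] of [u] and [v] as real vectors; [s] and [t]
    come from Cramer's rule. *)
Lemma real_coordinates (u v w : C) : complex.Re (Complex 0 1 * conjc u * v) != 0 ->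
  exists s t : R, w = s%:C%C * u + t%:C%C * v.
Proof.
case: u v w => [u1 u2] [v1 v2] [w1 w2] /= H.
pose J := u1 * v2 - u2 * v1.
have J0 : J != 0 by apply: contra_neq H => J0; transitivity (- J); [rewrite /J; ring|by rewrite J0 oppr0].
exists ((w1 * v2 - w2 * v1) / J), ((u1 * w2 - u2 * w1) / J).
by apply/eqP; rewrite eq_complex /=; apply/andP; split; apply/eqP;
  move: J0; rewrite /J => J0; field.
Qed.

Lemma nf_vanish (f : (C2 -> C2) -> C) g k :
  (forall g k, aff_set G g -> aff_set G k -> f (g \o k) = f g + f k) ->
  (forall g, aff_set G g -> a g = 0 -> f g = 0) ->
  aff_set G g -> aff_set G k -> a g = a k -> f g = f k.
Proof.
move=> fM f0 Gg Gk e; have [k' [Gk' kk' k'k ak' ck']] := nf_inv Gk.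
have : f (g \o k') = 0 by apply: f0; [exact: aff_comp|rewrite nf_aM // ak' e subrr].
rewrite fM // => h.
have h' : f (k \o k') = 0.
  by apply: f0; [exact: aff_comp|rewrite nf_aM // ak' subrr].
by move: h'; rewrite fM // -h => /addIr ->.
Qed.

(* The values a g of modulus at most r determine g up to the centre and, when
   commutators are not trivial, up to finitely many choices. *)
Lemma nf_hom_bound (f : (C2 -> C2) -> C) (h1 h2 : C2 -> C2) :
  aff_set G h1 -> aff_set G h2 -> c h1 * a h2 - c h2 * a h1 != 0 ->
  (forall g k, aff_set G g -> aff_set G k -> f (g \o k) = f g + f k) ->
  (forall g, aff_set G g -> a g = 0 -> f g = 0) ->
  forall r : R, exists N : R, forall g, aff_set G g -> cabs (a g) <= r -> cabs (f g) <= N.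
Proof.
move=> G1 G2 D0 fM f0 r.
(* First case: the values of [b] on the kernel of [a] span C over the reals. Composing [g] with
   elements of this kernel brings [b g] into a bounded set and changes neither [a g] nor [f g], so
   [nf_bound] applies. *)
have [span|] := pselect (forall p : C, (forall k, aff_set G k -> a k = 0 ->
    complex.Re (p * b k) = 0) -> p = 0).
  have [k1 [Gk1 ak1 bk1]] : exists k, [/\ aff_set G k, a k = 0 & b k != 0].
    apply: contrapT => no; suff /eqP : (1 : C) = 0 by rewrite oner_eq0.
    apply: span => k Gk ak; suff -> : b k = 0 by rewrite mulr0.
    by apply: contrapT => /eqP bk; apply: no; exists k.
  have [k2 [Gk2 ak2 bk2]] : exists k, [/\ aff_set G k, a k = 0 &
      complex.Re (Complex 0 1 * conjc (b k1) * b k) != 0].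
    apply: contrapT => no; suff /eqP : Complex 0 1 * conjc (b k1) = 0 :> C.
      by rewrite mulf_eq0 conjc_eq0 (negbTE bk1) orbF eq_complex /= oner_eq0 andbF.
    apply: span => k Gk ak; apply: contrapT => /eqP bk; apply: no; by exists k.
  have [N NP] := nf_bound f (Num.max r (cabs (b k1) + cabs (b k2))).
  exists N => g Gg ar.
  have [s [t bE]] := real_coordinates (b g) bk2.
  have [m1 [Gm1 am1 bm1]] := nf_multiple (- Num.floor s) Gk1 ak1.
  have [m2 [Gm2 am2 bm2]] := nf_multiple (- Num.floor t) Gk2 ak2.
  have Gm : aff_set G (m1 \o m2) by exact: aff_comp.
  have am : a (m1 \o m2) = 0 by rewrite (nf_aM Gm1 Gm2) am1 am2 addr0.
  have -> : f g = f ((m1 \o m2) \o g) by rewrite (fM _ _ Gm Gg) (f0 _ Gm am) add0r.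
  apply: NP; first exact: aff_comp.
    by rewrite (nf_aM Gm Gg) am add0r le_max ar.
  rewrite le_max; apply/orP; right.
  have frac (x : R) : cabs ((x%:C%C : C) + (- Num.floor x)%:~R) <= 1.
    have -> : (x%:C%C : C) + (- Num.floor x)%:~R = (x - (Num.floor x)%:~R)%:C%C.
      by rewrite rmorphB mulrNz rmorph_int.
    rewrite cabs_real ger0_norm ?subr_ge0 ?floor_le //.
    by have := floorD1_gt x; rewrite intrD => /ltW; rewrite lerBlDl addrC.
  rewrite (nf_bM Gm Gg) (nf_free Gm am) mul0r addr0 (nf_bM Gm1 Gm2).
  rewrite (nf_free Gm1 am1) mul0r addr0.
  rewrite bm1 bm2 bE.
  have -> : (- Num.floor s)%:~R * b k1 + (- Num.floor t)%:~R * b k2 +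
     (s%:C%C * b k1 + t%:C%C * b k2) = (s%:C%C + (- Num.floor s)%:~R) * b k1
     + (t%:C%C + (- Num.floor t)%:~R) * b k2 by ring.
  apply: le_trans (cabsD _ _) _; rewrite !cabsM.
  by apply: lerD; rewrite ler_piMl ?cabs_ge0.
(* Second case: a nonzero [p0] makes [p0 * b k] imaginary on the kernel of [a]. There lie the
   commutators of [g] with [h1] and [h2]; their [b]-values [w1 g] and [w2 g] determine [a g], since
   [D] is nonzero. *)
move=> /existsNP[p0 /not_implyP[pK /eqP p00]].
pose w1 g := c g * a h1 - c h1 * a g.
pose w2 g := c g * a h2 - c h2 * a g.
set D := c h1 * a h2 - c h2 * a h1 in D0.
have aD g : D * a g = a h1 * w2 g - a h2 * w1 g by rewrite /D /w1 /w2; ring.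
pose t1 g : R := complex.Im (p0 * w1 g).
pose t2 g : R := complex.Im (p0 * w2 g).
have tE (w : C) : complex.Re (p0 * w) = 0 -> p0 * w = Complex 0 (complex.Im (p0 * w)).
  by case: (p0 * w) => x y /= ->.
have w1E g : aff_set G g -> p0 * w1 g = Complex 0 (t1 g).
  by move=> Gg; apply: tE; have [m [Gm am bm _]] := nf_commutator Gg G1; rewrite /w1 -bm; exact: pK.
have w2E g : aff_set G g -> p0 * w2 g = Complex 0 (t2 g).
  by move=> Gg; apply: tE; have [m [Gm am bm _]] := nf_commutator Gg G2; rewrite /w2 -bm; exact: pK.
have pD g : aff_set G g -> p0 * D * a g = a h1 * Complex 0 (t2 g) - a h2 * Complex 0 (t1 g).
  by move=> Gg; rewrite -w1E // -w2E // -mulrA aD; ring.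
(* Multiplying [pD] by the conjugate of [a h1] and taking real parts leaves [J * t1 g], and likewise
   for [h2]. Once [J] is nonzero, a bound on [a g] bounds both commutators. *)
pose J : R := complex.Im (conjc (a h1) * a h2).
have JE1 g : aff_set G g -> complex.Re (conjc (a h1) * (p0 * D) * a g) = J * t1 g.
  move=> Gg; rewrite -mulrA pD // /J.
  by case: (a h1) (a h2) => [x y] [x' y'] /=; ring.
have JE2 g : aff_set G g -> complex.Re (conjc (a h2) * (p0 * D) * a g) = J * t2 g.
  move=> Gg; rewrite -mulrA pD // /J.
  by case: (a h1) (a h2) => [x y] [x' y'] /=; ring.
have pD0 : p0 * D != 0 by rewrite mulf_neq0.
have J0 : J != 0.
  apply/eqP => J0.
  have a0 h : (forall g, aff_set G g -> complex.Re (conjc (a h) * (p0 * D) * a g) = 0) -> a h = 0.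
    move=> /nf_spanA /eqP; rewrite mulf_eq0 (negbTE pD0) orbF conjc_eq0 => /eqP //.
  have a1 : a h1 = 0 by apply: a0 => g Gg; rewrite JE1 // J0 mul0r.
  have a2 : a h2 = 0 by apply: a0 => g Gg; rewrite JE2 // J0 mul0r.
  by move/eqP: D0; apply; rewrite /D a1 a2 !mulr0 subrr.
have Jp : 0 < `|J| by rewrite normr_gt0.
have bnd h (w : (C2 -> C2) -> C) (t : (C2 -> C2) -> R) :
    (forall g, aff_set G g -> p0 * w g = Complex 0 (t g)) ->
    (forall g, aff_set G g -> complex.Re (conjc (a h) * (p0 * D) * a g) = J * t g) ->
    exists B : R, forall g, aff_set G g -> cabs (a g) <= r -> cabs (w g) <= B.
  move=> wE JE; exists (cabs (conjc (a h) * (p0 * D)) * r / `|J| / cabs p0) => g Gg ar.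
  have pp : 0 < cabs p0.
    by rewrite lt_neqAle cabs_ge0 andbT eq_sym; apply: contraNneq p00 => /cabs_eq0 ->.
  rewrite ler_pdivlMr // mulrC -cabsM wE // cabs_i ler_pdivlMr // mulrC -normrM -JE //.
  apply: le_trans (Re_le_cabs _) _; rewrite [in leLHS]cabsM.
  by rewrite ler_wpM2l ?cabs_ge0.
have [B1 B1P] := bnd h1 w1 t1 w1E JE1.
have [B2 B2P] := bnd h2 w2 t2 w2E JE2.
pose S B := [set g | aff_set G g /\ cabs (a g) <= B /\ cabs (b g) <= B].
(* Bounded commutators form finitely many pairs; a pair fixes [a g], and [f g] depends on [a g]
   alone. *)
have Sfin : finite_set (S (Num.max 0 B1) `*` S (Num.max 0 B2)).
  by apply: finite_setX; exact: nf_finite.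
have [||s s0 sP] := @finite_uniform R _ _ (fun m s => forall g, aff_set G g ->
    b m.1 = w1 g -> b m.2 = w2 g -> cabs (f g) <= s^-1) Sfin.
- move=> m s t t0 ts H g Gg e1 e2; apply: le_trans (H g Gg e1 e2) _.
  by rewrite lef_pV2 ?posrE //; exact: lt_le_trans ts.
- move=> m _.
  have [[g0 [Gg0 e1 e2]]|no] := pselect (exists g, [/\ aff_set G g, b m.1 = w1 g & b m.2 = w2 g]);
    last by exists 1 => // g Gg e1 e2; exfalso; apply: no; exists g.
  exists (cabs (f g0) + 1)^-1; first by rewrite invr_gt0 ltr_pwDr ?cabs_ge0.
  move=> g Gg e1' e2'; rewrite invrK (@nf_vanish f g g0) ?lerDl //.
  by apply: (mulfI D0); rewrite !aD -e1 -e2 -e1' -e2'.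
- exists s^-1 => g Gg ar.
  have [m1 [Gm1 am1 bm1 _]] := nf_commutator Gg G1.
  have [m2 [Gm2 am2 bm2 _]] := nf_commutator Gg G2.
  apply: (sP (m1, m2)) => //=; split; split => //=; split.
  + by rewrite am1 cabs0 le_max lexx.
  + by rewrite bm1 le_max (B1P g Gg ar) orbT.
  + by rewrite am2 cabs0 le_max lexx.
  + by rewrite bm2 le_max (B2P g Gg ar) orbT.
Qed.

Lemma nf_rlin_extension (f : (C2 -> C2) -> C) :
  (forall r : R, exists N : R, forall g, aff_set G g -> cabs (a g) <= r -> cabs (f g) <= N) ->
  (forall g k, aff_set G g -> aff_set G k -> f (g \o k) = f g + f k) ->
  exists p q, forall g, aff_set G g -> f g = rlin p q (a g).
Proof.
move=> bound fM.
have f1 : f id = 0.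
  by apply: (@addrI _ (f id)); rewrite addr0 -fM //; exact: aff_id.
pose Gam : set (C * C) := [set w | exists2 g, aff_set G g & w = (a g, f g)].
have [] := @rlin_extension R Gam.
- by exists id; [exact: aff_id|rewrite nf_a1 f1].
- move=> _ _ [g Gg ->] [k Gk ->]; have [k' [Gk' kk' k'k ak' ck']] := nf_inv Gk.
  exists (g \o k'); first exact: aff_comp.
  rewrite nf_aM // ak' fM //; congr (_, _ + _).
  by apply: (@addIr _ (f k)); rewrite addNr -(fM _ _ Gk' Gk) k'k f1.
- by move=> l H; apply: nf_spanA => g Gg; apply: (H (a g, f g)); exists g.
- move=> r; have [N NP] := bound r; exists N => _ [g Gg ->] /=; exact: NP.
- move=> p [q H]; exists p, q => g Gg; apply: (H (a g, f g)); by exists g.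
Qed.

End Form.
End Consequences.

(** * Torus and Kodaira normal forms *)

Section Forms.
Variable R : realType.
Local Notation C := (Cplx R).
Local Notation C2 := (C2 R).

Lemma conjK (z : C) : conjc (conjc z) = z.
Proof. by case: z => x y /=; rewrite opprK. Qed.

Lemma conjD (z w : C) : conjc (z + w) = conjc z + conjc w.
Proof. exact: rmorphD. Qed.
Lemma conjB (z w : C) : conjc (z - w) = conjc z - conjc w.
Proof. exact: rmorphB. Qed.
Lemma conjM (z w : C) : conjc (z * w) = conjc z * conjc w.
Proof. exact: rmorphM. Qed.
Lemma conj_nat n : conjc (n%:R : C) = n%:R.
Proof. exact: rmorph_nat. Qed.
Lemma conj0 : conjc (0 : C) = 0.
Proof. exact: rmorph0. Qed.

Lemma ReE (z : C) : complex.Re z = 0 -> z + conjc z = 0.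
Proof.
by case: z => x y /= ->; apply/eqP; rewrite eq_complex /=; apply/andP; split;
  apply/eqP; ring.
Qed.

Lemma cpoly_rlin (f : C2 -> C) p q : cpoly f -> cpoly (fun z => rlin p q (f z)).
Proof.
move=> pf; apply: cpoly_add; apply: cpoly_mul; try exact: cpoly_cst => //.
  exact: pf.
exact: cpoly_conj.
Qed.

Variable G : affine_group R.

(** The elements with [a g = 0] form the centre: [kf_extA] is the extension property for the
    quotient by the centre, [kf_spanB] and [kf_extB] concern the centre itself. *)
Record kodaira_form (X Y : C2 -> C) (M : C -> C -> C2) (a b : (C2 -> C2) -> C) : Prop :=
  KodairaForm {
  kf_nf : nform G X Y M a b (fun g => conjc (a g));
  kf_extA : forall f : (C2 -> C2) -> C,
    (forall g k, aff_set G g -> aff_set G k -> f (g \o k) = f g + f k) ->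
    (forall g, aff_set G g -> a g = 0 -> f g = 0) ->
    exists p q, forall g, aff_set G g -> f g = rlin p q (a g);
  kf_spanB : forall p : C, (forall k, aff_set G k -> a k = 0 -> complex.Re (p * b k) = 0) ->
    p = 0;
  kf_extB : forall f : (C2 -> C2) -> C,
    (forall g k, aff_set G g -> aff_set G k -> a g = 0 -> a k = 0 -> f (g \o k) = f g + f k) ->
    exists p q, forall g, aff_set G g -> a g = 0 -> f g = rlin p q (b g)
}.

Record torus_form (X Y : C2 -> C) (M : C -> C -> C2) (a b : (C2 -> C2) -> C) : Prop :=
  TorusForm {
  tf_nf : nform G X Y M a b (fun=> 0);
  tf_span : forall p q : C,
    (forall g, aff_set G g -> complex.Re (p * a g + q * b g) = 0) -> p = 0 /\ q = 0;
  tf_ext : forall f : (C2 -> C2) -> C,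
    (forall g k, aff_set G g -> aff_set G k -> f (g \o k) = f g + f k) ->
    exists p q p' q', forall g, aff_set G g -> f g = rlin p q (a g) + rlin p' q' (b g)
}.

Hypothesis Gpd : properly_discontinuous G.
Hypothesis Gfree : fixed_point_free G.
Hypothesis Gcpt : compact [set: orbit_space G].

(** As [(X + a)^2 - X^2 = 2 a X + a^2], the shear subtracts [2 l a] from [c] before scaling. *)
Lemma nform_shear X Y M a b c (k l : C) : k != 0 -> nform G X Y M a b c ->
  nform G X (fun z => k * (Y z - l * (X z * X z))) (fun x y => M x (k^-1 * y + l * (x * x)))
    a (fun g => k * (b g - l * (a g * a g))) (fun g => k * (c g - 2 * l * a g)).
Proof.
move=> k0 nf; split; first exact: shear_chart k0 (nf_chart nf).
  exact: nfX nf.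
by move=> g z Gg; rewrite (nfX nf) // (nfY nf) //; ring.
Qed.

Lemma torus_form_exists X Y M a b c : nform G X Y M a b c ->
  (forall g k, aff_set G g -> aff_set G k -> c g * a k = c k * a g) ->
  exists Y' M' b', torus_form X Y' M' a b'.
Proof.
move=> nf comm.
have [g0 [Gg0 a0]] : exists g, aff_set G g /\ a g != 0.
  apply: contrapT => no; suff /eqP : (1 : C) = 0 by rewrite oner_eq0.
  apply: (nf_spanA Gcpt nf) => g Gg; suff -> : a g = 0 by rewrite mulr0.
  by apply: contrapT => /eqP bk; apply: no; exists g.
(* Commutativity makes [c] proportional to [a]; the shear by half the ratio removes it. *)
have cE g : aff_set G g -> c g = c g0 / a g0 * a g.
  by move=> Gg; apply: (mulIf a0); rewrite comm //; field.
have nf1 := nform_shear (c g0 / a g0 / 2) (oner_neq0 C) nf.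
set Y' := (fun z => 1 * (Y z - c g0 / a g0 / 2 * (X z * X z))) in nf1.
set M' := (fun x y => _) in nf1.
set b' := (fun g => 1 * (b g - _)) in nf1.
have nf' : nform G X Y' M' a b' (fun=> 0).
  split; first exact: nf_chart nf1.
    exact: nfX nf1.
  move=> g z Gg; rewrite (nfY nf1) // cE //; congr (_ + _ * _ + _).
  by field.
clearbody Y' M' b'; clear nf1.
have ch := nf_chart nf'.
have nfY' g z : aff_set G g -> Y' (g z) = Y' z + b' g.
  by move=> Gg; rewrite (nfY nf') // mul0r addr0.
have bM g k : aff_set G g -> aff_set G k -> b' (g \o k) = b' g + b' k.
  by move=> Gg Gk; rewrite (nf_bM nf' Gg Gk) mul0r addr0.
have inv g : aff_set G g -> exists k, [/\ aff_set G k, k \o g = id, a k = - a g & b' k = - b' g].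
  move=> Gg; have [k [Gk gk kg ak _]] := nf_inv nf' Gg; exists k; split => //.
  by apply: (@addrI _ (b' g)); rewrite -(bM _ _ Gg Gk) gk (nf_b1 nf') subrr.
(* A real functional vanishing on all [(a g, b' g)] gives an invariant function, whose value at
   [X = n conj p], [Y' = n conj q] is [2 n (|p|^2 + |q|^2)]. *)
have span (p q : C) : (forall g, aff_set G g -> complex.Re (p * a g + q * b' g) = 0) ->
    p = 0 /\ q = 0.
  move=> H; pose Q z : C := (p * X z + q * Y' z) + conjc (p * X z + q * Y' z).
  have pQ : cpoly Q.
    have h : cpoly (fun z => p * X z + q * Y' z).
      apply: cpoly_add; apply: cpoly_mul; try exact: cpoly_cst.
        exact: chXp ch.
      exact: chYp ch.
    by apply: cpoly_add => //; exact: cpoly_conj.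
  have QG g z : aff_set G g -> Q (g z) = Q z.
    move=> Gg; rewrite /Q (nfX nf') // nfY' //.
    have -> : p * (X z + a g) + q * (Y' z + b' g) =
      (p * X z + q * Y' z) + (p * a g + q * b' g) by ring.
    rewrite [conjc (_ + (p * a g + _))]conjD.
    by rewrite addrACA (ReE (H g Gg)) addr0.
  have [N NP] := invariant_bounded Gcpt (cpoly_continuous pQ) QG.
  have : p * conjc p + q * conjc q = 0.
    apply: (@bounded_progression R 0 _ (N / 2)) => n; rewrite add0r.
    have := NP (M' (n%:R * conjc p) (n%:R * conjc q)); rewrite /Q (chX ch) (chY ch).
    rewrite conjD !conjM !conjK conj_nat.
    have -> : p * (n%:R * conjc p) + q * (n%:R * conjc q) + (conjc p * (n%:R * p) +
      conjc q * (n%:R * q)) = (2 : R)%:C%C * (n%:R * (p * conjc p + q * conjc q)).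
      by rewrite rmorph_nat; ring.
    move: (n%:R * _) => w.
    by rewrite cabsM (cabs_real 2) ger0_norm // ler_pdivlMr // mulrC.
  rewrite !mul_conj -rmorphD => /eqP; rewrite eq_complex /= eqxx andbT => /eqP h.
  have [h1 h2] := (cabs_ge0 p, cabs_ge0 q).
  have [s1 s2] := (sqr_ge0 (cabs p), sqr_ge0 (cabs q)).
  have e1 : cabs p ^+ 2 = 0 by lra.
  have e2 : cabs q ^+ 2 = 0 by lra.
  by split; apply: cabs_eq0; apply/eqP; rewrite -sqrf_eq0; apply/eqP.
exists Y', M', b'; split => //.
move=> f fM; have f1 : f id = 0.
  by apply: (@addrI _ (f id)); rewrite addr0 -(fM id id (aff_id G) (aff_id G)).
pose Gam : set ((C * C) * C) := [set w | exists2 g, aff_set G g & w = ((a g, b' g), f g)].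
have [] := @rlin2_extension R Gam.
- by exists id; [exact: aff_id|rewrite (nf_a1 nf') (nf_b1 nf') f1].
- move=> _ _ [g Gg ->] [k Gk ->]; have [k' [Gk' k'k ak' bk']] := inv k Gk.
  exists (g \o k'); first exact: aff_comp.
  rewrite (nf_aM nf' Gg Gk') (bM _ _ Gg Gk') ak' bk' (fM _ _ Gg Gk'); congr (_, _ + _).
  by apply: (@addIr _ (f k)); rewrite addNr -(fM _ _ Gk' Gk) k'k f1.
- by move=> l m H; apply: span => g Gg; apply: (H (a g, b' g, f g)); exists g.
- move=> r; have [N NP] := nf_bound Gpd nf' f r; exists N => _ [g Gg ->] /=; exact: NP.
- move=> p [q [p' [q' H]]]; exists p, q, p', q' => g Gg.
  by apply: (H (a g, b' g, f g)); exists g.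
Qed.

(** [c] is a homomorphism that vanishes where [a] does, so [c = ga * a + de * conjc a]. The first
    term drops out of commutators, hence [de] is nonzero; the shear by [ga / 2] and the scaling by
    [de^-1] leave [conjc a]. *)
Lemma kodaira_form_exists X Y M a b c h1 h2 : nform G X Y M a b c ->
  aff_set G h1 -> aff_set G h2 -> c h1 * a h2 != c h2 * a h1 ->
  exists Y' M' b', kodaira_form X Y' M' a b'.
Proof.
move=> nf G1 G2 D0; rewrite -subr_eq0 in D0.
have [ga [de cE]] := nf_rlin_extension Gcpt nf
  (nf_hom_bound Gpd Gfree Gcpt nf G1 G2 D0 (nf_cM nf) (nf_free Gfree nf)) (nf_cM nf).
have DE : c h1 * a h2 - c h2 * a h1 = de * (conjc (a h1) * a h2 - conjc (a h2) * a h1).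
  by rewrite !cE // /rlin; ring.
have de0 : de != 0 by apply: contraNneq D0 => de0; rewrite DE de0 mul0r.
have D'0 : conjc (a h1) * a h2 - conjc (a h2) * a h1 != 0.
  by apply: contraNneq D0 => h; rewrite DE h mulr0.
have dV0 : de^-1 != 0 by rewrite invr_eq0.
have nf1 := nform_shear (ga / 2) dV0 nf.
set Y' := (fun z => de^-1 * (Y z - _)) in nf1.
set M' := (fun x y => _) in nf1.
set b' := (fun g => de^-1 * (b g - _)) in nf1.
have nf' : nform G X Y' M' a b' (fun g => conjc (a g)).
  split; first exact: nf_chart nf1.
    exact: nfX nf1.
  move=> g z Gg; rewrite (nfY nf1) // cE //; congr (_ + _ * _ + _).
  by rewrite /rlin; field.
clearbody Y' M' b'; clear nf1.
have ch := nf_chart nf'.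
have extA (f : (C2 -> C2) -> C) :
    (forall g k, aff_set G g -> aff_set G k -> f (g \o k) = f g + f k) ->
    (forall g, aff_set G g -> a g = 0 -> f g = 0) ->
    exists p q, forall g, aff_set G g -> f g = rlin p q (a g).
  move=> fM f0; apply: (nf_rlin_extension Gcpt nf') => //.
  exact: (nf_hom_bound Gpd Gfree Gcpt nf' G1 G2 D'0 fM f0).
have spanB (p : C) : (forall k, aff_set G k -> a k = 0 -> complex.Re (p * b' k) = 0) -> p = 0.
  move=> H; apply: contrapT => /eqP p0.
  have [m [Gm am bm _]] := nf_commutator Gfree nf' G1 G2.
  (* the commutators are purely imaginary, hence p is real *)
  have pr : conjc p = p.
    have := H m Gm am; rewrite bm => /ReE; rewrite conjM conjB !conjM !conjK.
    set w := conjc (a h1) * a h2 - _ in D'0 *.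
    have -> : a h1 * conjc (a h2) - a h2 * conjc (a h1) = - w by rewrite /w; ring.
    move=> h; apply/eqP; rewrite eq_sym -subr_eq0; apply/eqP; apply: (mulIf D'0).
    by rewrite mul0r -[RHS]h; ring.
  have bK k : aff_set G k -> a k = 0 -> b' k + conjc (b' k) = 0.
    move=> Gk ak; apply: (mulfI p0); rewrite mulr0 -[RHS](ReE (H k Gk ak)).
    by rewrite conjM pr; ring.
  (* The real part of [b'] minus half of [|a|^2]. It is additive because the real part of
     [conjc (a g) * a k] is the polarisation of half of [|a|^2]. *)
  pose f g := (b' g + conjc (b' g)) / 2 - a g * conjc (a g) / 2.
  have [||s [t fE]] := extA f.
  - move=> g k Gg Gk; rewrite /f (nf_aM nf' Gg Gk) (nf_bM nf' Gg Gk).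
    by rewrite !conjD conjM conjK; field.
  - by move=> g Gg ag; rewrite /f bK // ag !mul0r subrr.
  (* An invariant function which on [X = 0] is the real part of [Y'], hence unbounded. *)
  pose q z := (Y' z + conjc (Y' z)) / 2 - X z * conjc (X z) / 2 - rlin s t (X z).
  have pX := chXp ch; have pY := chYp ch.
  have pq : cpoly q.
    apply: cpoly_add; last by apply: cpoly_opp; exact: cpoly_rlin.
    apply: cpoly_add; last apply: cpoly_opp; apply: cpoly_mul; try exact: cpoly_cst.
      by apply: cpoly_add => //; exact: cpoly_conj.
    by apply: cpoly_mul => //; exact: cpoly_conj.
  have qG g z : aff_set G g -> q (g z) = q z.
    move=> Gg; rewrite /q (nfX nf') // (nfY nf') // rlinD -fE // /f.
    by rewrite !conjD conjM conjK; field.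
  have [N NP] := invariant_bounded Gcpt (cpoly_continuous pq) qG.
  suff /eqP : (1 : C) = 0 by rewrite oner_eq0.
  apply: (@bounded_progression R 0 1 N) => n; rewrite add0r mulr1.
  have := NP (M' 0 n%:R); rewrite /q (chX ch) (chY ch) rlin0 conj_nat !mul0r !subr0.
  by congr (cabs _ <= _); field.
exists Y', M', b'; split => // f fM.
have c0 g : a g = 0 -> conjc (a g) = 0 by move=> ->; rewrite conj0.
have bM g k : aff_set G g -> aff_set G k -> a g = 0 -> b' (g \o k) = b' g + b' k.
  by move=> Gg Gk ag; rewrite (nf_bM nf' Gg Gk) c0 // mul0r addr0.
have f1 : f id = 0.
  have a1 := nf_a1 nf'.
  by apply: (@addrI _ (f id)); rewrite addr0 -(fM id id (aff_id G) (aff_id G) a1 a1).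
pose Gam : set (C * C) := [set w | exists2 g, aff_set G g & a g = 0 /\ w = (b' g, f g)].
have [] := @rlin_extension R Gam.
- by exists id; [exact: aff_id|rewrite (nf_a1 nf') (nf_b1 nf') f1].
- move=> _ _ [g Gg [ag ->]] [k Gk [ak ->]].
  have [k' [Gk' kk' k'k ak' _]] := nf_inv nf' Gk.
  have ak'0 : a k' = 0 by rewrite ak' ak oppr0.
  exists (g \o k'); first exact: aff_comp.
  split; first by rewrite (nf_aM nf' Gg Gk') ag ak'0 addr0.
  rewrite (bM _ _ Gg Gk' ag) (fM _ _ Gg Gk' ag ak'0).
  have -> : b' k' = - b' k.
    by apply: (@addIr _ (b' k)); rewrite addNr -(bM _ _ Gk' Gk ak'0) k'k (nf_b1 nf').
  congr (_, _ + _).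
  by apply: (@addIr _ (f k)); rewrite addNr -(fM _ _ Gk' Gk ak'0 ak) k'k f1.
- move=> l H; apply: spanB => g Gg ag; apply: (H (b' g, f g)); by exists g.
- move=> r; have [N NP] := nf_bound Gpd nf' f (Num.max r 0).
  exists N => _ [g Gg [ag ->]] /= br; apply: NP => //.
    by rewrite ag cabs0 le_max lexx orbT.
  by rewrite le_max br.
- move=> p [q H]; exists p, q => g Gg ag; apply: (H (b' g, f g)); by exists g.
Qed.

End Forms.

(** * Rigidity of antiholomorphic equivariant maps *)

Section Quadratic.
Variable R : realType.
Local Notation C := (Cplx R).
Local Notation C2 := (C2 R).

(** Polynomials of degree at most 2 in [z] and [conj z] have constant second differences, and this
    is all that [entire_near_quadratic] asks of them. *)
Definition quadratic (P : C -> C) :=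
  forall u v, exists k, forall z, P (z + u + v) - P (z + u) - P (z + v) + P z = k.

Lemma quadratic_cst c : quadratic (fun=> c).
Proof. by move=> u v; exists 0 => z; ring. Qed.

Lemma quadratic_rlin p q : quadratic (rlin p q).
Proof. by move=> u v; exists 0 => z; rewrite !rlinD; ring. Qed.

Lemma quadraticD P Q : quadratic P -> quadratic Q -> quadratic (fun z => P z + Q z).
Proof.
move=> qP qQ u v; have [k kP] := qP u v; have [l lP] := qQ u v.
by exists (k + l) => z; rewrite -(kP z) -(lP z); ring.
Qed.

Lemma quadratic_rlin_comp p q P : quadratic P -> quadratic (fun z => rlin p q (P z)).
Proof.
move=> qP u v; have [k kP] := qP u v; exists (rlin p q k) => z.
by rewrite -(kP z) !(rlinD, rlinN).
Qed.

Lemma quadratic_comp_affine p q s P : quadratic P -> quadratic (fun z => P (rlin p q z + s)).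
Proof.
move=> qP u v; have [k kP] := qP (rlin p q u) (rlin p q v).
exists k => z; rewrite -(kP (rlin p q z + s)) !rlinD.
have -> : rlin p q z + rlin p q u + rlin p q v + s =
  rlin p q z + s + rlin p q u + rlin p q v by ring.
have -> : rlin p q z + rlin p q u + s = rlin p q z + s + rlin p q u by ring.
by have -> : rlin p q z + rlin p q v + s = rlin p q z + s + rlin p q v by ring.
Qed.

Lemma quadratic_conj P : quadratic P -> quadratic (fun z => conjc (P z)).
Proof.
move=> qP; have := quadratic_rlin_comp 0 1 qP; congr quadratic.
by apply/funext => z; rewrite /rlin mul0r add0r mul1r.
Qed.

Lemma bounded_quadratic P (N : R) : quadratic P -> (forall z, cabs (P z) <= N) ->
  forall z, P z = P 0.
Proof.
move=> qP PN z.
have := @entire_near_quadratic R (fun=> 0) P N (entire_cst 0) qP.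
move=> /(_ _ z); rewrite !sub0r => h; apply: oppr_inj; apply: h => w.
by rewrite sub0r cabsN.
Qed.

(** The one-variable statement, applied to conjugates on coordinate lines, makes the difference
    independent of [x] and of [y]. *)
Lemma chart_rigid (X Y : C2 -> C) M (W : C2 -> C) (P : C -> C -> C) (N : R) : chart X Y M ->
  (forall f g, entire f -> entire g -> entire (fun t => conjc (W (M (f t) (g t))))) ->
  (forall x, quadratic (P x)) -> (forall y, quadratic (P ^~ y)) ->
  (forall z, cabs (W z - P (X z) (Y z)) <= N) ->
  exists s, forall z, W z = P (X z) (Y z) + s.
Proof.
move=> ch We Px Py WN; exists (W (M 0 0) - P 0 0) => z.
pose D x y := W (M x y) - P x y.
have DN x y : cabs (D x y) <= N by have := WN (M x y); rewrite (chX ch) (chY ch).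
have conjBN (u v : C) : cabs (conjc u - conjc v) = cabs (u - v) by rewrite -conjB cabs_conj.
have Dx x y : D x y = D 0 y.
  have := @entire_near_quadratic R (fun t => conjc (W (M t y))) (fun t => conjc (P t y)) N
    (We _ _ (@entire_id R) (entire_cst y)) (quadratic_conj (Py y)).
  move=> /(_ (fun t => _) x); rewrite -!conjB => h.
  have : conjc (D x y) = conjc (D 0 y) by apply: h => t; rewrite conjBN; exact: DN.
  by move=> /(congr1 (@conjc R)); rewrite !conjK.
have Dy x y : D x y = D x 0.
  have := @entire_near_quadratic R (fun t => conjc (W (M x t))) (fun t => conjc (P x t)) N
    (We _ _ (entire_cst x) (@entire_id R)) (quadratic_conj (Px x)).
  move=> /(_ (fun t => _) y); rewrite -!conjB => h.
  have : conjc (D x y) = conjc (D x 0) by apply: h => t; rewrite conjBN; exact: DN.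
  by move=> /(congr1 (@conjc R)); rewrite !conjK.
have : D (X z) (Y z) = D 0 0 by rewrite Dx Dy.
by rewrite /D (chM ch) => /eqP; rewrite subr_eq addrC => /eqP.
Qed.

Lemma antiholomorphic_chart (X Y : C2 -> C) M (X' Y' : C2 -> C) M' (h : C2 -> C2) :
  chart X Y M -> chart X' Y' M' -> antiholomorphic_curves h ->
  forall f g, entire f -> entire g ->
    entire (fun t => conjc (X' (h (M (f t) (g t))))) /\
    entire (fun t => conjc (Y' (h (M (f t) (g t))))).
Proof.
move=> ch ch' ha f g ef eg.
have [e1 e2] := ha (fun t => M (f t) (g t)) (chMh ch ef eg).
exact: (chanti ch' e1 e2).
Qed.

Record group_iso (G G' : affine_group R) (phi psi : (C2 -> C2) -> (C2 -> C2)) : Prop := GroupIso {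
  gi_in : forall g, aff_set G g -> aff_set G' (phi g);
  gi_in' : forall g, aff_set G' g -> aff_set G (psi g);
  giM : forall g k, aff_set G g -> aff_set G k -> phi (g \o k) = phi g \o phi k;
  giK : forall g, aff_set G g -> psi (phi g) = g;
  giK' : forall g, aff_set G' g -> phi (psi g) = g
}.

Lemma group_iso_sym G G' phi psi : group_iso G G' phi psi -> group_iso G' G psi phi.
Proof.
move=> iso; split; [exact: gi_in' iso|exact: gi_in iso| |exact: giK' iso|exact: giK iso].
move=> g k Gg Gk; have Gg' := gi_in' iso Gg; have Gk' := gi_in' iso Gk.
rewrite -{1}(giK' iso Gg) -{1}(giK' iso Gk) -(giM iso Gg' Gk').
by rewrite (giK iso) //; exact: aff_comp.
Qed.

(** [h] is invertible because [h \o h] belongs to [G]; conjugation by [h] preserves [G] because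
    [h \o g] lifts [sigma] again. *)
Lemma lifting_iso (G : affine_group R) (sigma : orbit_space G -> orbit_space G) h :
  properly_discontinuous G -> fixed_point_free G -> real_structure sigma ->
  liftings sigma h ->
  (forall z, exists w, h w = z) /\
  exists phi psi, group_iso G G phi psi /\ forall g, aff_set G g -> h \o g = phi g \o h.
Proof.
move=> Gpd Gfree sr hL.
have Gm := lifting_square Gpd Gfree sr hL.
have [m' [Gm' mm' m'm]] := aff_inv Gm.
have hsurj z : exists w, h w = z by exists (h (m' z)); have := m'm z.
have hinj : injective h by move=> z w e; apply: (can_inj mm'); rewrite /= e.
have ex g : exists k, aff_set G g -> aff_set G k /\ h \o g = k \o h.
  have [Gg|ng] := pselect (aff_set G g); last by exists id.
  by have [k Gk kE] := lifting_conj Gpd Gfree hL Gg; exists k.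
have [phi phiP] := choice ex.
have cancel_h k k' : k \o h = k' \o h -> k = k'.
  move=> e; apply/funext => z; have [w <-] := hsurj z.
  exact: (congr1 (fun f => f w) e).
have phiM g k : aff_set G g -> aff_set G k -> phi (g \o k) = phi g \o phi k.
  move=> Gg Gk; apply: (cancel_h).
  have [_ e1] := phiP _ (aff_comp Gg Gk); have [_ e2] := phiP g Gg; have [_ e3] := phiP k Gk.
  rewrite -e1; apply/funext => w /=.
  have -> : h (g (k w)) = phi g (h (k w)) by exact: (congr1 (fun f => f (k w)) e2).
  by have -> : h (k w) = phi k (h w) by exact: (congr1 (fun f => f w) e3).
have phiI g k : aff_set G g -> aff_set G k -> phi g = phi k -> g = k.
  move=> Gg Gk e; have [_ e2] := phiP g Gg; have [_ e3] := phiP k Gk.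
  apply/funext => w; apply: hinj.
  have := congr1 (fun f => f w) e2; rewrite e => /= ->.
  by have := congr1 (fun f => f w) e3 => /= ->.
have phiS k : exists g, aff_set G k -> aff_set G g /\ phi g = k.
  have [Gk|nk] := pselect (aff_set G k); last by exists id.
  (* Conjugating twice by [h] is conjugating by [h \o h]. So if [g] is [k] conjugated back by
     [h \o h], then [phi g] is the preimage of [k]. *)
  pose g := (m' \o k) \o (h \o h).
  have Gg : aff_set G g by apply: aff_comp Gm; exact: aff_comp.
  have [Gpg e1] := phiP g Gg; have [Gppg e2] := phiP _ Gpg.
  exists (phi g) => _; split => //; apply: (cancel_h); rewrite -e2.
  apply: (cancel_h); apply/funext => w /=.
  have -> : phi g (h w) = h (g w) by exact: (congr1 (fun f => f w) (esym e1)).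
  by rewrite /g /=; exact: (m'm (k (h (h w)))).
have [psi psiP] := choice phiS.
split => //; exists phi, psi; split; last by move=> g Gg; exact: (phiP g Gg).2.
split.
- by move=> g Gg; exact: (phiP g Gg).1.
- by move=> g Gg; exact: (psiP g Gg).1.
- exact: phiM.
- move=> g Gg; have [Gp e] := psiP _ (phiP g Gg).1.
  exact: phiI.
- by move=> g Gg; exact: (psiP g Gg).2.
Qed.

(* The translation parts s_h, s' of commuting real structures h, h' satisfy
   A' e = - e for e = s' - L s_h, as h^2 and h'^2 correspond to each other. *)
Lemma antifixed (V V' : zmodType) (L : V -> V') (A : V -> V) (A' : V' -> V') sh s' v :
  (forall x y, L (x - y) = L x - L y) -> (forall x y, A' (x - y) = A' x - A' y) ->
  (forall x, L (A x) = A' (L x)) -> A sh + sh = v -> A' s' + s' = L v ->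
  A' (s' - L sh) = - (s' - L sh).
Proof.
move=> LB A'B LA e e'.
have -> : A' (s' - L sh) = (L v - s') - L (v - sh).
  by rewrite A'B -e' addrK -LA -e addrK.
by rewrite LB !opprB addrC addrA subrK.
Qed.

End Quadratic.

(** * Abelian groups *)

Section RealLinear.
Variable R : realType.
Local Notation C := (Cplx R).
Local Notation C2 := (C2 R).

Definition rlin2 (l : C * C -> C) :=
  exists p q r s, forall w, l w = rlin p q w.1 + rlin r s w.2.
Definition rlinear2 (L : C * C -> C * C) :=
  rlin2 (fun w => (L w).1) /\ rlin2 (fun w => (L w).2).

Lemma rlin2B l x y : rlin2 l -> l (x - y) = l x - l y.
Proof.
by move=> [p [q [r [s lE]]]]; rewrite !lE /= !rlinB; ring.
Qed.

Lemma rlinear2B L x y : rlinear2 L -> L (x - y) = L x - L y.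
Proof.
move=> [L1 L2]; rewrite [LHS]surjective_pairing.
by rewrite (rlin2B x y L1) (rlin2B x y L2).
Qed.

Lemma rlin2_comp l L : rlin2 l -> rlinear2 L -> rlin2 (fun w => l (L w)).
Proof.
move=> [p [q [r [s lE]]]] [[p1 [q1 [r1 [s1 L1]]]] [p2 [q2 [r2 [s2 L2]]]]].
exists (p * p1 + q * conjc q1 + (r * p2 + s * conjc q2)),
  (p * q1 + q * conjc p1 + (r * q2 + s * conjc p2)),
  (p * r1 + q * conjc s1 + (r * r2 + s * conjc s2)),
  (p * s1 + q * conjc r1 + (r * s2 + s * conjc r2)) => w.
by rewrite lE L1 L2 /rlin !(conjD, conjM) !conjK; ring.
Qed.

Lemma rlinear2_comp L L' : rlinear2 L -> rlinear2 L' -> rlinear2 (fun w => L (L' w)).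
Proof. by move=> [L1 L2] L'r; split; [exact: (rlin2_comp L1 L'r)|exact: (rlin2_comp L2 L'r)]. Qed.

Lemma rlinear2_id : rlinear2 id.
Proof.
by split; [exists 1, 0, 0, 0|exists 0, 0, 1, 0] => w; rewrite /rlin; ring.
Qed.

Lemma rlin2_cpoly l (f g : C2 -> C) : rlin2 l -> cpoly f -> cpoly g ->
  cpoly (fun z => l (f z, g z)).
Proof.
move=> [p [q [r [s lE]]]] pf pg.
have -> : (fun z => l (f z, g z)) = (fun z => rlin p q (f z) + rlin r s (g z)).
  by apply/funext => z; rewrite lE.
by apply: cpoly_add; exact: cpoly_rlin.
Qed.

Lemma rlin2_quadratic_l l y : rlin2 l -> quadratic (fun x => l (x, y)).
Proof.
move=> [p [q [r [s lE]]]]; have -> : (fun x => l (x, y)) = (fun x => rlin p q x + rlin r s y).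
  by apply/funext => x; rewrite lE.
by apply: quadraticD; [exact: quadratic_rlin|exact: quadratic_cst].
Qed.

Lemma rlin2_quadratic_r l x : rlin2 l -> quadratic (fun y => l (x, y)).
Proof.
move=> [p [q [r [s lE]]]]; have -> : (fun y => l (x, y)) = (fun y => rlin p q x + rlin r s y).
  by apply/funext => y; rewrite lE.
by apply: quadraticD; [exact: quadratic_cst|exact: quadratic_rlin].
Qed.

Section TorusForm.
Variables (G : affine_group R) (X Y : C2 -> C) (M : C -> C -> C2) (a b : (C2 -> C2) -> C).
Hypothesis tf : torus_form G X Y M a b.

Lemma tf_rlin2_eq0 l : rlin2 l -> (forall g, aff_set G g -> l (a g, b g) = 0) ->
  forall w, l w = 0.
Proof.
move=> [p [q [r [s lE]]]] H.
have H' g : aff_set G g -> rlin p q (a g) + rlin r s (b g) = 0.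
  by move=> Gg; have := H g Gg; rewrite lE.
have [h1 h2] : p + conjc q = 0 /\ r + conjc s = 0.
  apply: (tf_span tf) => g Gg; have := congr1 (@complex.Re R) (H' g Gg); rewrite /rlin /=.
  by case: (p) (q) (r) (s) (a g) (b g) => [? ?] [? ?] [? ?] [? ?] [? ?] [? ?] /= e;
    rewrite -[RHS]e; ring.
have [h3 h4] : Complex 0 (-1) * (p - conjc q) = 0 :> C /\ Complex 0 (-1) * (r - conjc s) = 0 :> C.
  apply: (tf_span tf) => g Gg; have := congr1 (@complex.Im R) (H' g Gg); rewrite /rlin /=.
  by case: (p) (q) (r) (s) (a g) (b g) => [? ?] [? ?] [? ?] [? ?] [? ?] [? ?] /= e;
    rewrite -[RHS]e; ring.
have [p0 q0] := conj_pair_eq0 h1 h3; have [r0 s0] := conj_pair_eq0 h2 h4.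
by move=> w; rewrite lE p0 q0 r0 s0 /rlin; ring.
Qed.

Lemma tf_unique L L' : rlinear2 L -> rlinear2 L' ->
  (forall g, aff_set G g -> L (a g, b g) = L' (a g, b g)) -> forall w, L w = L' w.
Proof.
move=> [L1 L2] [L1' L2'] e w.
have sub l l' : rlin2 l -> rlin2 l' -> rlin2 (fun w => l w - l' w).
  move=> [p [q [r [s lE]]]] [p' [q' [r' [s' lE']]]].
  exists (p - p'), (q - q'), (r - r'), (s - s') => v.
  by rewrite lE lE' /rlin; ring.
rewrite [LHS]surjective_pairing [RHS]surjective_pairing; congr (_, _); apply: subr0_eq.
  by apply: (tf_rlin2_eq0 (sub _ _ L1 L1')) => g Gg; rewrite e // subrr.
by apply: (tf_rlin2_eq0 (sub _ _ L2 L2')) => g Gg; rewrite e // subrr.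
Qed.

Lemma tf_X g z : aff_set G g -> X (g z) = X z + a g.
Proof. exact: (nfX (tf_nf tf)). Qed.

Lemma tf_Y g z : aff_set G g -> Y (g z) = Y z + b g.
Proof. by move=> Gg; rewrite (nfY (tf_nf tf)) // mul0r addr0. Qed.

Lemma tf_aM g k : aff_set G g -> aff_set G k -> a (g \o k) = a g + a k.
Proof. exact: (nf_aM (tf_nf tf)). Qed.

Lemma tf_bM g k : aff_set G g -> aff_set G k -> b (g \o k) = b g + b k.
Proof. by move=> Gg Gk; rewrite (nf_bM (tf_nf tf)) // mul0r addr0. Qed.

End TorusForm.

Section TorusPair.
Variables (G G' : affine_group R) (X Y : C2 -> C) (M : C -> C -> C2) (a b : (C2 -> C2) -> C).
Variables (X' Y' : C2 -> C) (M' : C -> C -> C2) (a' b' : (C2 -> C2) -> C).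
Hypothesis tf : torus_form G X Y M a b.
Hypothesis tf' : torus_form G' X' Y' M' a' b'.
Variables (phi psi : (C2 -> C2) -> (C2 -> C2)).
Hypothesis iso : group_iso G G' phi psi.

Lemma tf_hom : exists L, rlinear2 L /\
  forall g, aff_set G g -> (a' (phi g), b' (phi g)) = L (a g, b g).
Proof.
have [p [q [r [s e1]]]] := tf_ext tf (f := fun g => a' (phi g))
  (fun g k Gg Gk => etrans (congr1 a' (giM iso Gg Gk)) (tf_aM tf' (gi_in iso Gg) (gi_in iso Gk))).
have [p2 [q2 [r2 [s2 e2]]]] := tf_ext tf (f := fun g => b' (phi g))
  (fun g k Gg Gk => etrans (congr1 b' (giM iso Gg Gk)) (tf_bM tf' (gi_in iso Gg) (gi_in iso Gk))).
exists (fun w => (rlin p q w.1 + rlin r s w.2, rlin p2 q2 w.1 + rlin r2 s2 w.2)); split.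
  by split; [exists p, q, r, s|exists p2, q2, r2, s2].
by move=> g Gg; rewrite e1 // e2.
Qed.

Hypothesis Gcpt : compact [set: orbit_space G].

(** The coordinates of [f] differ from the components of [L] by invariant, hence bounded, functions,
    which [chart_rigid] makes constant. *)
Lemma tf_rigid L (f : C2 -> C2) : rlinear2 L ->
  (forall g, aff_set G g -> (a' (phi g), b' (phi g)) = L (a g, b g)) ->
  continuous f -> antiholomorphic_curves f ->
  (forall g, aff_set G g -> f \o g = phi g \o f) ->
  exists s, forall z, (X' (f z), Y' (f z)) = L (X z, Y z) + s.
Proof.
move=> Lr LE fc fa fE.
have ch := nf_chart (tf_nf tf); have ch' := nf_chart (tf_nf tf').
have fg g z : aff_set G g -> f (g z) = phi g (f z).
  by move=> Gg; exact: (congr1 (fun k => k z) (fE g Gg)).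
have rigid (W' : C2 -> C) (l : C * C -> C) (d : (C2 -> C2) -> C) : cpoly W' -> rlin2 l ->
    (forall g z, aff_set G g -> W' (f (g z)) = W' (f z) + d g) ->
    (forall g, aff_set G g -> d g = l (a g, b g)) ->
    (forall u v, entire u -> entire v -> entire (fun t => conjc (W' (f (M (u t) (v t)))))) ->
    exists s, forall z, W' (f z) = l (X z, Y z) + s.
  move=> pW lr Wg dE We.
  have pl : cpoly (fun z => l (X z, Y z)) by apply: rlin2_cpoly lr (chXp ch) (chYp ch).
  have c : continuous (fun z => W' (f z) - l (X z, Y z)).
    move=> z; apply: (@continuousB C C^o _ (fun z => W' (f z)) (fun z => l (X z, Y z))).
      by apply: continuous_comp; [exact: fc|exact: cpoly_continuous].
    exact: (cpoly_continuous pl).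
  have inv g z : aff_set G g -> W' (f (g z)) - l (X (g z), Y (g z)) = W' (f z) - l (X z, Y z).
    move=> Gg; rewrite Wg // dE // (tf_X tf) // (tf_Y tf) //.
    have := rlin2B (X z + a g, Y z + b g) (a g, b g) lr.
    have -> : (X z + a g, Y z + b g) - (a g, b g) = (X z, Y z) :> C * C.
      by congr (_, _); rewrite addrK.
    by move=> ->; ring.
  have [N NP] := invariant_bounded Gcpt c inv.
  apply: (@chart_rigid R X Y M (fun z => W' (f z)) (fun x y => l (x, y)) N ch) => //.
    by move=> x; exact: rlin2_quadratic_r.
  by move=> y; exact: rlin2_quadratic_l.
have ac := antiholomorphic_chart ch ch' fa.
have [|||||s sE] := rigid X' (fun w => (L w).1) (fun g => a' (phi g)).
- exact: chXp ch'.
- exact: Lr.1.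
- by move=> g z Gg; rewrite fg // (tf_X tf') //; exact: (gi_in iso).
- by move=> g Gg; rewrite -LE.
- by move=> u v eu ev; exact: (ac u v eu ev).1.
have [|||||t tE] := rigid Y' (fun w => (L w).2) (fun g => b' (phi g)).
- exact: chYp ch'.
- exact: Lr.2.
- by move=> g z Gg; rewrite fg // (tf_Y tf') //; exact: (gi_in iso).
- by move=> g Gg; rewrite -LE.
- by move=> u v eu ev; exact: (ac u v eu ev).2.
by exists (s, t) => z; rewrite sE tE [L _]surjective_pairing.
Qed.

End TorusPair.
End RealLinear.

Section Equivariant.
Variable R : realType.
Local Notation C := (Cplx R).
Local Notation C2 := (C2 R).

(* An isomorphism of extensions with [h] corresponding to [h']: by [ed_comm] it
   intertwines the conjugations by [h] and [h']. *)
Record extension_data (G G' : affine_group R) (phi psi : (C2 -> C2) -> (C2 -> C2))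
    (h h' : C2 -> C2) : Prop := ExtensionData {
  ed_iso : group_iso G G' phi psi;
  ed_h : exists ph qh, group_iso G G ph qh /\ forall g, aff_set G g -> h \o g = ph g \o h;
  ed_h' : exists ph qh, group_iso G' G' ph qh /\ forall g, aff_set G' g -> h' \o g = ph g \o h';
  ed_hc : continuous h;
  ed_h'c : continuous h';
  ed_ha : antiholomorphic_curves h;
  ed_h'a : antiholomorphic_curves h';
  ed_hh : aff_set G (h \o h);
  ed_phihh : phi (h \o h) = h' \o h';
  ed_h'surj : forall z, exists w, h' w = z;
  ed_comm : forall g k, aff_set G g -> aff_set G k -> h \o g = k \o h ->
    h' \o phi g = phi k \o h'
}.

Definition equivariant_diffeo (G : affine_group R) (phi : (C2 -> C2) -> (C2 -> C2))
    (h h' : C2 -> C2) := exists F F' : C2 -> C2,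
  [/\ cancel F F', cancel F' F, smooth_on setT F, smooth_on setT F' &
      (forall g, aff_set G g -> F \o g = phi g \o F) /\ F \o h = h' \o F].

Lemma ed_conj G G' phi psi h h' ph qh ph' qh' : extension_data G G' phi psi h h' ->
  group_iso G G ph qh -> (forall g, aff_set G g -> h \o g = ph g \o h) ->
  group_iso G' G' ph' qh' -> (forall g, aff_set G' g -> h' \o g = ph' g \o h') ->
  forall g, aff_set G g -> phi (ph g) = ph' (phi g).
Proof.
move=> ed ih hE ih' h'E g Gg.
have e1 := ed_comm ed Gg (gi_in ih Gg) (hE g Gg).
have e2 := h'E _ (gi_in (ed_iso ed) Gg).
apply/funext => z; have [w <-] := ed_h'surj ed z.
by have := congr1 (fun f => f w) (etrans (esym e1) e2).
Qed.

(** In coordinates [h] is [A + sh], [h'] is [A' + s'], and any [L + s] is equivariant for [G]. It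
    intertwines [h] and [h'] when [s - A' s = e] with [e = s' - L sh]; as [A' e = - e] by
    [antifixed], half of [e] is a solution. *)
Lemma torus_equivariant (G G' : affine_group R) X Y M a b X' Y' M' a' b' phi psi h h' :
  compact [set: orbit_space G] -> compact [set: orbit_space G'] ->
  torus_form G X Y M a b -> torus_form G' X' Y' M' a' b' ->
  extension_data G G' phi psi h h' -> equivariant_diffeo G phi h h'.
Proof.
move=> Gcpt G'cpt tf tf' ed; have iso := ed_iso ed; have iso' := group_iso_sym iso.
have ch := nf_chart (tf_nf tf); have ch' := nf_chart (tf_nf tf').
have [L [Lr LE]] := tf_hom tf tf' iso.
have [L' [L'r L'E]] := tf_hom tf' tf iso'.
have L'L w : L' (L w) = w.
  apply: (@tf_unique R G X Y M a b tf (fun w => L' (L w)) id (rlinear2_comp L'r Lr) (rlinear2_id R)) => g Gg.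
  by rewrite -LE // -L'E ?(giK iso Gg) //; exact: gi_in iso _ Gg.
have LL' w : L (L' w) = w.
  apply: (@tf_unique R G' X' Y' M' a' b' tf' (fun w => L (L' w)) id (rlinear2_comp Lr L'r) (rlinear2_id R)) => g Gg.
  by rewrite -L'E // -LE ?(giK' iso Gg) //; exact: gi_in' iso _ Gg.
have [ph [qh [ih hE]]] := ed_h ed; have [ph' [qh' [ih' h'E]]] := ed_h' ed.
have [A [Ar AE]] := tf_hom tf tf ih; have [A' [A'r A'E]] := tf_hom tf' tf' ih'.
have [sh shE] := tf_rigid tf tf ih Gcpt Ar AE (ed_hc ed) (ed_ha ed) hE.
have [s' s'E] := tf_rigid tf' tf' ih' G'cpt A'r A'E (ed_h'c ed) (ed_h'a ed) h'E.
have LA w : L (A w) = A' (L w).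
  apply: (@tf_unique R G X Y M a b tf (fun w => L (A w)) (fun w => A' (L w)) (rlinear2_comp Lr Ar) (rlinear2_comp A'r Lr)) => g Gg.
  rewrite -AE // -LE; last exact: gi_in ih _ Gg.
  rewrite -LE // -A'E; last exact: gi_in iso _ Gg.
  by rewrite (ed_conj ed ih hE ih' h'E Gg).
pose Z z := (X z, Y z); pose Z' z := (X' z, Y' z).
have ZM w : Z (M w.1 w.2) = w by rewrite /Z (chX ch) (chY ch); case: w.
have Z'M w : Z' (M' w.1 w.2) = w by rewrite /Z' (chX ch') (chY ch'); case: w.
have Z'I z w : Z' z = Z' w -> z = w.
  by move=> e; rewrite -(chM ch' z) -(chM ch' w); exact: (congr1 (fun p : C * C => M' p.1 p.2) e).
have Zg g z : aff_set G g -> Z (g z) = Z z + (a g, b g).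
  by move=> Gg; rewrite /Z (tf_X tf) // (tf_Y tf).
have Z'g g z : aff_set G' g -> Z' (g z) = Z' z + (a' g, b' g).
  by move=> Gg; rewrite /Z' (tf_X tf') // (tf_Y tf').
have add0 (B : C * C -> C * C) : rlinear2 B -> B 0 = 0.
  by move=> Br; have := rlinear2B 0 0 Br; rewrite !subrr.
have addD (B : C * C -> C * C) x y : rlinear2 B -> B (x + y) = B x + B y.
  move=> Br; have := rlinear2B (x + y) y Br; rewrite addrK => ->.
  by rewrite subrK.
have hZ z : Z (h z) = A (Z z) + sh by exact: shE.
have h'Z z : Z' (h' z) = A' (Z' z) + s' by exact: s'E.
have ZM0 : Z (M 0 0) = 0 := ZM (0, 0).
have Z'M0 : Z' (M' 0 0) = 0 := Z'M (0, 0).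
pose m := h \o h.
have e1 : A sh + sh = (a m, b m).
  have := Zg m (M 0 0) (ed_hh ed); rewrite /m /= !hZ ZM0 (add0 _ Ar) !add0r; exact.
have e2 : A' s' + s' = L (a m, b m).
  rewrite -LE; last exact: ed_hh ed.
  have := Z'g (phi m) (M' 0 0) (gi_in iso (ed_hh ed)).
  rewrite {1}/m (ed_phihh ed) /= !h'Z Z'M0 (add0 _ A'r) !add0r; exact.
pose e := s' - L sh.
have A'e : A' e = - e.
  apply: (antifixed (fun x y => rlinear2B x y Lr) (fun x y => rlinear2B x y A'r) LA e1 e2).
pose s : C * C := (e.1 / 2, e.2 / 2).
have half (x : C) : x / 2 + x / 2 = x by field.
have ss : s + s = e by rewrite [RHS]surjective_pairing -[e.1]half -[e.2]half.
have A's : A' s = - s.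
  have : (A' s + s) + (A' s + s) = 0.
    by rewrite addrACA -addD // ss A'e addNr.
  have two (x : C) : x + x = 0 -> x = 0.
    by move=> /eqP; rewrite -mulr2n mulrn_eq0 /= => /eqP.
  case: (A' s + s) (addrK s (A' s)) => [x y] <- [/two -> /two ->].
  by rewrite sub0r.
pose F z := let w := L (Z z) + s in M' w.1 w.2.
pose F' z := let w := L' (Z' z - s) in M w.1 w.2.
have FZ z : Z' (F z) = L (Z z) + s by exact: Z'M.
have F'Z z : Z (F' z) = L' (Z' z - s) by exact: ZM.
have pZ : cpoly X /\ cpoly Y by split; [exact: chXp ch|exact: chYp ch].
have pZ' : cpoly X' /\ cpoly Y' by split; [exact: chXp ch'|exact: chYp ch'].
exists F, F'; split.
- move=> z; rewrite -(chM ch (F' (F z))) -[RHS](chM ch).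
  by have := F'Z (F z); rewrite FZ addrK L'L => -[-> ->].
- by move=> z; apply: Z'I; rewrite FZ F'Z LL' subrK.
- have p1 : cpoly (fun z => (L (X z, Y z)).1 + s.1).
    by apply: cpoly_add; [exact: rlin2_cpoly Lr.1 pZ.1 pZ.2|exact: cpoly_cst].
  have p2 : cpoly (fun z => (L (X z, Y z)).2 + s.2).
    by apply: cpoly_add; [exact: rlin2_cpoly Lr.2 pZ.1 pZ.2|exact: cpoly_cst].
  have [q1 q2] := chMp ch' p1 p2.
  by apply: cpoly_smooth.
- have p1 : cpoly (fun z => (L' (X' z - s.1, Y' z - s.2)).1).
    by apply: (rlin2_cpoly L'r.1); apply: cpoly_add; try exact: cpoly_cst; case: pZ'.
  have p2 : cpoly (fun z => (L' (X' z - s.1, Y' z - s.2)).2).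
    by apply: (rlin2_cpoly L'r.2); apply: cpoly_add; try exact: cpoly_cst; case: pZ'.
  have [q1 q2] := chMp ch p1 p2.
  by apply: cpoly_smooth.
- split=> [g Gg|]; apply/funext => z; apply: Z'I.
    rewrite /= FZ Zg // addD // -LE // Z'g; last exact: gi_in iso _ Gg.
    by rewrite FZ addrAC.
  rewrite /= FZ hZ addD // h'Z FZ addD // A's -LA -!addrA; congr (_ + _).
  by apply: (@addrI _ s); rewrite addrCA ss [RHS]addrA subrr add0r /e addrC subrK.
Qed.

End Equivariant.

(** * Non-abelian groups *)

Section KodairaForm.
Variable R : realType.
Local Notation C := (Cplx R).
Local Notation C2 := (C2 R).
Variables (G : affine_group R) (X Y : C2 -> C) (M : C -> C -> C2) (a b : (C2 -> C2) -> C).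
Hypothesis kf : kodaira_form G X Y M a b.
Hypothesis Gcpt : compact [set: orbit_space G].

Lemma kf_X g z : aff_set G g -> X (g z) = X z + a g.
Proof. exact: (nfX (kf_nf kf)). Qed.

Lemma kf_Y g z : aff_set G g -> Y (g z) = Y z + conjc (a g) * X z + b g.
Proof. exact: (nfY (kf_nf kf)). Qed.

(** The condition says that [i * conj (a g) * a k] has real part 0 for all [k], so [nf_spanA]
    applies. *)
Lemma kf_center g : aff_set G g ->
  (forall k, aff_set G k -> conjc (a g) * a k = conjc (a k) * a g) -> a g = 0.
Proof.
move=> Gg H; have : Complex 0 1 * conjc (a g) = 0 :> C.
  apply: (nf_spanA Gcpt (kf_nf kf)) => k Gk; have := congr1 (@complex.Im R) (H k Gk).
  by case: (a g) (a k) => [x y] [u v] /= h; lra.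
have i0 : (Complex 0 1 : C) != 0 by rewrite eq_complex /= oner_eq0 andbF.
by move=> /eqP; rewrite mulf_eq0 (negbTE i0) conjc_eq0 => /eqP.
Qed.

Lemma kf_noncommuting : exists g k, [/\ aff_set G g, aff_set G k &
  conjc (a g) * a k - conjc (a k) * a g != 0].
Proof.
apply: contrapT => no.
have a0 g : aff_set G g -> a g = 0.
  move=> Gg; apply: kf_center => // k Gk; apply: subr0_eq; apply: contrapT => /eqP h.
  by apply: no; exists g, k.
suff /eqP : (1 : C) = 0 by rewrite oner_eq0.
by apply: (nf_spanA Gcpt (kf_nf kf)) => g Gg; rewrite a0 // mulr0.
Qed.

Lemma kf_rlin_eqA p q p' q' : (forall g, aff_set G g -> rlin p q (a g) = rlin p' q' (a g)) ->
  forall z, rlin p q z = rlin p' q' z.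
Proof.
move=> H.
have [||p0 q0] := @rlin_eq0 R [set x | exists2 g, aff_set G g & x = a g] (p - p') (q - q').
- by move=> l Hl; apply: (nf_spanA Gcpt (kf_nf kf)) => g Gg; apply: Hl; exists g.
- move=> _ [g Gg ->]; apply: (@addIr _ (rlin p' q' (a g))).
  by rewrite add0r -[RHS]H // /rlin; ring.
by move=> z; rewrite (subr0_eq p0) (subr0_eq q0).
Qed.

Lemma kf_rlin_eqB p q p' q' :
  (forall k, aff_set G k -> a k = 0 -> rlin p q (b k) = rlin p' q' (b k)) ->
  forall z, rlin p q z = rlin p' q' z.
Proof.
move=> H.
have [||p0 q0] := @rlin_eq0 R [set x | exists2 k, aff_set G k & a k = 0 /\ x = b k]
    (p - p') (q - q').
- by move=> l Hl; apply: (kf_spanB kf) => g Gg ag; apply: Hl; exists g.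
- move=> _ [g Gg [ag ->]]; apply: (@addIr _ (rlin p' q' (b g))).
  by rewrite add0r -[RHS]H // /rlin; ring.
by move=> z; rewrite (subr0_eq p0) (subr0_eq q0).
Qed.

End KodairaForm.

Section KodairaPair.
Variable R : realType.
Local Notation C := (Cplx R).
Local Notation C2 := (C2 R).

Definition rlinear (l : C -> C) := exists p q, l = rlin p q.

(* [al] and [be] describe the action of [phi] on the lattice and on the centre;
   [Q] is the correction which makes (x, y) |-> (al x, be y + Q x) equivariant. *)
Record kodaira_map (G : affine_group R) (a b a' b' : (C2 -> C2) -> C)
    (phi : (C2 -> C2) -> (C2 -> C2)) (al be Q : C -> C) : Prop := KodairaMap {
  km_al : rlinear al;
  km_be : rlinear be;
  km_quadratic : quadratic Q;
  km_cpoly : forall f : C2 -> C, cpoly f -> cpoly (fun z => Q (f z));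
  km_a : forall g, aff_set G g -> a' (phi g) = al (a g);
  km_b : forall g, aff_set G g -> a g = 0 -> b' (phi g) = be (b g);
  km_Q : forall g x, aff_set G g -> Q (x + a g) + be (conjc (a g) * x + b g) =
    Q x + conjc (al (a g)) * al x + b' (phi g)
}.

Variables (G G' : affine_group R) (X Y : C2 -> C) (M : C -> C -> C2) (a b : (C2 -> C2) -> C).
Variables (X' Y' : C2 -> C) (M' : C -> C -> C2) (a' b' : (C2 -> C2) -> C).
Hypothesis Gfree : fixed_point_free G.
Hypothesis kf : kodaira_form G X Y M a b.
Hypothesis kf' : kodaira_form G' X' Y' M' a' b'.
Hypothesis Gcpt : compact [set: orbit_space G].
Hypothesis G'cpt : compact [set: orbit_space G'].
Variables (phi psi : (C2 -> C2) -> (C2 -> C2)).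
Hypothesis iso : group_iso G G' phi psi.
Let nf := kf_nf kf.
Let nf' := kf_nf kf'.

(** Elements with [a g = 0] are central, and [kf_center] gives the converse in [G']. *)
Lemma kodaira_center g : aff_set G g -> a g = 0 -> a' (phi g) = 0.
Proof.
move=> Gg ag; have Gpg := gi_in iso Gg.
apply: (kf_center kf' G'cpt Gpg) => k' Gk'.
have Gk := gi_in' iso Gk'; have Gpk := gi_in iso Gk.
have e : g \o psi k' = psi k' \o g.
  apply: (nf_inj nf (aff_comp Gg Gk) (aff_comp Gk Gg)).
  - by rewrite (nf_aM nf Gg Gk) (nf_aM nf Gk Gg) addrC.
  - by rewrite (nf_bM nf Gg Gk) (nf_bM nf Gk Gg) ag conj0 mul0r mulr0 !addr0 addrC.
  - by rewrite (nf_aM nf Gg Gk) (nf_aM nf Gk Gg) addrC.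
have := congr1 (b' \o phi) e; rewrite /= (giM iso Gg Gk) (giM iso Gk Gg) (giK' iso Gk').
rewrite (nf_bM nf' Gpg Gk') (nf_bM nf' Gk' Gpg) [b' k' + _]addrC.
exact: addrI.
Qed.

(** [km_Q] asks for a function whose polarisation is [conj (al c) * al x - be (conj c * x)]. This
    has to be symmetric in [x] and [c], which is the relation [rho]. *)
Lemma kodaira_map_exists : exists al be Q, kodaira_map G a b a' b' phi al be Q.
Proof.
have [p1 [p2 alE]] := kf_extA kf (f := fun g => a' (phi g))
  (fun g k Gg Gk => etrans (congr1 a' (giM iso Gg Gk)) (nf_aM nf' (gi_in iso Gg) (gi_in iso Gk)))
  kodaira_center.
have [|q1 [q2 beE]] := kf_extB kf (f := fun g => b' (phi g)).
  move=> g k Gg Gk ag ak; rewrite (giM iso Gg Gk).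
  by rewrite (nf_bM nf' (gi_in iso Gg) (gi_in iso Gk)) kodaira_center // conj0 mul0r addr0.
have [h1 [h2 [G1 G2 w0]]] := kf_noncommuting kf Gcpt.
(* [phi] preserves commutators. The [b]-value [w] of the commutator is imaginary, so [be] multiplies
   it by [q1 - q2], while [al] multiplies the alternating form by [|p1|^2 - |p2|^2]. *)
have rho : p1 * conjc p1 - q1 = p2 * conjc p2 - q2.
  have [m [Gm am bm mE]] := nf_commutator Gfree nf G1 G2.
  have P1 := gi_in iso G1; have P2 := gi_in iso G2; have Pm := gi_in iso Gm.
  have am' := kodaira_center Gm am.
  have := congr1 (b' \o phi) mE; rewrite /= (giM iso Gm (aff_comp G2 G1)) (giM iso G2 G1).
  rewrite (giM iso G1 G2) (nf_bM nf' Pm (aff_comp P2 P1)) (nf_bM nf' P2 P1) (nf_bM nf' P1 P2).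
  rewrite am' conj0 mul0r addr0 beE // bm !alE //; set w := _ - _ in w0 *.
  have wE : conjc w = - w by rewrite /w conjB !conjM !conjK; ring.
  move=> e; apply: (mulIf w0).
  have e' : rlin q1 q2 w = (conjc (rlin p1 p2 (a h1)) * rlin p1 p2 (a h2)
      - conjc (rlin p1 p2 (a h2)) * rlin p1 p2 (a h1)).
    apply: (@addIr _ (b' (phi h2) + b' (phi h1) + conjc (rlin p1 p2 (a h2)) * rlin p1 p2 (a h1))).
    by rewrite e; ring.
  move: e'; rewrite {1}/rlin wE => e'; apply: (@addIr _ (q1 * w + q2 * - w)).
  rewrite [in RHS]e' /rlin !(conjD, conjM) !conjK /w; ring.
pose Q2 (x : C) : C := (p1 * conjc p1 - q1) * (x * conjc x) + conjc p1 * p2 / 2 * (conjc x * conjc x)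
  + conjc p2 * p1 / 2 * (x * x).
have Q2E x c : Q2 (x + c) + rlin q1 q2 (conjc c * x) =
    Q2 x + Q2 c + conjc (rlin p1 p2 c) * rlin p1 p2 x.
  have e2 : q2 = p2 * conjc p2 - (p1 * conjc p1 - q1) by rewrite rho; ring.
  by rewrite /Q2 /rlin e2 !(conjD, conjM) !conjK; field.
(* What remains of [b' \o phi] after [be] and [Q2] is additive and vanishes on the centre, hence
   real-linear in [a]; it becomes the linear term of [Q]. *)
have [||m1 [m2 muE]] := kf_extA kf (f := fun g => b' (phi g) - rlin q1 q2 (b g) - Q2 (a g)).
- move=> g k Gg Gk; rewrite (giM iso Gg Gk) (nf_bM nf' (gi_in iso Gg) (gi_in iso Gk)).
  rewrite (nf_bM nf Gg Gk) (nf_aM nf Gg Gk) !rlinD !alE //.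
  have := Q2E (a k) (a g); rewrite [a k + _]addrC => e.
  by apply: (@addIr _ (Q2 (a g + a k) + rlin q1 q2 (conjc (a g) * a k))); rewrite {2}e; ring.
- by move=> g Gg ag; rewrite beE // ag /Q2 conj0 subrr; ring.
exists (rlin p1 p2), (rlin q1 q2), (fun x => Q2 x + rlin m1 m2 x); split.
- by exists p1, p2.
- by exists q1, q2.
- move=> u v; exists ((p1 * conjc p1 - q1) * (u * conjc v + v * conjc u)
    + conjc p1 * p2 * (conjc u * conjc v) + conjc p2 * p1 * (u * v)) => z.
  by rewrite /Q2 !rlinD !conjD; field.
- move=> f pf; have pc := cpoly_conj pf.
  apply: cpoly_add; last exact: cpoly_rlin.
  by do !apply: cpoly_add; do !(apply: cpoly_mul => //); exact: cpoly_cst.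
- exact: alE.
- exact: beE.
- move=> g x Gg; rewrite !rlinD -muE //.
  transitivity (Q2 (x + a g) + rlin q1 q2 (conjc (a g) * x) +
    (rlin m1 m2 x + b' (phi g) - Q2 (a g))); first by ring.
  by rewrite Q2E; ring.
Qed.

End KodairaPair.

Section RLinear.
Variable R : realType.
Local Notation C := (Cplx R).
Local Notation C2 := (C2 R).

Lemma rlinear_quadratic (l : C -> C) : rlinear l -> quadratic l.
Proof. by move=> [p [q ->]]; exact: quadratic_rlin. Qed.

Lemma rlinear_add (l : C -> C) x y : rlinear l -> l (x + y) = l x + l y.
Proof. by move=> [p [q ->]]; exact: rlinD. Qed.

Lemma rlinear_cpoly (l : C -> C) (f : C2 -> C) : rlinear l -> cpoly f -> cpoly (fun z => l (f z)).
Proof. by move=> [p [q ->]]; exact: cpoly_rlin. Qed.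

Lemma rlinear_quadratic_comp (l : C -> C) P : rlinear l -> quadratic P -> quadratic (fun z => l (P z)).
Proof. by move=> [p [q ->]]; exact: quadratic_rlin_comp. Qed.

Lemma rlinear_conjM_quadratic (l : C -> C) s : rlinear l -> quadratic (fun z => conjc (l z) * s).
Proof.
move=> [p [q ->]]; have := quadratic_rlin_comp s 0 (quadratic_conj (quadratic_rlin p q)).
by congr quadratic; apply/funext => z; rewrite /rlin; ring.
Qed.

End RLinear.

Section KodairaRigid.
Variable R : realType.
Local Notation C := (Cplx R).
Local Notation C2 := (C2 R).
Variables (G G' : affine_group R) (X Y : C2 -> C) (M : C -> C -> C2) (a b : (C2 -> C2) -> C).
Variables (X' Y' : C2 -> C) (M' : C -> C -> C2) (a' b' : (C2 -> C2) -> C).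
Hypothesis kf : kodaira_form G X Y M a b.
Hypothesis kf' : kodaira_form G' X' Y' M' a' b'.
Hypothesis Gcpt : compact [set: orbit_space G].
Variables (phi psi : (C2 -> C2) -> (C2 -> C2)).
Hypothesis iso : group_iso G G' phi psi.

(** The argument for tori, first on [X']. A translation by [s] in [X'] adds [conjc (a' (phi g)) * s]
    to the shift of [Y'] under [phi g], and the term [conjc (al (X z)) * s] absorbs this. *)
Lemma kodaira_rigid al be Q (f : C2 -> C2) : kodaira_map G a b a' b' phi al be Q ->
  continuous f -> antiholomorphic_curves f ->
  (forall g, aff_set G g -> f \o g = phi g \o f) ->
  exists s t, forall z, X' (f z) = al (X z) + s /\
    Y' (f z) = be (Y z) + (Q (X z) + conjc (al (X z)) * s) + t.
Proof.
move=> km fc fa fE.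
have ch := nf_chart (kf_nf kf); have ch' := nf_chart (kf_nf kf').
have fg g z : aff_set G g -> f (g z) = phi g (f z).
  by move=> Gg; exact: (congr1 (fun k => k z) (fE g Gg)).
have ac := antiholomorphic_chart ch ch' fa.
have rigid (W : C2 -> C) (P : C -> C -> C) : cpoly W ->
    (forall x, quadratic (P x)) -> (forall y, quadratic (P ^~ y)) ->
    cpoly (fun z => P (X z) (Y z)) ->
    (forall g z, aff_set G g -> W (f (g z)) - P (X (g z)) (Y (g z)) = W (f z) - P (X z) (Y z)) ->
    (forall u v, entire u -> entire v -> entire (fun t => conjc (W (f (M (u t) (v t)))))) ->
    exists s, forall z, W (f z) = P (X z) (Y z) + s.
  move=> pW Px Py pP inv We.
  have c : continuous (fun z => W (f z) - P (X z) (Y z)).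
    move=> z; apply: (@continuousB C C^o _ (fun z => W (f z)) (fun z => P (X z) (Y z))).
      by apply: continuous_comp; [exact: fc|exact: cpoly_continuous].
    exact: (cpoly_continuous pP).
  have [N NP] := invariant_bounded Gcpt c inv.
  exact: (@chart_rigid R X Y M (fun z => W (f z)) P N ch).
have [||||||s sE] := rigid X' (fun x _ => al x).
- exact: chXp ch'.
- by move=> x; exact: quadratic_cst.
- by move=> y; exact: rlinear_quadratic (km_al km).
- exact: rlinear_cpoly (km_al km) (chXp ch).
- move=> g z Gg; rewrite fg // (kf_X kf' (f z) (gi_in iso Gg)) (kf_X kf z Gg) (km_a km Gg).
  by rewrite (rlinear_add _ _ (km_al km)); ring.
- by move=> u v eu ev; exact: (ac u v eu ev).1.
have [||||||t tE] := rigid Y' (fun x y => be y + (Q x + conjc (al x) * s)).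
- exact: chYp ch'.
- move=> x; apply: quadraticD (quadratic_cst _); exact: rlinear_quadratic (km_be km).
- move=> y; apply: quadraticD (quadratic_cst _) _.
  by apply: quadraticD (km_quadratic km) _; exact: rlinear_conjM_quadratic (km_al km).
- apply: cpoly_add; first exact: rlinear_cpoly (km_be km) (chYp ch).
  apply: cpoly_add; first exact: km_cpoly km _ (chXp ch).
  apply: cpoly_mul; last exact: cpoly_cst.
  by apply: cpoly_conj; exact: rlinear_cpoly (km_al km) (chXp ch).
- move=> g z Gg; rewrite fg // (kf_Y kf' (f z) (gi_in iso Gg)) (kf_X kf z Gg) (kf_Y kf z Gg).
  rewrite sE (km_a km Gg) -addrA !(rlinear_add _ _ (km_be km)) (rlinear_add _ _ (km_al km)).
  rewrite conjD.
  have := km_Q km (X z) Gg; rewrite (rlinear_add _ _ (km_be km)).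
  move: (be (conjc _ * _)) (be (b g)) (be (Y z)) (Q (X z)) (Q (_ + _)) => u v w q q' e.
  have -> : q' = q + conjc (al (a g)) * al (X z) + b' (phi g) - (u + v) by rewrite -e; ring.
  by ring.
- by move=> u v eu ev; exact: (ac u v eu ev).2.
by exists s, t => z; rewrite sE tE.
Qed.

End KodairaRigid.

Section KodairaEquivariant.
Variable R : realType.
Local Notation C := (Cplx R).
Local Notation C2 := (C2 R).

Lemma rlinear_sub (l : C -> C) x y : rlinear l -> l (x - y) = l x - l y.
Proof. by move=> [p [q ->]]; exact: rlinB. Qed.

Lemma rlinear_opp (l : C -> C) x : rlinear l -> l (- x) = - l x.
Proof. by move=> [p [q ->]]; exact: rlinN. Qed.

Lemma rlinear_comp (l k : C -> C) : rlinear l -> rlinear k -> rlinear (fun x => l (k x)).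
Proof.
move=> [p [q ->]] [p' [q' ->]].
exists (p * p' + q * conjc q'), (p * q' + q * conjc p').
by apply/funext => x; exact: rlin_comp.
Qed.

Lemma rlinear_id : rlinear (@id C).
Proof. by exists 1, 0; apply/funext => x; rewrite /rlin; ring. Qed.

Lemma double_eq0 (x : C) : x + x = 0 -> x = 0.
Proof. by move=> /eqP; rewrite -mulr2n mulrn_eq0 /= => /eqP. Qed.

Lemma kf_rlinear_eqA (G : affine_group R) X Y M a b (l k : C -> C) :
  kodaira_form G X Y M a b -> compact [set: orbit_space G] -> rlinear l -> rlinear k ->
  (forall g, aff_set G g -> l (a g) = k (a g)) -> forall x, l x = k x.
Proof.
by move=> kf Gcpt [p [q ->]] [p' [q' ->]] H; exact: (kf_rlin_eqA kf Gcpt H).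
Qed.

Lemma kf_rlinear_eqB (G : affine_group R) X Y M a b (l k : C -> C) :
  kodaira_form G X Y M a b -> rlinear l -> rlinear k ->
  (forall g, aff_set G g -> a g = 0 -> l (b g) = k (b g)) -> forall x, l x = k x.
Proof.
by move=> kf [p [q ->]] [p' [q' ->]] H; exact: (kf_rlin_eqB kf H).
Qed.

Lemma kodaira_map_inv (G G' : affine_group R) X Y M a b X' Y' M' a' b' phi psi
    al be Q al' be' Q' :
  kodaira_form G X Y M a b -> kodaira_form G' X' Y' M' a' b' ->
  compact [set: orbit_space G] -> compact [set: orbit_space G'] ->
  group_iso G G' phi psi ->
  kodaira_map G a b a' b' phi al be Q -> kodaira_map G' a' b' a b psi al' be' Q' ->
  cancel al al' /\ cancel be be'.
Proof.
move=> kf kf' Gcpt G'cpt iso km km'; split.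
  apply: (kf_rlinear_eqA kf Gcpt (rlinear_comp (km_al km') (km_al km)) rlinear_id) => g Gg.
  by rewrite -(km_a km Gg) -(km_a km' (gi_in iso Gg)) (giK iso Gg).
apply: (kf_rlinear_eqB kf (rlinear_comp (km_be km') (km_be km)) rlinear_id) => g Gg ag.
rewrite -(km_b km Gg ag) -(km_b km' (gi_in iso Gg)) ?(giK iso Gg) //.
exact: (kodaira_center kf kf' G'cpt iso).
Qed.

(** The defect is halved once in each coordinate: [s] corrects [X'] as for tori, and then [t]
    corrects [Y'], once [F \o h] and [h' \o F] agree in [X']. The map is triangular, so it is
    inverted by solving for [X] and then for [Y]. *)
Lemma kodaira_equivariant (G G' : affine_group R) X Y M a b X' Y' M' a' b' phi psi h h' :
  fixed_point_free G -> fixed_point_free G' ->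
  compact [set: orbit_space G] -> compact [set: orbit_space G'] ->
  kodaira_form G X Y M a b -> kodaira_form G' X' Y' M' a' b' ->
  extension_data G G' phi psi h h' -> equivariant_diffeo G phi h h'.
Proof.
move=> Gfree G'free Gcpt G'cpt kf kf' ed; have iso := ed_iso ed; have iso' := group_iso_sym iso.
have ch := nf_chart (kf_nf kf); have ch' := nf_chart (kf_nf kf').
have [al [be [Q km]]] := kodaira_map_exists Gfree kf kf' Gcpt G'cpt iso.
have [al' [be' [Q' km']]] := kodaira_map_exists G'free kf' kf G'cpt Gcpt iso'.
have [alK beK] := kodaira_map_inv kf kf' Gcpt G'cpt iso km km'.
have [alK' beK'] := kodaira_map_inv kf' kf G'cpt Gcpt iso' km' km.
have [ph [qh [ih hE]]] := ed_h ed; have [ph' [qh' [ih' h'E]]] := ed_h' ed.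
have [A [B [P kA]]] := kodaira_map_exists Gfree kf kf Gcpt Gcpt ih.
have [A' [B' [P' kA']]] := kodaira_map_exists G'free kf' kf' G'cpt G'cpt ih'.
have [sh [th hXY]] := kodaira_rigid kf kf Gcpt ih kA (ed_hc ed) (ed_ha ed) hE.
have [s' [t' h'XY]] := kodaira_rigid kf' kf' G'cpt ih' kA' (ed_h'c ed) (ed_h'a ed) h'E.
have hX z := (hXY z).1; have hY z := (hXY z).2.
have h'X z := (h'XY z).1; have h'Y z := (h'XY z).2.
have alr := km_al km; have Ar := km_al kA; have A'r := km_al kA'; have B'r := km_be kA'.
have alA x : al (A x) = A' (al x).
  apply: (kf_rlinear_eqA kf Gcpt (rlinear_comp alr Ar) (rlinear_comp A'r alr)) => g Gg.
  rewrite -(km_a kA Gg) -(km_a km (gi_in ih Gg)) -(km_a km Gg) -(km_a kA' (gi_in iso Gg)).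
  by rewrite (ed_conj ed ih hE ih' h'E Gg).
have I' z w : X' z = X' w -> Y' z = Y' w -> z = w.
  by move=> e1 e2; rewrite -(chM ch' z) -(chM ch' w) e1 e2.
pose m := h \o h.
have Gm : aff_set G m := ed_hh ed.
have lin0 (l : C -> C) : rlinear l -> l 0 = 0 by move=> [p [q ->]]; exact: rlin0.
have e1 : A sh + sh = a m.
  have := kf_X kf (M 0 0) Gm.
  by rewrite /m /= !hX (chX ch) (lin0 _ Ar) !add0r.
have e2 : A' s' + s' = al (a m).
  rewrite -(km_a km Gm); have := kf_X kf' (M' 0 0) (gi_in iso Gm).
  by rewrite {1}/m (ed_phihh ed) /= !h'X (chX ch') (lin0 _ A'r) !add0r.
pose e := s' - al sh.
have A'e : A' e = - e.
  exact: (antifixed (fun x y => rlinear_sub x y alr) (fun x y => rlinear_sub x y A'r) alA e1 e2).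
have half (x : C) : x / 2 + x / 2 = x by field.
have anti_half (l : C -> C) x : rlinear l -> l x = - x -> l (x / 2) = - (x / 2).
  move=> lr lx; apply/eqP; rewrite -subr_eq0 opprK; apply/eqP/double_eq0.
  by rewrite addrACA -(rlinear_add _ _ lr) half lx addNr.
pose s := e / 2.
have A's : A' s = - s by exact: anti_half.
pose q x := Q x + conjc (al x) * s.
pose F t z := M' (al (X z) + s) (be (Y z) + q (X z) + t).
have FX t z : X' (F t z) = al (X z) + s by exact: chX ch' _ _.
have FY t z : Y' (F t z) = be (Y z) + q (X z) + t by exact: chY ch' _ _.
have Fg t g z : aff_set G g -> F t (g z) = phi g (F t z).
  move=> Gg; have Gpg := gi_in iso Gg; apply: I'.
    by rewrite FX (kf_X kf' _ Gpg) (kf_X kf _ Gg) (km_a km Gg) FX (rlinear_add _ _ alr); ring.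
  rewrite FY (kf_Y kf' _ Gpg) (kf_X kf _ Gg) (kf_Y kf _ Gg) (km_a km Gg) FX FY.
  rewrite /q -addrA !(rlinear_add _ _ (km_be km)) (rlinear_add _ _ alr) conjD.
  have := km_Q km (X z) Gg; rewrite (rlinear_add _ _ (km_be km)).
  move: (be (conjc _ * _)) (be (b g)) (be (Y z)) (Q (X z)) (Q (_ + _)) => u v w r r' e3.
  have -> : r' = r + conjc (al (a g)) * al (X z) + b' (phi g) - (u + v) by rewrite -e3; ring.
  by ring.
have FhX t z : X' (F t (h z)) = X' (h' (F t z)).
  rewrite FX hX h'X FX !(rlinear_add _ _ alr) (rlinear_add _ _ A'r) alA A's.
  have -> : s' = e + al sh by rewrite /e subrK.
  by rewrite -[e in RHS]half -/s; ring.
have qp f : cpoly f -> cpoly (fun z => q (f z)).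
  move=> pf; apply: cpoly_add; first exact: km_cpoly km _ pf.
  apply: cpoly_mul (cpoly_cst _); apply: cpoly_conj; exact: rlinear_cpoly alr pf.
have Fp t : cpoly (fun z => al (X z) + s) /\ cpoly (fun z => be (Y z) + q (X z) + t).
  split; apply: cpoly_add (cpoly_cst _); first exact: rlinear_cpoly alr (chXp ch).
  by apply: cpoly_add; [exact: rlinear_cpoly (km_be km) (chYp ch)|exact: qp (chXp ch)].
(* The defect of equivariance of [F 0] is a bounded quadratic function. *)
pose D z := Y' (F 0 (h z)) - Y' (h' (F 0 z)).
have [e3 De] : exists e3, forall z, D z = e3.
  pose P1 x y := be (B y + (P x + conjc (A x) * sh) + th) + q (A x + sh).
  pose P2 x y := B' (be y + q x) + (P' (al x + s) + conjc (A' (al x + s)) * s') + t'.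
  have DE z : D z = P1 (X z) (Y z) + - P2 (X z) (Y z).
    by rewrite /D FY hX hY h'Y FX FY !addr0 /P1 /P2.
  have qq : quadratic q.
    by apply: quadraticD (km_quadratic km) _; exact: rlinear_conjM_quadratic alr.
  have affq (l : C -> C) c r : rlinear l -> quadratic r -> quadratic (fun x => r (l x + c)).
    by move=> [p [p' ->]]; exact: quadratic_comp_affine.
  have P1x x : quadratic (P1 x).
    apply: quadraticD (quadratic_cst _); apply: rlinear_quadratic_comp (km_be km) _.
    do !apply: quadraticD (quadratic_cst _); exact: rlinear_quadratic (km_be kA).
  have P1y y : quadratic (P1 ^~ y).
    apply: quadraticD (affq _ _ _ Ar qq); apply: rlinear_quadratic_comp (km_be km) _.
    apply: quadraticD (quadratic_cst _); apply: quadraticD (quadratic_cst _) _.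
    apply: quadraticD (km_quadratic kA) _; exact: rlinear_conjM_quadratic Ar.
  have P2x x : quadratic (P2 x).
    do !apply: quadraticD (quadratic_cst _); apply: rlinear_quadratic_comp B'r _.
    apply: quadraticD (quadratic_cst _); exact: rlinear_quadratic (km_be km).
  have P2y y : quadratic (P2 ^~ y).
    apply: quadraticD (quadratic_cst _); apply: quadraticD.
      by apply: rlinear_quadratic_comp B'r _; apply: quadraticD (quadratic_cst _) qq.
    apply: (affq al s (fun w => P' w + conjc (A' w) * s') alr).
    apply: quadraticD (km_quadratic kA') _; exact: rlinear_conjM_quadratic A'r.
  have Dc : continuous D.
    have pX0 : cpoly (fun z => X' (F 0 z)) by rewrite (funext (FX 0)); exact: (Fp 0).1.
    have pY0 : cpoly (fun z => Y' (F 0 z)) by rewrite (funext (FY 0)); exact: (Fp 0).2.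
    have p2 : cpoly (fun z => Y' (h' (F 0 z))).
      rewrite (funext (fun z => h'Y (F 0 z))).
      apply: cpoly_add (cpoly_cst _); apply: cpoly_add; first exact: rlinear_cpoly B'r pY0.
      apply: cpoly_add; first exact: km_cpoly kA' _ pX0.
      apply: cpoly_mul (cpoly_cst _); apply: cpoly_conj; exact: rlinear_cpoly A'r pX0.
    move=> z; apply: (@continuousB C C^o _ (fun z => Y' (F 0 (h z))) (fun z => Y' (h' (F 0 z)))).
      apply: (@continuous_comp _ _ _ h (fun z => Y' (F 0 z))); first exact: (ed_hc ed).
      exact: cpoly_continuous pY0 _.
    exact: cpoly_continuous p2 _.
  (* Both terms of [D] are moved by the same element [ph' (phi g)], and its shift of [Y'] depends
     only on the [X']-coordinate, which agrees by [FhX]. *)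
  have DG g z : aff_set G g -> D (g z) = D z.
    move=> Gg; rewrite /D (congr1 (fun f => f z) (hE g Gg) : h (g z) = ph g (h z)).
    rewrite (Fg _ _ _ (gi_in ih Gg)) (Fg _ _ _ Gg) (ed_conj ed ih hE ih' h'E Gg).
    have Gpg := gi_in iso Gg; have Gppg := gi_in ih' Gpg.
    rewrite (congr1 (fun f => f (F 0 z)) (h'E _ Gpg) : h' (phi g (F 0 z)) = ph' (phi g) (h' (F 0 z))).
    by rewrite !(kf_Y kf' _ Gppg) FhX; ring.
  have [N NP] := invariant_bounded Gcpt Dc DG.
  pose P3 x y := P1 x y + - P2 x y.
  have P3N x y : cabs (P3 x y) <= N.
    by have := NP (M x y); rewrite DE (chX ch) (chY ch).
  have quadraticN r : quadratic r -> quadratic (fun x => - r x).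
    move=> rq; have := quadratic_rlin_comp (-1) 0 rq; congr quadratic.
    by apply/funext => x; rewrite /rlin; ring.
  have P3x x : quadratic (P3 x) by apply: quadraticD (P1x x) _; exact: quadraticN.
  have P3y y : quadratic (P3 ^~ y) by apply: quadraticD (P1y y) _; exact: quadraticN.
  exists (P3 0 0) => z; rewrite DE -/(P3 (X z) (Y z)).
  rewrite (bounded_quadratic (P3x (X z)) (P3N (X z))).
  exact: (@bounded_quadratic R (P3 ^~ 0) N (P3y 0) (P3N ^~ 0)).
(* On a fibre of [X'], [h'] is affine in [Y'] with linear part [B']. *)
have Y'h w w' d : X' w = X' w' -> Y' w = Y' w' + d -> Y' (h' w) = Y' (h' w') + B' d.
  by move=> eX eY; rewrite !h'Y eX eY (rlinear_add _ _ B'r); ring.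
have Y'F0 z : Y' (F 0 (h z)) = Y' (h' (F 0 z)) + e3 by rewrite -(De z) /D addrC subrK.
(* Two passages through [h] give the defect [e3 + B' e3], which is 0 because [h \o h] lies in [G]
   and [F 0] is equivariant for [G]. *)
have B'e3 : B' e3 = - e3.
  pose z := M 0 0; have hm : F 0 (h (h z)) = h' (h' (F 0 z)).
    have := Fg 0 m z Gm; rewrite {2}/m (ed_phihh ed); exact.
  have := Y'F0 (h z); rewrite hm (Y'h _ _ _ (FhX 0 z) (Y'F0 z)) -addrA => e4.
  apply/eqP; rewrite -subr_eq0 opprK; apply/eqP.
  by apply: (@addrI _ (Y' (h' (h' (F 0 z))))); rewrite addr0 -e4.
(* Adding [t] to [Y'] changes the defect by [t - B' t], which is [t + t]. *)
pose t := - (e3 / 2).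
have B't : B' t = - t by rewrite /t (rlinear_opp _ B'r) (anti_half _ _ B'r B'e3).
have FtY z : Y' (F t z) = Y' (F 0 z) + t by rewrite !FY; ring.
have Fh z : F t (h z) = h' (F t z).
  apply: I'; first exact: FhX.
  rewrite FtY Y'F0 (Y'h (F t z) (F 0 z) t) ?FX ?FtY // B't -addrA; congr (_ + _).
  by rewrite -[e3]half /t; ring.
pose F' z := let x := al' (X' z - s) in M x (be' (Y' z - q x - t)).
have F'X z : X (F' z) = al' (X' z - s) by exact: chX ch _ _.
have F'Y z : Y (F' z) = be' (Y' z - q (al' (X' z - s)) - t) by exact: chY ch _ _.
exists (F t), F'; split.
- move=> z; rewrite -[LHS](chM ch) -[RHS](chM ch) F'X F'Y FX FY addrK alK; congr (M _ _).
  by transitivity (be' (be (Y z))); [congr (be' _); ring|exact: beK].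
- move=> z; apply: I'; first by rewrite FX F'X alK' subrK.
  by rewrite FY F'X F'Y beK'; ring.
- have [p1 p2] := Fp t; have [p3 p4] := chMp ch' p1 p2; exact: cpoly_smooth p3 p4.
- have p1 : cpoly (fun z => al' (X' z - s)).
    by apply: rlinear_cpoly (km_al km') _; apply: cpoly_add (chXp ch') (cpoly_cst _).
  have p2 : cpoly (fun z => be' (Y' z - q (al' (X' z - s)) - t)).
    apply: rlinear_cpoly (km_be km') _; apply: cpoly_add (cpoly_cst _).
    by apply: cpoly_add (chYp ch') _; apply: cpoly_opp; exact: qp p1.
  have [p3 p4] := chMp ch p1 p2; exact: cpoly_smooth p3 p4.
- by split=> [g Gg|]; apply/funext => z /=; [exact: Fg|exact: Fh].
Qed.

End KodairaEquivariant.

(** * The differentiable type *)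

(** The two products always agree in [a] and [c]; in [b] they differ by the two sides of the
    equation. *)
Lemma nf_commute (R : realType) (G : affine_group R) X Y M a b c g k :
  nform G X Y M a b c -> aff_set G g -> aff_set G k ->
  c g * a k = c k * a g <-> g \o k = k \o g.
Proof.
move=> nf Gg Gk; split=> [e|/(congr1 b)].
  apply: (nf_inj nf (aff_comp Gg Gk) (aff_comp Gk Gg)).
  - by rewrite (nf_aM nf Gg Gk) (nf_aM nf Gk Gg) addrC.
  - by rewrite (nf_bM nf Gg Gk) (nf_bM nf Gk Gg) e [b k + _]addrC.
  - by rewrite (nf_cM nf Gg Gk) (nf_cM nf Gk Gg) addrC.
rewrite (nf_bM nf Gg Gk) (nf_bM nf Gk Gg) [b k + _]addrC; exact: addrI.
Qed.

Lemma extension_data_exists (R : realType) (G G' : affine_group R)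
    (sigma : orbit_space G -> orbit_space G) (sigma' : orbit_space G' -> orbit_space G') :
  properly_discontinuous G -> fixed_point_free G -> real_structure sigma ->
  properly_discontinuous G' -> fixed_point_free G' -> real_structure sigma' ->
  orb_extension_iso sigma sigma' ->
  exists phi psi h h', [/\ extension_data G G' phi psi h h', liftings sigma h &
    liftings sigma' h'].
Proof.
move=> Gpd Gfree sr G'pd G'free sr' ext.
have [phi [h [h' [hL h'L Gphi phiS [phiM phiI phihh comm]]]]] :=
  extension_iso_lifting Gpd Gfree G'pd G'free sr sr' ext.
have ex g' : exists g, aff_set G' g' -> aff_set G g /\ phi g = g'.
  have [Gg'|ng'] := pselect (aff_set G' g'); last by exists id.
  by have [g Gg e] := phiS g' Gg'; exists g.
have [psi psiP] := choice ex.
have [_ hiso] := lifting_iso Gpd Gfree sr hL.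
have [h'surj h'iso] := lifting_iso G'pd G'free sr' h'L.
exists phi, psi, h, h'; split => //; split => //.
- split => //.
  + by move=> g /psiP[].
  + move=> g Gg; have [Gpg e] := psiP _ (Gphi g Gg); exact: phiI.
  + by move=> g /psiP[].
- exact: hL.1.
- exact: h'L.1.
- by move=> f; exact: (lifting_antiholomorphic Gpd Gfree sr hL).
- by move=> f; exact: (lifting_antiholomorphic G'pd G'free sr' h'L).
- exact: (lifting_square Gpd Gfree sr hL).
Qed.

Lemma extension_equivariant (R : realType) (G G' : affine_group R) phi psi h h' :
  primary_Kodaira G -> primary_Kodaira G' -> extension_data G G' phi psi h h' ->
  equivariant_diffeo G phi h h'.
Proof.
move=> [Gpd Gfree Gvol Gcpt _] [G'pd G'free G'vol G'cpt _] ed.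
have iso := ed_iso ed.
have [X [Y [M [a [b [c nf]]]]]] := nform_exists Gfree Gvol.
have [X' [Y' [M' [a' [b' [c' nf']]]]]] := nform_exists G'free G'vol.
(* Commutativity passes through [phi], so both groups receive the same type of normal form. *)
have [comm|ncomm] := pselect (forall g k, aff_set G g -> aff_set G k -> g \o k = k \o g).
  have comm' g k : aff_set G' g -> aff_set G' k -> g \o k = k \o g.
    move=> Gg Gk; have Gg' := gi_in' iso Gg; have Gk' := gi_in' iso Gk.
    rewrite -(giK' iso Gg) -(giK' iso Gk) -(giM iso Gg' Gk') -(giM iso Gk' Gg').
    by rewrite comm.
  have [Y1 [M1 [b1 tf]]] := torus_form_exists Gpd Gcpt nf
    (fun g k Gg Gk => (nf_commute nf Gg Gk).2 (comm g k Gg Gk)).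
  have [Y2 [M2 [b2 tf']]] := torus_form_exists G'pd G'cpt nf'
    (fun g k Gg Gk => (nf_commute nf' Gg Gk).2 (comm' g k Gg Gk)).
  exact: (torus_equivariant Gcpt G'cpt tf tf' ed).
have [g [k [Gg Gk gk]]] : exists g k, [/\ aff_set G g, aff_set G k & g \o k <> k \o g].
  apply: contrapT => no; apply: ncomm => g k Gg Gk; apply: contrapT => gk.
  by apply: no; exists g, k.
have Gpg := gi_in iso Gg; have Gpk := gi_in iso Gk.
have gk' : phi g \o phi k <> phi k \o phi g.
  rewrite -(giM iso Gg Gk) -(giM iso Gk Gg) => /(congr1 psi).
  by rewrite !(giK iso) //; exact: aff_comp.
have n1 : c g * a k != c k * a g.
  by apply/eqP => e; apply: gk; exact: (nf_commute nf Gg Gk).1 e.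
have n2 : c' (phi g) * a' (phi k) != c' (phi k) * a' (phi g).
  by apply/eqP => e; apply: gk'; exact: (nf_commute nf' Gpg Gpk).1 e.
have [Y1 [M1 [b1 kf]]] := kodaira_form_exists Gpd Gfree Gcpt nf Gg Gk n1.
have [Y2 [M2 [b2 kf']]] := kodaira_form_exists G'pd G'free G'cpt nf' Gpg Gpk n2.
exact: (kodaira_equivariant Gfree G'free Gcpt G'cpt kf kf' ed).
Qed.

Theorem theorem0p1 (R : realType) (G G' : affine_group R)
    (sigma : orbit_space G -> orbit_space G)
    (sigma' : orbit_space G' -> orbit_space G') :
  primary_Kodaira G -> real_structure sigma ->
  primary_Kodaira G' -> real_structure sigma' ->
  orb_extension_iso sigma sigma' ->
  exists f : orbit_space G -> orbit_space G',
    diffeomorphism f /\ (forall x, f (sigma x) = sigma' (f x)).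
Proof.
move=> GK sr GK' sr' ext.
have [Gpd Gfree _ _ _] := GK; have [G'pd G'free _ _ _] := GK'.
have [phi [psi [h [h' [ed hL h'L]]]]] :=
  extension_data_exists Gpd Gfree sr G'pd G'free sr' ext.
have [F [F' [FK F'K sF sF' [FE Fh]]]] := extension_equivariant GK GK' ed.
apply: (equivariant_diffeomorphism FK F'K sF sF' (gi_in (ed_iso ed)) _ FE hL h'L Fh) => g' Gg'.
by exists (psi g'); [exact: gi_in' (ed_iso ed) _ Gg'|exact: giK' (ed_iso ed) _ Gg'].
Qed.
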